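(* For positive integers $n,k$, let $\Gamma_{n,k}$ be a uniformly distributed random element of the (finite) set of convex chains on $\left(\frac1n\mathbb{Z}\cap[0,1]\right)^2$ joining $(0,0)$ to $(1,1)$ with at most $k$ vertices. Let $$\mathcal{P}=\{(x,y)\in[0,1]^2:\sqrt{y}+\sqrt{1-x}=1\}.$$ Then the Hausdorff distance between $\Gamma_{n,k}$ and the arc of parabola $\mathcal{P}$ converges to $0$ in probability when both $n$ and $k$ tend to $+\infty$ (with no restriction on their relative growth).
   Context: A convex chain on $\left(\frac1n\mathbb{Z}\cap[0,1]\right)^2$ joining $(0,0)$ to $(1,1)$ is the image under $z\mapsto z/n$ of a planar polygonal chain which starts at $(0,0)$, ends at $(n,n)$, has all its vertices in $\mathbb{Z}^2$, and whose successive edges have strictly increasing slopes in $[0,+\infty]$ (each edge makes an angle in $[0,\pi/2]$ with the horizontal axis). Vertices are only the points where the slope changes and the extremities; the number of vertices is counted as the number of edges (the starting point is not counted). *)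

(* Defs.v *)
From HB Require Import structures.
From mathcomp Require Import all_boot all_order all_algebra.
From mathcomp Require Import all_classical all_reals all_analysis.

Set Implicit Arguments.
Unset Strict Implicit.
Unset Printing Implicit Defensive.

Import Order.TTheory GRing.Theory Num.Theory.
Import numFieldNormedType.Exports.

Local Open Scope classical_set_scope.
Local Open Scope ring_scope.

(* The lattice square (Z `&` [0, n])^2; scaling by 1/n sends it to
   ((1/n)Z `&` [0, 1])^2. *)
Definition grid (n : nat) := ('I_n.+1 * 'I_n.+1)%type.

Definition grid_origin (n : nat) : grid n := (ord0, ord0).

Definition edge (n : nat) (p q : grid n) : int * int :=
  ((q.1 : nat)%:Z - (p.1 : nat)%:Z, (q.2 : nat)%:Z - (p.2 : nat)%:Z).

Definition slope (e : int * int) : \bar rat :=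
  if e.1 == 0 then +oo%E else (e.2%:~R / e.1%:~R)%:E.

(* A chain is given by its successive vertices, the starting point (0, 0)
   being left out, so that [size c] is both its number of edges and its number
   of vertices in the convention that does not count the starting point. *)
Definition edges (n : nat) (c : seq (grid n)) : seq (int * int) :=
  pairmap (@edge n) (grid_origin n) c.

(* Slopes in [0, +oo] mean that edges are nonzero vectors of the closed first
   quadrant; their strict increase makes every listed interior point a genuine
   vertex, so that distinct lists describe distinct chains. *)
Definition convex_chain (n : nat) (c : seq (grid n)) : bool :=
  [&& last (grid_origin n) c == (ord_max, ord_max),
      all (fun e => [&& 0 <= e.1, 0 <= e.2 & e != (0, 0)]) (edges c)
    & sorted (fun e f => (slope e < slope f)%O) (edges c)].

Section Plane.
Context {R : realType}.

Definition euclidean_dist (a b : R * R) : R :=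
  Num.sqrt ((a.1 - b.1) ^+ 2 + (a.2 - b.2) ^+ 2).

Definition segment (a b : R * R) : set (R * R) :=
  [set (line_path a.1 b.1 t, line_path a.2 b.2 t) | t in `[0, 1]].

(* Extended-real valued, so that suprema and infima need no side condition. *)
Definition hausdorff_dist (A B : set (R * R)) : \bar R :=
  Order.max
    (ereal_sup [set ereal_inf [set (euclidean_dist a b)%:E | b in B] | a in A])
    (ereal_sup [set ereal_inf [set (euclidean_dist a b)%:E | a in A] | b in B]).

Definition scaled_point (n : nat) (p : grid n) : R * R :=
  (p.1%:R / n%:R, p.2%:R / n%:R).

Definition chain_curve (n : nat) (c : seq (grid n)) : set (R * R) :=
  [set z | exists2 pq, pq \in zip (grid_origin n :: c) c
                     & segment (scaled_point pq.1) (scaled_point pq.2) z].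

Definition parabola_arc : set (R * R) :=
  [set z | [/\ 0 <= z.1 <= 1, 0 <= z.2 <= 1
             & Num.sqrt z.2 + Num.sqrt (1 - z.1) = 1]].

(* Probability of the event E under the uniform distribution on the convex
   chains with at most k vertices. *)
Definition chain_prob (n k : nat) (E : pred (seq (grid n))) : R :=
  #|[pred c : k.-bseq (grid n) | convex_chain c & E c]|%:R
  / #|[pred c : k.-bseq (grid n) | convex_chain c]|%:R.

End Plane.

(* Main.v *)
Require Import Defs.
From mathcomp Require Import all_boot all_order all_algebra.
From mathcomp Require Import all_classical all_reals all_analysis.
From mathcomp Require Import ring lra zify.
Set Implicit Arguments.
Unset Strict Implicit.
Unset Printing Implicit Defensive.
Import Order.TTheory GRing.Theory Num.Theory.
Import numFieldNormedType.Exports.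
Local Open Scope ring_scope.

(* A chain is a finite set of edges with distinct directions, hence a map w from
   primitive vectors to multiplicities. Under the Gibbs weights
   lam ^ (number of edges) * exp (- beta * (total l1-length)), the multiplicities
   of distinct directions are independent. Parametrising directions as
   (1 - t, t), equidistribution of primitive vectors gives every arc of length
   1 / N of [0, 1] about the same l1-length 2 n / N, and the curve with this
   property is (2 t - t ^ 2, t ^ 2), which is the arc of parabola. Chernoff
   bounds make a deviation exponentially unlikely in Phi = log Z. It remains to
   see that few chains are lost by imposing the endpoint (n, n) and the number k
   of edges: configurations of at most k - 1 edges avoiding a few directions near
   the diagonal are completed by one edge in these directions, and conversely
   deleting an edge from a chain is injective. Taking beta with Phi = beta n and
   lam making k - 1 the mode of the number of edges (or lam = 1) treats all
   regimes of n and k at once, as Phi tends to infinity with both. *)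

(** * Divisor sums *)

(** Conditioning on the exact endpoint would normally call for a local limit theorem. It is avoided
    by accepting an exponential loss, provided that it is smaller than the Chernoff gain. Write Phi
    = beta * n. A configuration of at most K + 1 edges and total length at most 2 n has Gibbs weight
    at least lam ^ (K + 1) * exp (- 2 Phi), out of a total mass exp Phi. So there are at most lam ^
    - (K + 1) * exp (3 Phi) of them, and those with one overlong cone fall short of this by a factor
    exp (- c1 Phi), where c1 is fixed by eps before n and k. Conversely, forbidding a proportion 1 /
    s of the directions, around the diagonal, and asking for balanced lengths still leaves lam ^ -
    (K + 1) * exp (3 Phi - 6 Phi / s) configurations, up to a polynomial in Phi, and each can be
    completed to a chain. As s is chosen after c1, the loss 6 / s can be made smaller than c1; the
    factor lam ^ (K + 1) cancels in the quotient. *)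

Lemma sum_inv_sqr_le (R : realFieldType) (l : nat) :
  \sum_(2 <= d < l.+1) (d%:R ^- 2 : R) <= 3 / 4.
Proof.
case: l => [|[|l]]; try by rewrite big_geq //; lra.
(* The bound is strengthened by the tail 1 / (l + 2) so that the induction closes, through 1 / (x +
   1) ^ 2 <= 1 / x - 1 / (x + 1). *)
suff: \sum_(2 <= d < l.+3) (d%:R ^- 2 : R) <= 3 / 4 - l.+2%:R^-1.
  move/le_trans; apply; rewrite gerBl invr_ge0; exact: ler0n.
elim: l => [|l IH]; first by rewrite big_nat1; lra.
rewrite big_nat_recr //=.
have h1 : (0 : R) < l.+2%:R by rewrite ltr0n.
have h2 : l.+3%:R = l.+2%:R + 1 :> R by rewrite -natr1.
rewrite -exprVn h2; move: IH h1; move: (\sum_(_ <= _ < _) _) => S.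
move: (l.+2%:R : R) => x IH h1.
have : (x + 1)^-1 ^+ 2 <= x^-1 - (x + 1)^-1.
  rewrite -subr_ge0.
  have -> : x^-1 - (x + 1)^-1 - (x + 1)^-1 ^+ 2 = (x * (x + 1) ^+ 2)^-1.
    by field; apply/andP; split; lra.
  by rewrite invr_ge0; nra.
lra.
Qed.

Section DivisorSums.
Variable R : archiRealFieldType.

Lemma geometric_small (a e : R) : 0 < e -> exists j, (7 / 8) ^+ j * a <= e.
Proof.
move=> e0; exists (Num.bound `|7 * a / e|).
set j := Num.bound _.
have hj : 7 * a / e <= j%:R.
  by apply/ltW/(le_lt_trans (ler_norm _))/archi_boundP/normr_ge0.
have bern m : 1 + m%:R / 7 <= ((8 / 7) ^+ m : R).
  elim: m => [|m IH]; first by rewrite expr0 mul0r addr0.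
  rewrite exprS -natr1.
  have : (0 : R) <= m%:R by exact: ler0n.
  by move: IH; move: (_ ^+ m) (m%:R : R) => y x; nra.
have hp : ((7 / 8) ^+ j * (8 / 7) ^+ j : R) = 1.
  by rewrite -exprMn (_ : 7 / 8 * (8 / 7) = 1 :> R) ?expr1n //; field.
have p0 : 0 < ((7 / 8) ^+ j : R) by apply: exprn_gt0; lra.
have : a <= e * (8 / 7) ^+ j.
  rewrite ler_pdivrMr // in hj; have := bern j.
  by move: hj; move: (_ ^+ j) (j%:R : R) => y x; nra.
move=> h; rewrite -(ler_pM2l p0) in h.
by rewrite (le_trans h) // mulrCA hp mulr1.
Qed.

Lemma divn_sqr_le (l d : nat) : (0 < d)%N ->
  ((l %/ d)%N%:R ^+ 2 <= l%:R ^+ 2 * d%:R ^- 2 :> R).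
Proof.
move=> d0; rewrite -exprVn -exprMn ler_pXn2r ?nnegrE ?mulr_ge0 ?invr_ge0 ?ler0n //.
by rewrite ler_pdivlMr ?ltr0n // -natrM ler_nat leq_trunc_div.
Qed.

(* Moebius inversion is avoided: as sum_(d >= 2) d^-2 < 1, a bound rho l^2 on g
   improves itself by a constant factor at each use of the divisor identity. *)
Lemma little_o_of_divisor_sum (g : nat -> R) (C : R) :
  (forall l, `|\sum_(1 <= d < l.+1) g (l %/ d)%N| <= C * l%:R) ->
  (forall l, `|g l| <= C * l%:R ^+ 2) ->
  forall rho, 0 < rho -> exists K, forall l, `|g l| <= rho * l%:R ^+ 2 + K.
Proof.
move=> hs hg rho rho0.
have C0 : 0 <= C by have := hg 1%N; rewrite expr1n mulr1; apply: le_trans.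
(* 7 / 8 is 3 / 4 + 1 / 8: the terms d >= 2 contribute 3 / 4 of r, and the linear terms are absorbed
   into r / 8 * l ^ 2 plus a constant by completing a square. *)
have step r K : 0 < r -> (forall l, `|g l| <= r * l%:R ^+ 2 + K) ->
    exists K', forall l, `|g l| <= 7 / 8 * r * l%:R ^+ 2 + K'.
  move=> r0 h; exists (`|K| + 2 * (C + `|K|) ^+ 2 / r); case=> [|l].
    have := h 0%N; rewrite expr0n /= !mulr0 !add0r.
    move/le_trans; apply.
    rewrite (le_trans (ler_norm _)) // lerDl mulr_ge0 ?invr_ge0 ?(ltW r0) //.
    by rewrite mulr_ge0 // sqr_ge0.
  have := hs l.+1; rewrite big_nat_recl //= divn1 => h1.
  have h2 : `|\sum_(1 <= d < l.+1) g (l.+1 %/ d.+1)%N| <=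
      r * l.+1%:R ^+ 2 * (3 / 4) + `|K| * l.+1%:R.
    rewrite (le_trans (ler_norm_sum _ _ _)) //.
    apply: (@le_trans _ _ (\sum_(1 <= d < l.+1)
        (r * l.+1%:R ^+ 2 * d.+1%:R ^- 2 + `|K|))).
      apply: ler_sum => d _; rewrite (le_trans (h _)) //.
      rewrite lerD ?ler_norm // -mulrA ler_pM2l //; exact: divn_sqr_le.
    rewrite big_split /= -mulr_sumr lerD //.
      rewrite ler_pM2l; last by rewrite mulr_gt0 // exprn_gt0 // ltr0n.
      have := sum_inv_sqr_le R l.+1.
      by rewrite big_add1 /=.
    rewrite sumr_const_nat -[X in X <= _]mulr_natr ler_wpM2l ?normr_ge0 // ler_nat.
    lia.
  have h3 : `|g l.+1| <= C * l.+1%:R + (r * l.+1%:R ^+ 2 * (3 / 4) + `|K| * l.+1%:R).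
    set S := \sum_(_ <= _ < _) _ in h1 h2.
    rewrite -[g _](addrK S) (le_trans (ler_normB _ _)) // lerD //.
  apply: (le_trans h3).
  have K0 := normr_ge0 K; move: K0; move: `|K| => k k0.
  move: (l.+1%:R : R) => x.
  suff : (C + k) * x <= r / 8 * x ^+ 2 + 2 * (C + k) ^+ 2 / r by lra.
  rewrite -subr_ge0.
  have -> : r / 8 * x ^+ 2 + 2 * (C + k) ^+ 2 / r - (C + k) * x =
     (r * x - 4 * (C + k)) ^+ 2 / (8 * r) by field; rewrite gt_eqF.
  by rewrite mulr_ge0 ?sqr_ge0 // invr_ge0; lra.
have C1 : 0 < C + 1 by lra.
have iter j : exists K, forall l, `|g l| <= (7 / 8) ^+ j * (C + 1) * l%:R ^+ 2 + K.
  elim: j => [|j [K hK]].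
    exists 0 => l; rewrite expr0 mul1r addr0 (le_trans (hg l)) //.
    by apply: ler_wpM2r; rewrite ?sqr_ge0 // lerDl.
  have [|K' hK'] := step _ K _ hK.
    by rewrite mulr_gt0 // exprn_gt0 //; lra.
  by exists K' => l; rewrite exprS -!mulrA; have := hK' l; rewrite -!mulrA.
have [j hj] := geometric_small (C + 1) rho0.
have [K hK] := iter j; exists K => l; rewrite (le_trans (hK l)) // lerD2r.
by apply: ler_wpM2r; rewrite ?sqr_ge0.
Qed.

End DivisorSums.

(** * Primitive vectors in cones *)

Definition lattice_count (C : nat -> nat -> bool) (M : nat) : nat :=
  #|[pred x : 'I_M.+1 * 'I_M.+1 | (0 < x.1 + x.2 <= M)%N && C x.1 x.2]|.

Definition primitive_count (C : nat -> nat -> bool) : nat -> nat :=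
  lattice_count (fun a b => coprime a b && C a b).

Definition row_count (C : nat -> nat -> bool) (m : nat) : nat :=
  #|[pred b : 'I_m.+1 | C (m - b)%N b]|.

(** Lattice vectors are sorted by their gcd d: dividing by d is a bijection onto the primitive
    vectors of length at most M / d, and it preserves the cone. *)
Lemma lattice_count_primitive (C : nat -> nat -> bool) (M : nat) :
  (forall d a b, (0 < d)%N -> C (d * a)%N (d * b)%N = C a b) ->
  lattice_count C M = (\sum_(1 <= d < M.+1) primitive_count C (M %/ d))%N.
Proof.
move=> hC.
rewrite /lattice_count -sum1_card.
rewrite (partition_big (fun x : 'I_M.+1 * 'I_M.+1 => inord (gcdn x.1 x.2) : 'I_M.+1)
   predT) //=.
have gM (x : 'I_M.+1 * 'I_M.+1) : (0 < x.1 + x.2 <= M)%N ->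
    (0 < gcdn x.1 x.2 <= M)%N.
  case/andP => h1 h2; rewrite gcdn_gt0.
  have := @dvdn_leq (gcdn x.1 x.2) (x.1 + x.2) h1.
  rewrite dvdn_add ?dvdn_gcdl ?dvdn_gcdr // => /(_ isT) h.
  by rewrite (leq_trans h h2) andbT; lia.
transitivity (\sum_(0 <= d < M.+1) \sum_(x : 'I_M.+1 * 'I_M.+1 |
  (0 < x.1 + x.2 <= M)%N && C x.1 x.2 && (inord (gcdn x.1 x.2) == inord d :> 'I_M.+1)) 1)%N.
  by rewrite big_mkord; apply: eq_bigr => d _; rewrite inord_val.
rewrite big_ltn //= big1 ?add0n => [|x /andP[/andP[h _] /eqP]]; last first.
  move=> /(congr1 val) /=; have /andP[g1 g2] := gM _ h.
  by rewrite !inordK // => g0; rewrite g0 in g1.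
apply: eq_big_nat => d /andP[d1 dM].
rewrite sum1_card /primitive_count /lattice_count.
have qM : ((M %/ d) <= M)%N by exact: leq_div.
pose f (y : 'I_(M %/ d).+1 * 'I_(M %/ d).+1) : 'I_M.+1 * 'I_M.+1 :=
  (inord (d * y.1), inord (d * y.2)).
have fE (i : 'I_(M %/ d).+1) : (inord (d * i) : 'I_M.+1) = (d * i)%N :> nat.
  rewrite inordK // ltnS (leq_trans _ (leq_trunc_div M d)) // mulnC leq_mul2r.
  by rewrite -ltnS ltn_ord orbT.
rewrite -(card_in_imset (f := f)); last first.
  move=> y z _ _ [] /(congr1 val) /= h1 /(congr1 val) /= h2.
  move: h1 h2; rewrite !fE => /eqP; rewrite eqn_pmul2l // => /eqP h1 /eqP.
  rewrite eqn_pmul2l // => /eqP h2.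
  by case: y z h1 h2 => [y1 y2] [z1 z2] /= h1 h2; congr (_, _); exact: val_inj.
apply: eq_card => x; apply/idP/imsetP; rewrite unfold_in /=.
  case/andP=> /andP[h hc] /eqP /(congr1 val) /=.
  have /andP[g1 g2] := gM _ h; rewrite !inordK // => gd.
  have /andP[h1 h2] := h.
  have d_x1 : (d %| x.1)%N by rewrite -gd dvdn_gcdl.
  have d_x2 : (d %| x.2)%N by rewrite -gd dvdn_gcdr.
  have e1 : (x.1 %/ d * d = x.1)%N by rewrite divnK.
  have e2 : (x.2 %/ d * d = x.2)%N by rewrite divnK.
  have q1 : ((x.1 %/ d)%N < (M %/ d).+1)%N by rewrite ltnS leq_div2r // (leq_trans _ h2) ?leq_addr.
  have q2 : ((x.2 %/ d)%N < (M %/ d).+1)%N by rewrite ltnS leq_div2r // (leq_trans _ h2) ?leq_addl.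
  exists (Ordinal q1, Ordinal q2) => /=.
    rewrite unfold_in /= -(hC d) // !(mulnC d) e1 e2 hc andbT.
    rewrite leq_divRL // mulnDl e1 e2.
    apply/andP; split; first by nia.
    rewrite /coprime -(eqn_pmul2r d1) mul1n muln_gcdl e1 e2.
    by rewrite gd.
  rewrite /f /=; case: x {h h1 h2 hc g1 g2 gd d_x1 d_x2 q1 q2} e1 e2 => a b /= e1 e2.
  by congr (_, _); apply: val_inj; rewrite /= inordK mulnC ?e1 ?e2 ?ltn_ord.
case=> y; rewrite unfold_in /= => /andP[/andP[h1 h2] /andP[cop hc]] ->.
rewrite /f /= !fE hC // hc andbT -mulnDr muln_gt0 d1 h1 /= mulnC -leq_divRL // h2 /=.
by rewrite -muln_gcdr (eqP cop) muln1.
Qed.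

Lemma lattice_count_rows (C : nat -> nat -> bool) (M : nat) :
  lattice_count C M = (\sum_(1 <= m < M.+1) row_count C m)%N.
Proof.
rewrite /lattice_count -sum1_card.
rewrite (partition_big (fun x : 'I_M.+1 * 'I_M.+1 => inord (x.1 + x.2) : 'I_M.+1)
   predT) //=.
transitivity (\sum_(0 <= m < M.+1) \sum_(x : 'I_M.+1 * 'I_M.+1 |
  (0 < x.1 + x.2 <= M)%N && C x.1 x.2 && (inord (x.1 + x.2) == inord m :> 'I_M.+1)) 1)%N.
  by rewrite big_mkord; apply: eq_bigr => m _; rewrite inord_val.
rewrite big_ltn //= big1 ?add0n => [|x /andP[/andP[/andP[h1 h2] _] /eqP]]; last first.
  by move=> /(congr1 val) /=; rewrite !inordK // => g0; rewrite g0 in h1.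
apply: eq_big_nat => m /andP[m1 mM].
rewrite sum1_card /row_count.
pose f (b : 'I_m.+1) : 'I_M.+1 * 'I_M.+1 := (inord (m - b), inord b).
have f1 (b : 'I_m.+1) : (inord (m - b) : 'I_M.+1) = (m - b)%N :> nat.
  by rewrite inordK // ltnS (leq_trans (leq_subr _ _)).
have f2 (b : 'I_m.+1) : (inord b : 'I_M.+1) = b :> nat.
  by rewrite inordK // (leq_trans (ltn_ord b)).
rewrite -(card_in_imset (f := f)); last first.
  by move=> y z _ _ [] _ /(congr1 val) /=; rewrite !f2 => h; apply: val_inj.
apply: eq_card => x; apply/idP/imsetP; rewrite unfold_in /=.
  case/andP=> /andP[/andP[h1 h2] hc] /eqP /(congr1 val) /=.
  rewrite !inordK // => gd.
  have q2 : (x.2 < m.+1)%N by rewrite ltnS -gd leq_addl.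
  have e1 : (m - x.2 = x.1)%N by rewrite -gd addnK.
  exists (Ordinal q2); first by rewrite unfold_in /= e1.
  rewrite /f /= e1; case: x {h1 h2 hc gd q2 e1} => a b /=.
  by rewrite !inord_val.
case=> b; rewrite unfold_in /= => hc ->.
have bm : (b <= m)%N by rewrite -ltnS.
by rewrite /f /= !f1 !f2 hc subnK // m1 -ltnS mM eqxx.
Qed.

(** Summing a * m over the rows gives a * M * (M + 1) / 2; the excess a * M / 2 and the row errors 2
    * M together stay below 3 * M. *)
Lemma lattice_count_approx (R : realFieldType) (C : nat -> nat -> bool) (a : R) :
  0 <= a <= 1 ->
  (forall m, (0 < m)%N -> `|(row_count C m)%:R - a * m%:R| <= 2) ->
  forall M, `|(lattice_count C M)%:R - a * M%:R ^+ 2 / 2| <= 3 * M%:R.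
Proof.
move=> a01 h; elim=> [|M IH].
  by rewrite lattice_count_rows big_geq // expr0n /= !mulr0 mul0r subrr normr0.
rewrite lattice_count_rows big_nat_recr //= -lattice_count_rows natrD -(natr1 M).
have := h M.+1 isT; rewrite -(natr1 M); move: IH; rewrite !ler_norml.
move: ((lattice_count _ _)%:R : R) (M%:R : R) (_%:R : R) => S m r; nra.
Qed.

Definition all_directions (a b : nat) := true.

Lemma row_count_all (m : nat) : row_count all_directions m = m.+1.
Proof. by rewrite /row_count card_ord. Qed.

Lemma primitive_count_all_ge (M : nat) :
  (M ^ 2 <= 32 * primitive_count all_directions M)%N.
Proof.
(* The axes are dropped so that the lattice count is M * (M - 1) / 2, hence at most M ^ 2 / 2: the
   non-primitive vectors then number at most 3 / 8 of M ^ 2, with no linear term to sum over d. *)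
pose P (a b : nat) := (0 < a)%N && (0 < b)%N.
have hP d a b : (0 < d)%N -> P (d * a)%N (d * b)%N = P a b.
  by move=> d0; rewrite /P !muln_gt0 d0.
have rowP m : row_count P m = m.-1.
  case: m => [|[|m]]; rewrite /row_count.
  - by apply: eq_card0 => -[[|b] hb]; rewrite unfold_in /P.
  - by apply: eq_card0 => -[[|[|b]] hb]; rewrite unfold_in /P.
  pose f (i : 'I_m.+1) : 'I_m.+3 := inord i.+1.
  have fE (i : 'I_m.+1) : f i = i.+1 :> nat.
    by rewrite inordK //; case: i => i /=; lia.
  rewrite -[RHS]card_ord -(card_imset (f := f)); last first.
    by move=> i j h; have := fE i; rewrite h fE => -[] /val_inj.
  apply: eq_card => b; apply/idP/imsetP; rewrite unfold_in /= /P.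
    case/andP=> h1 h2; have hb : (b.-1 < m.+1)%N by lia.
    exists (Ordinal hb) => //; apply: val_inj.
    by rewrite -[RHS]/(nat_of_ord (f _)) fE /= prednK.
  by case=> i _ ->; rewrite fE; case: i => i /=; lia.
have latP m : (2 * lattice_count P m = m * m.-1)%N.
  rewrite lattice_count_rows; elim: m => [|m IH]; first by rewrite big_geq.
  by rewrite big_nat_recr //= mulnDr IH rowP; case: m {IH} => //= m; lia.
have primP m : (primitive_count P m <= lattice_count P m)%N.
  apply: subset_leq_card; apply/fintype.subsetP => x.
  by rewrite !unfold_in /= => /andP[-> /andP[_ ->]].
have primA : (primitive_count P M <= primitive_count all_directions M)%N.
  apply: subset_leq_card; apply/fintype.subsetP => x.
  by rewrite !unfold_in /= => /andP[-> /andP[-> _]].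
(* From 8 on, the linear loss M is at most half of the remaining M ^ 2 / 4. Below 8, the two unit
   vectors suffice, since M ^ 2 <= 49 < 64. *)
case: (leqP 8 M) => hM; last first.
  case: M primA hM => // M _ hM.
  have : (2 <= primitive_count all_directions M.+1)%N.
    pose A : {set 'I_M.+2 * 'I_M.+2} := [set (ord0, inord 1); (inord 1, ord0)].
    have -> : 2%N = #|A|.
      rewrite cards2; congr _.+1; apply/esym/eqP; rewrite eqb1.
      by apply/eqP => -[] /(congr1 val) /=; rewrite inordK.
    apply: subset_leq_card; apply/fintype.subsetP => x.
    by rewrite !inE => /orP[] /eqP ->; rewrite /= inordK.
  by nia.
have sub : ((M * M.-1) <= 2 * primitive_count P M + \sum_(2 <= d < M.+1) (M %/ d) ^ 2)%N.
  rewrite -latP lattice_count_primitive // big_ltn 1?divn1 ?ltnS //; last by lia.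
  rewrite mulnDr leq_add2l big_distrr /=.
  apply: leq_sum => d _; apply: (@leq_trans (2 * lattice_count P (M %/ d))).
    by rewrite leq_mul2l primP orbT.
  by rewrite latP; nia.
have := sub; rewrite -(ler_nat rat) natrD => sub'.
have sq : (\sum_(2 <= d < M.+1) (M %/ d) ^ 2)%:R <= (M%:R ^+ 2 * (3 / 4) : rat).
  rewrite natr_sum; apply: (@le_trans _ _ (\sum_(2 <= d < M.+1) M%:R ^+ 2 * d%:R ^- 2)).
    rewrite big_nat [X in _ <= X]big_nat; apply: ler_sum => d /andP[d2 _].
    by rewrite natrX divn_sqr_le //; lia.
  by rewrite -mulr_sumr ler_wpM2l ?sqr_ge0 // sum_inv_sqr_le.
rewrite -(ler_nat rat) natrX natrM.
have h8 : (8 : rat) <= M%:R by rewrite ler_nat.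
have h9 : (primitive_count P M)%:R <= (primitive_count all_directions M)%:R :> rat.
  by rewrite ler_nat.
move: sub'; rewrite natrM [_.-1%:R](_ : _ = M%:R - 1); last first.
  by rewrite -[in RHS](prednK (_ : 0 < M)%N) -?natr1 ?addrK //; lia.
rewrite natrM; move: sq h8 h9.
move: (M%:R : rat) ((primitive_count P M)%:R : rat).
move: ((primitive_count _ M)%:R : rat) ((\sum_(_ <= _ < _) _)%N%:R : rat).
by move=> x y z t *; nra.
Qed.

(* The directions (1 - t, t), t in [0, 1], are cut into N arcs of equal length;
   the last arc contains t = 1. *)
Definition cone (N a b : nat) : nat := minn (N * b %/ (a + b)) N.-1.

Definition in_cone (N i a b : nat) : bool := cone N a b == i.

Lemma cone_lt (N a b : nat) : (0 < N)%N -> (cone N a b < N)%N.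
Proof. by move=> N0; rewrite /cone; lia. Qed.

Lemma cone_scale (N d a b : nat) : (0 < d)%N ->
  cone N (d * a) (d * b) = cone N a b.
Proof. by move=> d0; rewrite /cone -mulnDr mulnCA divnMl. Qed.

Lemma cone_ge (N i a b : nat) : (0 < a + b)%N -> (i <= cone N a b)%N ->
  (i * (a + b) <= N * b)%N.
Proof. by move=> m0; rewrite /cone leq_min leq_divRL // => /andP[]. Qed.

Lemma cone_le (N i a b : nat) : (0 < a + b)%N -> (cone N a b <= i)%N ->
  (N * b <= i.+1 * (a + b))%N.
Proof.
move=> m0; rewrite /cone geq_min => /orP[|].
  by rewrite -ltnS ltn_divLR // => /ltnW.
move=> h; apply: (@leq_trans (N * (a + b))); first by rewrite leq_mul2l leq_addl orbT.
by rewrite leq_mul2r; lia.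
Qed.

Lemma card_interval (m X Y : nat) : (Y <= m)%N ->
  #|[pred b : 'I_m | (X <= b < Y)%N]| = (Y - X)%N.
Proof.
move=> hY; rewrite -sum1_card /= -(big_mkord (fun b => X <= b < Y)%N (fun=> 1%N)).
rewrite -[RHS]muln1 -sum_nat_const_nat (big_nat_widenl X 0) //.
by rewrite [RHS](big_nat_widen _ _ _ _ _ hY).
Qed.

Lemma row_count_cone (R : realFieldType) (N i m : nat) : (i < N)%N -> (0 < m)%N ->
  `|(row_count (in_cone N i) m)%:R - N%:R^-1 * m%:R| <= 2 :> R.
Proof.
move=> iN m0; have N0 : (0 < N)%N by lia.
(* On the row a + b = m the cone is the interval X <= b < Y, whose ends are the ceilings of i * m /
   N and (i + 1) * m / N, except that the last cone also contains b = m. *)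
pose X := ((i * m + N.-1) %/ N)%N.
pose Y := (if i == N.-1 then m.+1 else (i.+1 * m + N.-1) %/ N)%N.
have ceilP x b : ((x + N.-1) %/ N <= b)%N = (x <= N * b)%N.
  by rewrite -ltnS ltn_divLR //; apply/idP/idP; nia.
have ceilP2 x : (x <= N * ((x + N.-1) %/ N) <= x + N.-1)%N.
  by rewrite -ceilP leqnn mulnC leq_trunc_div.
have hY : (Y <= m.+1)%N.
  by rewrite /Y; case: eqP => // _; rewrite ceilP; nia.
have -> : row_count (in_cone N i) m = (Y - X)%N.
  rewrite -(card_interval X hY); apply: eq_card => b; rewrite !unfold_in /=.
  have bm : (b <= m)%N by rewrite -ltnS.
  rewrite /in_cone /cone subnK // /X /Y ceilP.
  case: (i =P N.-1) => [->|/eqP hi].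
    by rewrite ltn_ord andbT -leq_divRL //; apply/eqP/idP => /minn_idPr.
  rewrite ltnNge ceilP -ltnNge -leq_divRL // -ltn_divLR //.
  by move: (_ %/ _)%N => z; apply/eqP/idP; lia.
have /andP[x1 x2] : (i * m <= N * X <= i * m + N.-1)%N by exact: ceilP2.
have y12 : (i.+1 * m <= N * Y <= i.+1 * m + N)%N.
  rewrite /Y; case: eqP => [->|_]; first by nia.
  by have := ceilP2 (i.+1 * m)%N; lia.
have : (m <= N * (Y - X) + N <= m + 2 * N)%N by nia.
move: (Y - X)%N => Z /andP[h1 h2].
have N0' : (0 : R) < N%:R by rewrite ltr0n.
move: h1 h2; rewrite -2!(ler_nat R) !natrD !natrM => h1 h2.
have -> : Z%:R - N%:R^-1 * m%:R = (N%:R * Z%:R - m%:R) / N%:R :> R.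
  by field; rewrite gt_eqF.
rewrite normrM normfV (ger0_norm (ltW N0')) ler_pdivrMr // ler_norml.
by apply/andP; split; lra.
Qed.

Lemma sqr_between (R : realFieldType) (p w z : R) : 0 <= p -> 0 <= z -> 0 <= w ->
  z - p <= w <= z -> z ^+ 2 - 2 * p * z <= w ^+ 2 <= z ^+ 2.
Proof.
move=> p0 z0 w0 /andP[h1 h2]; apply/andP; split; last by rewrite ler_pXn2r.
have : 0 <= (p - (z - w)) * (z + w) by rewrite mulr_ge0 //; lra.
have : 0 <= p * (z - w) by rewrite mulr_ge0 //; lra.
lra.
Qed.

(** * Equidistribution of primitive vectors among the cones *)

Section PrimitiveEquidistribution.
Variable R : archiRealFieldType.

(** Since (l / d) / p = (l / p) / d, the divisor identity is compatible with rescaling; the terms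
    with d > l / p vanish. *)
Lemma sum_primitive_count (C : nat -> nat -> bool) (p l : nat) :
  (forall d a b, (0 < d)%N -> C (d * a)%N (d * b)%N = C a b) ->
  (\sum_(1 <= d < l.+1) primitive_count C ((l %/ d) %/ p))%N =
  lattice_count C (l %/ p).
Proof.
move=> hC; rewrite lattice_count_primitive //.
rewrite [RHS](big_nat_widen _ _ l.+1) ?ltnS ?leq_div //.
rewrite (bigID (fun d => d < (l %/ p).+1)%N) /= [X in (_ + X)%N]big1 ?addn0; last first.
  move=> d; rewrite -leqNgt => hd; rewrite divnAC divn_small //.
  by apply: eq_card0 => x; rewrite unfold_in /=; case: (_ + _)%N.
by apply: eq_bigr => d _; rewrite divnAC.
Qed.

(** Two scales p and q appear because a tilt multiplies beta by a rational p / q, which amounts to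
    rescaling lengths. The error is relative to the total primitive count, up to a constant, so that
    it can be summed against a decreasing weight. *)
Lemma primitive_count_cone_le (N i p q : nat) :
  (i < N)%N -> (0 < p)%N -> (0 < q)%N -> forall delta : R, 0 < delta ->
  exists2 K : R, 0 <= K & forall l,
    (primitive_count (in_cone N i) (l %/ p))%:R <=
    ((q%:R / p%:R) ^+ 2 / N%:R + delta) *
      (primitive_count all_directions (l %/ q))%:R + K.
Proof.
move=> iN p0 q0 delta delta0; have N0 : (0 < N)%N by lia.
have N0' : (0 : R) < N%:R by rewrite ltr0n.
have p0' : (0 : R) < p%:R by rewrite ltr0n.
have q0' : (0 : R) < q%:R by rewrite ltr0n.
have N1 : (1 : R) <= N%:R by rewrite ler1n.
have p1 : (1 : R) <= p%:R by rewrite ler1n.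
have q1 : (1 : R) <= q%:R by rewrite ler1n.
have hcone d a b : (0 < d)%N -> in_cone N i (d * a) (d * b) = in_cone N i a b.
  by move=> d0; rewrite /in_cone cone_scale.
have lat1 M := @lattice_count_approx R (in_cone N i) N%:R^-1 _
  (fun m => @row_count_cone R N i m iN) M.
have {}lat1 M : `|(lattice_count (in_cone N i) M)%:R - N%:R^-1 * M%:R ^+ 2 / 2|
    <= 3 * M%:R :> R.
  by apply: lat1; rewrite invr_ge0 ltW //= invf_le1.
have lat2 M : `|(lattice_count all_directions M)%:R - 1 * M%:R ^+ 2 / 2|
    <= 3 * M%:R :> R.
  apply: lattice_count_approx => [|m _]; first by rewrite ler01 lexx.
  by rewrite row_count_all -natr1 mul1r addrAC subrr add0r normr1; lra.
have primlat C M : (primitive_count C M)%:R <= (lattice_count C M)%:R :> R.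
  rewrite ler_nat; apply: subset_leq_card; apply/fintype.subsetP => x.
  by rewrite !unfold_in /= => /andP[-> /andP[_ ->]].
have natsq (M : nat) : M%:R <= (M%:R ^+ 2 : R).
  by rewrite -natrX ler_nat; nia.
have divb r l : (0 < r)%N -> l%:R - r%:R <= (r%:R * (l %/ r)%N%:R : R) <= l%:R.
  move=> r0; rewrite lerBlDr -!natrM -natrD !ler_nat (mulnC r).
  have := divn_eq l r; have := ltn_pmod l r0.
  by move: (l %/ r * r)%N (l %% r)%N => x y h ->; lia.
(* The coefficients are such that, in the divisor sum of g, the two main terms l ^ 2 / 2 cancel and
   only O(l) is left. *)
pose g l : R := N%:R * p%:R ^+ 2 * (primitive_count (in_cone N i) (l %/ p))%:R
   - q%:R ^+ 2 * (primitive_count all_directions (l %/ q))%:R.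
pose C : R := 10 * N%:R * p%:R + 10 * q%:R.
have g1 l : `|\sum_(1 <= d < l.+1) g (l %/ d)%N| <= C * l%:R.
  rewrite sumrB -!mulr_sumr -!natr_sum !sum_primitive_count //.
  have := lat1 (l %/ p)%N; have := lat2 (l %/ q)%N.
  have := divb p l p0; have := divb q l q0.
  rewrite !ler_norml /C.
  have := ler0n R (l %/ p); have := ler0n R (l %/ q); have := ler0n R l.
  move: ((l %/ p)%N%:R : R) ((l %/ q)%N%:R : R) (l%:R : R) => x y z.
  move: ((lattice_count (in_cone N i) _)%:R : R).
  move: ((lattice_count all_directions _)%:R : R) => T S z0 y0 x0 /andP[yz1 yz2] /andP[xz1 xz2].
  move=> /andP[T1 T2] /andP[S1 S2].
  have /andP[xs1 xs2] : z ^+ 2 - 2 * p%:R * z <= p%:R ^+ 2 * x ^+ 2 <= z ^+ 2.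
    by rewrite -exprMn; apply: sqr_between; rewrite ?xz1 ?mulr_ge0 //.
  have /andP[ys1 ys2] : z ^+ 2 - 2 * q%:R * z <= q%:R ^+ 2 * y ^+ 2 <= z ^+ 2.
    by rewrite -exprMn; apply: sqr_between; rewrite ?yz1 ?mulr_ge0 //.
  have cN : 0 < N%:R * p%:R ^+ 2 :> R by rewrite mulr_gt0 // exprn_gt0.
  have cq : 0 < q%:R ^+ 2 :> R by rewrite exprn_gt0.
  have NS : `|N%:R * p%:R ^+ 2 * S - p%:R ^+ 2 * x ^+ 2 / 2| <= 3 * N%:R * p%:R * z.
    have -> : N%:R * p%:R ^+ 2 * S - p%:R ^+ 2 * x ^+ 2 / 2 =
        N%:R * p%:R ^+ 2 * (S - N%:R^-1 * x ^+ 2 / 2) by field; rewrite gt_eqF.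
    rewrite normrM (ger0_norm (ltW cN)).
    apply: (@le_trans _ _ (N%:R * p%:R ^+ 2 * (3 * x))).
      by rewrite ler_pM2l // ler_norml; apply/andP; split; lra.
    rewrite (_ : _ * (3 * x) = 3 * N%:R * p%:R * (p%:R * x)); last by ring.
    by rewrite ler_wpM2l // !mulr_ge0 //; lra.
  have QT : `|q%:R ^+ 2 * T - q%:R ^+ 2 * y ^+ 2 / 2| <= 3 * q%:R * z.
    have -> : q%:R ^+ 2 * T - q%:R ^+ 2 * y ^+ 2 / 2 =
        q%:R ^+ 2 * (T - 1 * y ^+ 2 / 2) by field.
    rewrite normrM (ger0_norm (ltW cq)).
    apply: (@le_trans _ _ (q%:R ^+ 2 * (3 * y))).
      by rewrite ler_pM2l // ler_norml; apply/andP; split; lra.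
    rewrite (_ : _ * (3 * y) = 3 * q%:R * (q%:R * y)); last by ring.
    by rewrite ler_wpM2l // mulr_ge0 //; lra.
  move: NS QT; rewrite !ler_norml => /andP[? ?] /andP[? ?].
  have : 0 <= p%:R * z by rewrite mulr_ge0 // ltW.
  have : 0 <= q%:R * z by rewrite mulr_ge0 // ltW.
  have : p%:R * z <= N%:R * p%:R * z.
    by rewrite ler_wpM2r // ler_peMl // ltW.
  by move=> *; apply/andP; split; lra.
have latle C' a M : 0 <= a <= 1 -> `|(lattice_count C' M)%:R - a * M%:R ^+ 2 / 2|
    <= 3 * M%:R :> R -> (primitive_count C' M)%:R <= 4 * M%:R ^+ 2 :> R.
  move=> /andP[a0 a1] h; apply: (le_trans (primlat _ _)).
  move: h; rewrite ler_norml => /andP[_ h].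
  have := natsq M; have := sqr_ge0 (M%:R : R); move: h.
  move: (M%:R : R) ((lattice_count _ _)%:R : R) => x y h h1 h2.
  by have := ler_wpM2r h1 a1; lra.
have bnd r l C' : (0 < r)%N ->
    (primitive_count C' (l %/ r))%:R <= 4 * (l %/ r)%N%:R ^+ 2 :> R ->
    r%:R ^+ 2 * (primitive_count C' (l %/ r))%:R <= 4 * l%:R ^+ 2 :> R.
  move=> r0 h; have r0' : (0 : R) < r%:R by rewrite ltr0n.
  apply: (le_trans (_ : _ <= r%:R ^+ 2 * (4 * (l %/ r)%N%:R ^+ 2))).
    by rewrite ler_pM2l ?exprn_gt0.
  have := divb r l r0; have := ler0n R (l %/ r)%N.
  rewrite mulrCA -exprMn => x0 /andP[_ h2].
  rewrite ler_pM2l ?ltr0n //.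
  by rewrite ler_pXn2r // ?nnegrE ?mulr_ge0 ?ler0n.
have g2 l : `|g l| <= (4 * N%:R + 4) * l%:R ^+ 2.
  have := bnd p l (in_cone N i) p0 (latle _ N%:R^-1 _ _ (lat1 _)).
  rewrite invr_ge0 (ltW N0') /= invf_le1 // => /(_ N1) h1.
  have := bnd q l all_directions q0 (latle _ 1 _ _ (lat2 _)).
  rewrite ler01 lexx => /(_ isT) h2.
  have h3 : 0 <= q%:R ^+ 2 * (primitive_count all_directions (l %/ q))%:R :> R.
    by rewrite mulr_ge0 ?ler0n ?sqr_ge0.
  have h4 : 0 <= p%:R ^+ 2 * (primitive_count (in_cone N i) (l %/ p))%:R :> R.
    by rewrite mulr_ge0 ?ler0n ?sqr_ge0.
  have h5 := ler_wpM2l (ltW N0') h1.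
  have h6 := mulr_ge0 (ltW N0') h4.
  have h7 := mulr_ge0 (ltW N0') (sqr_ge0 (l%:R : R)).
  have h8 := sqr_ge0 (l%:R : R).
  by rewrite /g ler_norml; apply/andP; split; lra.
pose D : R := C + (4 * N%:R + 4).
have CD : C <= D by rewrite /D lerDl; lra.
have CD' : 4 * N%:R + 4 <= D by rewrite /D lerDr /C addr_ge0 ?mulr_ge0 ?ler0n.
(* By [primitive_count_all_ge], l ^ 2 is at most 64 * q ^ 2 times the total count at l / q, plus a
   constant; dividing by N * p ^ 2 then turns rho * l ^ 2 into delta times that count. *)
pose rho : R := delta * N%:R * p%:R ^+ 2 / (64 * q%:R ^+ 2).
have rho0 : 0 < rho.
  by rewrite /rho divr_gt0 // ?mulr_gt0 // ?exprn_gt0 //; lra.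
have [K hK] := @little_o_of_divisor_sum R g D
   (fun l => le_trans (g1 l) (ler_wpM2r (ler0n _ _) CD))
   (fun l => le_trans (g2 l) (ler_wpM2r (sqr_ge0 _) CD')) rho rho0.
exists ((2 * rho * q%:R ^+ 2 + `|K|) / (N%:R * p%:R ^+ 2)).
  have := ltW rho0; move: (rho) (`|K|) (normr_ge0 K) => r k k0 r0.
  by rewrite divr_ge0 // ?addr_ge0 // ?mulr_ge0 // ?exprn_ge0.
move=> l; have := hK l; rewrite ler_norml /g => /andP[_].
have := primitive_count_all_ge (l %/ q); rewrite -(ler_nat R) natrX natrM.
have := divb q l q0; have := ler0n R (l %/ q)%N; have := ler0n R l.
move: ((l %/ q)%N%:R : R) (l%:R : R) => x z.
move: ((primitive_count (in_cone N i) _)%:R : R).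
move: ((primitive_count all_directions _)%:R : R) => P' P z0 x0 /andP[h1 _] h2 h3.
have z2 : z ^+ 2 <= 64 * q%:R ^+ 2 * P' + 2 * q%:R ^+ 2.
  apply: (@le_trans _ _ (2 * q%:R ^+ 2 * x ^+ 2 + 2 * q%:R ^+ 2)).
    apply: (@le_trans _ _ ((q%:R * x + q%:R) ^+ 2)).
      by rewrite ler_pXn2r ?nnegrE // ?addr_ge0 ?mulr_ge0 ?ler0n //; lra.
    rewrite -subr_ge0.
    rewrite (_ : _ - _ = q%:R ^+ 2 * (x - 1) ^+ 2); last by ring.
    by rewrite mulr_ge0 ?sqr_ge0.
  rewrite lerD2r (_ : 64 * _ * _ = 2 * q%:R ^+ 2 * (32%:R * P')); last by ring.
  by rewrite ler_pM2l // mulr_gt0 ?exprn_gt0 //; lra.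
have c0 : 0 < N%:R * p%:R ^+ 2 :> R by rewrite mulr_gt0 ?exprn_gt0.
rewrite -(ler_pM2l c0).
have -> : N%:R * p%:R ^+ 2 * (((q%:R / p%:R) ^+ 2 / N%:R + delta) * P' +
     (2 * rho * q%:R ^+ 2 + `|K|) / (N%:R * p%:R ^+ 2)) =
   q%:R ^+ 2 * P' + rho * (64 * q%:R ^+ 2 * P' + 2 * q%:R ^+ 2) + `|K|.
  rewrite /rho; field; rewrite !gt_eqF //.
have := ler_wpM2l (ltW rho0) z2; have := ler_norm K; lra.
Qed.

End PrimitiveEquidistribution.

(** * Summation by layers *)

Section LayerCake.
Variables (R : realFieldType) (h : nat -> R).

Lemma telescope_down (n m : nat) : (n <= m)%N ->
  \sum_(n <= k < m) (h k - h k.+1) = h n - h m.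
Proof.
move=> nm; rewrite -[RHS]opprB -telescope_sumr // -sumrN.
by apply: eq_bigr => k _; rewrite opprB.
Qed.

Lemma sum_layers (I : finType) (P : pred I) (s : I -> nat) (L : nat) :
  (forall i, P i -> (s i <= L)%N) ->
  \sum_(i | P i) h (s i) = #|[pred i | P i]|%:R * h L +
    \sum_(0 <= l < L) #|[pred i | P i && (s i <= l)%N]|%:R * (h l - h l.+1).
Proof.
move=> hs.
have -> : \sum_(i | P i) h (s i) = \sum_(i | P i) (h L +
    \sum_(0 <= l < L) (s i <= l)%:R * (h l - h l.+1)).
  apply: eq_bigr => i Pi; have sL := hs _ Pi.
  have -> : \sum_(0 <= l < L) (s i <= l)%:R * (h l - h l.+1) =
      \sum_(s i <= l < L) (h l - h l.+1).
    rewrite (big_nat_widenl (s i) 0) // big_mkcond /=.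
    by apply: eq_bigr => l _; case: leqP; rewrite ?mul1r ?mul0r.
  by rewrite telescope_down // addrC subrK.
rewrite big_split /= sumr_const -[X in X + _]mulr_natl; congr (_%:R * _ + _).
rewrite exchange_big /=; apply: eq_bigr => l _.
rewrite -mulr_suml; congr (_ * _).
rewrite -sum1_card natr_sum [RHS]big_mkcond [LHS]big_mkcond /=.
by apply: eq_bigr => i _; rewrite unfold_in /=; case: (P i) => //=; case: (_ <= _)%N.
Qed.

(** Abel summation: a comparison of counts below every level passes to sums of a decreasing h. The
    additive error K telescopes to K * h 1 because no element lies at level 0. *)
Lemma layer_compare (I J : finType) (P : pred I) (Q : pred J) (s : I -> nat)
    (t : J -> nat) (kappa K : R) (L : nat) :
  (forall l, 0 <= h l) -> (forall l, h l.+1 <= h l) -> (0 < L)%N -> 0 <= K ->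
  (forall i, P i -> (0 < s i <= L)%N) -> (forall j, Q j -> (0 < t j <= L)%N) ->
  (forall l, (l <= L)%N -> #|[pred i | P i && (s i <= l)%N]|%:R <=
     kappa * #|[pred j | Q j && (t j <= l)%N]|%:R + K) ->
  \sum_(i | P i) h (s i) <= kappa * \sum_(j | Q j) h (t j) + K * h 1%N.
Proof.
move=> h0 hd L0 K0 hs ht hc.
rewrite (@sum_layers _ _ s L); last by move=> i /hs /andP[].
rewrite (@sum_layers _ _ t L); last by move=> i /ht /andP[].
have cL (T : finType) (S : pred T) (r : T -> nat) :
    (forall i, S i -> (0 < r i <= L)%N) ->
    #|[pred i | S i]| = #|[pred i | S i && (r i <= L)%N]|.
  move=> hr; apply: eq_card => i; rewrite !unfold_in /=.
  by case: (boolP (S i)) => // /hr /andP[_ ->].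
rewrite (cL _ _ _ hs) (cL _ _ _ ht).
have tele : h 1%N = h L + \sum_(1 <= l < L) (h l - h l.+1).
  by rewrite telescope_down // addrC subrK.
have z (T : finType) (S : pred T) (r : T -> nat) :
    (forall i, S i -> (0 < r i <= L)%N) -> #|[pred i | S i && (r i <= 0)%N]| = 0%N.
  move=> hr; apply: eq_card0 => i; rewrite !unfold_in /=.
  by case: (boolP (S i)) => // /hr /andP[]; case: (r i).
rewrite !(big_ltn L0) (z _ _ _ hs) (z _ _ _ ht) !mul0r !add0r tele.
have hA := ler_wpM2r (h0 L) (hc L (leqnn L)).
set S1 := \sum_(1 <= l < L) _; set S2 := \sum_(1 <= l < L) _.
set S3 := \sum_(1 <= l < L) _.
have hS : S1 <= kappa * S2 + K * S3.
  rewrite /S1 /S2 /S3 !mulr_sumr -big_split /= big_nat [leRHS]big_nat.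
  apply: ler_sum => l /andP[_ lL]; rewrite mulrA -mulrDl.
  by apply: ler_wpM2r; rewrite ?subr_ge0 //; apply/hc/ltnW.
move: hA hS; rewrite mulrDl; move: (#|_|%:R : R) (#|_|%:R : R) => x y; lra.
Qed.

End LayerCake.

(** * Energies *)

Definition len (n : nat) (x : grid n) : nat := (x.1 + x.2)%N.

Lemma ler_sum_subset (R : numDomainType) (I : finType) (P Q : pred I) (F : I -> R) :
  (forall i, P i -> Q i) -> (forall i, Q i -> 0 <= F i) ->
  \sum_(i | P i) F i <= \sum_(i | Q i) F i.
Proof.
move=> PQ F0; rewrite [leLHS]big_mkcond [leRHS]big_mkcond; apply: ler_sum => i _.
case: (boolP (P i)) => [/PQ ->//|_]; by case: (boolP (Q i)) => // /F0.
Qed.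

Section Energy.
Variable R : realType.

(** Truncated at n because the multiplicities of a configuration are at most n. *)
Definition trunc_geom (n : nat) (s : R) : R :=
  \sum_(1 <= m < n.+1) expR (- (m%:R * s)).

Definition edge_energy (n : nat) (lam s : R) : R := ln (1 + lam * trunc_geom n s).

(* The logarithm of the partition function restricted to the directions in C. *)
Definition energy (n : nat) (lam beta : R) (C : nat -> nat -> bool) : R :=
  \sum_(x : grid n | coprime x.1 x.2 && C x.1 x.2)
     edge_energy n lam (beta * (len x)%:R).

Lemma trunc_geom_ge0 n s : 0 <= trunc_geom n s.
Proof. by apply: sumr_ge0 => m _; exact: expR_ge0. Qed.

Lemma trunc_geom_le n s t : s <= t -> trunc_geom n t <= trunc_geom n s.
Proof.
by move=> st; apply: ler_sum => m _; rewrite ler_expR lerN2 ler_wpM2l.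
Qed.

(** From exp s = exp (s / 3) ^ 3 >= (1 + s / 3) ^ 3. The cubic growth makes the geometric sums decay
    like s ^ -3, which is summable over the plane, while near 0 they are still bounded by a multiple
    of 1 / s. *)
Lemma expR_sub1_ge (s : R) : 0 < s -> s * (1 + s) ^+ 2 / 27 <= expR s - 1.
Proof.
move=> s0; have -> : expR s = expR (s / 3) ^+ 3.
  by rewrite -expRM_natl; congr expR; field.
have h : 1 + s / 3 <= expR (s / 3) by exact: expR_ge1Dx.
have : (1 + s / 3) ^+ 3 <= expR (s / 3) ^+ 3.
  by rewrite ler_pXn2r ?nnegrE ?expR_ge0 //; lra.
have : 0 <= s ^+ 2 by rewrite sqr_ge0.
have -> : (1 + s / 3) ^+ 3 = 1 + s + s ^+ 2 / 3 + s ^+ 3 / 27 by field.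
have -> : s * (1 + s) ^+ 2 = s + 2 * s ^+ 2 + s ^+ 3 by ring.
lra.
Qed.

Lemma trunc_geom_expR n s : trunc_geom n s * (expR s - 1) <= 1.
Proof.
rewrite /trunc_geom mulrBr mulr1 mulr_suml -sumrB.
have -> : \sum_(1 <= m < n.+1) (expR (- (m%:R * s)) * expR s - expR (- (m%:R * s)))
   = \sum_(0 <= m < n) (expR (- (m%:R * s)) - expR (- (m.+1%:R * s))).
  rewrite big_add1 /=; apply: eq_bigr => m _; congr (_ - _).
  by rewrite -expRD; congr expR; rewrite -natr1; ring.
rewrite (telescope_down (fun m => expR (- (m%:R * s)))) // mul0r oppr0 expR0.
by rewrite gerBl expR_ge0.
Qed.

Lemma trunc_geom_le_cube n (s : R) : 0 < s ->
  trunc_geom n s <= 27 / (s * (1 + s) ^+ 2).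
Proof.
move=> s0; have h := expR_sub1_ge s0; have h2 := trunc_geom_expR n s.
have c0 : 0 < s * (1 + s) ^+ 2 by rewrite mulr_gt0 // exprn_gt0 //; lra.
rewrite ler_pdivlMr //.
have := ler_wpM2l (trunc_geom_ge0 n s) h; move: h2.
by move: (expR s) (trunc_geom n s) => e u; lra.
Qed.

Lemma trunc_geom_le_inv n (s : R) : 0 < s -> trunc_geom n s <= s^-1.
Proof.
move=> s0; have h := expR_ge1Dx s; have h2 := trunc_geom_expR n s.
rewrite -div1r ler_pdivlMr //.
have := ler_wpM2l (trunc_geom_ge0 n s) h; move: h2.
by move: (expR s) (trunc_geom n s) => e u; lra.
Qed.

Lemma edge_energy_ge0 n lam s : 0 <= lam -> 0 <= edge_energy n lam s.
Proof.
by move=> l0; rewrite ln_ge0 // lerDl mulr_ge0 // trunc_geom_ge0.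
Qed.

Lemma edge_energy_le n lam s t : 0 <= lam -> s <= t ->
  edge_energy n lam t <= edge_energy n lam s.
Proof.
move=> l0 st; have p u : 0 < 1 + lam * trunc_geom n u.
  by rewrite ltr_pwDl // mulr_ge0 // trunc_geom_ge0.
rewrite ler_ln ?posrE // lerD2l ler_wpM2l //; exact: trunc_geom_le.
Qed.

Lemma edge_energy_le_lin n lam s : 0 <= lam ->
  edge_energy n lam s <= lam * trunc_geom n s.
Proof.
move=> l0; apply: le_ln1Dx; have := mulr_ge0 l0 (trunc_geom_ge0 n s); lra.
Qed.

Lemma ln1D_ge (x : R) : 0 <= x -> x / (1 + x) <= ln (1 + x).
Proof.
move=> x0; have p : 0 < 1 + x by lra.
have : ln ((1 + x)^-1) <= (1 + x)^-1 - 1.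
  have : 0 < (1 + x)^-1 by rewrite invr_gt0.
  move: (_^-1) => y y0; have := @le_ln1Dx R (y - 1); rewrite [X in ln X]addrC subrK.
  by apply; lra.
rewrite lnV ?posrE //.
have -> : x / (1 + x) = 1 - (1 + x)^-1 by field; rewrite gt_eqF.
lra.
Qed.

Lemma energy_mono n lam beta (C C' : nat -> nat -> bool) : 0 <= lam ->
  (forall a b, C a b -> C' a b) -> energy n lam beta C <= energy n lam beta C'.
Proof.
move=> l0 h; apply: ler_sum_subset => [x /andP[-> /h ->]//|x _].
exact: edge_energy_ge0.
Qed.

(** A vector of length at most M has both coordinates at most M, so a grid of side at least M misses
    none. *)
Lemma card_lattice_widen (C : nat -> nat -> bool) (n n' M : nat) : (M <= n')%N ->
  (#|[pred x : 'I_n.+1 * 'I_n.+1 | (0 < x.1 + x.2 <= M)%N && C x.1 x.2]| <=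
   #|[pred x : 'I_n'.+1 * 'I_n'.+1 | (0 < x.1 + x.2 <= M)%N && C x.1 x.2]|)%N.
Proof.
move=> Mn; pose f (x : 'I_n.+1 * 'I_n.+1) : 'I_n'.+1 * 'I_n'.+1 := (inord x.1, inord x.2).
have f1 (x : 'I_n.+1 * 'I_n.+1) : (0 < x.1 + x.2 <= M)%N ->
    ((f x).1 = x.1 :> nat) * ((f x).2 = x.2 :> nat).
  by move=> /andP[_ h]; rewrite /f /= !inordK //; lia.
rewrite -(card_in_imset (f := f)); last first.
  move=> x y; rewrite !unfold_in /= => /andP[hx _] /andP[hy _] e.
  have [x1 x2] := f1 _ hx; have [y1 y2] := f1 _ hy.
  case: x y e hx hy x1 x2 y1 y2 => [x1 x2] [y1 y2] e _ _ /= e1 e2 e3 e4.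
  case: e => e5 e6; congr (_, _); apply: val_inj => /=.
    by rewrite -e1 -e3 e5.
  by rewrite -e2 -e4 e6.
apply: subset_leq_card; apply/fintype.subsetP => y /imsetP[x].
rewrite !unfold_in /= => /andP[hx hC] ->; have [-> ->] := f1 _ hx.
by rewrite hx.
Qed.

Lemma coprime_len_gt0 n (x : grid n) : coprime x.1 x.2 -> (0 < len x)%N.
Proof.
rewrite /len addn_gt0; case: (val x.1) (val x.2) => [|a] [|b] //.
Qed.

(** The product of the two factors of [energy_ge]: 1 / 128 from the number of short primitive
    vectors and exp (- 1) / 2 from the energy of each of them. *)
Definition energy_const : R := expR (- 1) / 256.

Lemma energy_const_gt0 : 0 < energy_const.
Proof. by rewrite divr_gt0 // expR_gt0. Qed.

(** Only primitive vectors with beta * length <= 1 are kept. Their maximal length [M] is the integer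
    part of 1 / beta, and 1 <= beta * n ensures that they all fit in the grid. *)
Lemma energy_ge n (lam beta : R) : 0 < lam <= 1 -> 0 < beta <= 1 -> 1 <= beta * n%:R ->
  energy_const * lam / beta ^+ 2 <= energy n lam beta all_directions.
Proof.
move=> /andP[l0 l1] /andP[b0 b1] bn.
have [M [M1 Mle Mge]] : exists M : nat, [/\ (0 < M <= n)%N, beta * M%:R <= 1 &
    1 / 2 <= beta * M%:R].
  have b2 : 1 <= beta^-1 by rewrite invf_ge1.
  have /andP[t1 t2] : ((Num.truncn beta^-1)%:R <= beta^-1 < (Num.truncn beta^-1).+1%:R).
    by apply: truncn_itv; rewrite invr_ge0 ltW.
  set M := Num.truncn _ in t1 t2.
  have M0 : (0 < M)%N by rewrite -ltnS -(ltr_nat R) (le_lt_trans b2).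
  have M1' : (1 : R) <= M%:R by rewrite ler1n.
  have e1 : beta * beta^-1 = 1 by rewrite divff // gt_eqF.
  have h1 : beta * M%:R <= 1 by rewrite -[leRHS]e1 ler_pM2l.
  have h2 : 1 / 2 <= beta * M%:R.
    have : 1 < beta * M.+1%:R by rewrite -[ltLHS]e1 ltr_pM2l.
    rewrite -natr1; nra.
  exists M; split => //; rewrite M0 -(ler_nat R) -(ler_pM2l b0) /=.
  exact: (le_trans h1 bn).
have n0 : (0 < n)%N by lia.
pose A := [pred x : 'I_n.+1 * 'I_n.+1 | (0 < x.1 + x.2 <= M)%N &&
   (coprime x.1 x.2 && all_directions x.1 x.2)].
have hA : (M ^ 2 <= 32 * #|A|)%N.
  apply: (leq_trans (primitive_count_all_ge M)); rewrite leq_mul2l /=.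
  by apply: card_lattice_widen; lia.
apply: (@le_trans _ _ (\sum_(x | A x) edge_energy n lam 1)).
  rewrite sumr_const -[leRHS]mulr_natl.
  have e1 : expR (-1) * lam / 2 <= edge_energy n lam 1.
    have h1 : expR (-1) <= trunc_geom n 1 :> R.
      rewrite /trunc_geom big_ltn // mul1r lerDl.
      by apply: sumr_ge0 => *; exact: expR_ge0.
    have h2 : expR (-1) <= 1 :> R by rewrite expR_le1; lra.
    have h3 : 0 < expR (-1) :> R by exact: expR_gt0.
    apply: (@le_trans _ _ (ln (1 + lam * expR (-1)))); last first.
      have p : 0 < lam * expR (-1) by rewrite mulr_gt0.
      have p2 := mulr_ge0 (ltW l0) (trunc_geom_ge0 n 1).
      rewrite ler_ln ?posrE ?lerD2l; [|lra|lra].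
      by rewrite ler_wpM2l // ltW.
    have p := mulr_gt0 l0 h3.
    apply: le_trans (ln1D_ge (ltW p)).
    move: (expR (-1)) h2 h3 p => e h2 h3 p.
    rewrite (mulrC e) ler_pM2l // lef_pV2 ?posrE //; last by lra.
    by nra.
  move: hA; rewrite -(ler_nat R) natrX natrM => hA.
  have c0 : 0 < expR (-1) * lam / 2 by rewrite divr_gt0 // mulr_gt0 // expR_gt0.
  apply: (@le_trans _ _ (#|A|%:R * (expR (-1) * lam / 2))); last first.
    by rewrite ler_wpM2l.
  rewrite -ler_pdivrMr // /energy_const.
  have -> : expR (-1) / 256 * lam / beta ^+ 2 / (expR (-1) * lam / 2) =
      1 / 128 / beta ^+ 2.
    by field; rewrite ?gt_eqF ?expR_gt0.
  rewrite ler_pdivrMr ?exprn_gt0 //.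
  have : 0 <= (beta * M%:R - 1 / 2) * (beta * M%:R + 1 / 2) by apply: mulr_ge0; lra.
  have := ler_wpM2l (sqr_ge0 beta) hA.
  by move: (#|A|%:R : R) (M%:R : R) => x y; lra.
apply: (@le_trans _ _ (\sum_(x | A x) edge_energy n lam (beta * (len x)%:R))).
  apply: ler_sum => x; move=> /andP[/andP[_ h] _].
  apply: edge_energy_le; first exact: ltW.
  by rewrite (le_trans _ Mle) // ler_pM2l // ler_nat.
apply: ler_sum_subset => [x|x _]; first by move=> /andP[_ ->].
by apply: edge_energy_ge0; exact: ltW.
Qed.

End Energy.

(** * Comparison of the energies of a cone and of all directions *)

Section EnergyCompare.
Variable R : realType.

Lemma sum_by_len (n : nat) (F : nat -> R) : (forall m, 0 <= F m) ->
  \sum_(x : grid n | (0 < len x)%N) F (len x) <=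
  \sum_(1 <= m < (2 * n).+1) F m * m.+1%:R.
Proof.
move=> F0.
have lenle (x : grid n) : (len x < (2 * n).+1)%N.
  by rewrite /len; case: x => -[a ha] [b hb] /=; lia.
rewrite (partition_big (fun x : grid n => Ordinal (lenle x)) (fun m => 0 < val m)%N) //=.
rewrite -(big_mkord (fun m => 0 < m)%N (fun m => \sum_(x : grid n |
  (0 < len x)%N && (len x == m)) F (len x))).
rewrite big_mkcond big_ltn //= add0r big_nat [leRHS]big_nat.
apply: ler_sum => m /andP[m0 _]; rewrite m0.
rewrite (eq_bigr (fun=> F m)) => [|x /andP[_ /eqP ->]//].
rewrite sumr_const -[leLHS]mulr_natr ler_wpM2l // ler_nat.
pose f (x : grid n) : 'I_m.+1 := inord x.2.
have hf (x : grid n) : len x = m -> f x = x.2 :> nat.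
  by rewrite /f /len => h; rewrite inordK // ltnS -h leq_addl.
rewrite -[leqRHS]card_ord -(card_in_imset (f := f)).
  exact: max_card.
move=> x y; rewrite !unfold_in /= => /andP[_ /eqP hx] /andP[_ /eqP hy] e.
have e2 : x.2 = y.2 :> nat by rewrite -hf // e hf.
have e1 : x.1 = y.1 :> nat by move: hx; rewrite -hy /len e2 => /addIn.
by case: x y e1 e2 {e hx hy} => [x1 x2] [y1 y2] /= /val_inj -> /val_inj ->.
Qed.

Lemma sum_trunc_geom_le (n : nat) (beta : R) : 0 < beta ->
  \sum_(x : grid n | coprime x.1 x.2) trunc_geom n (beta * (len x)%:R) <=
  54 / beta ^+ 2.
Proof.
move=> b0.
apply: (@le_trans _ _ (\sum_(x : grid n | (0 < len x)%N)
    trunc_geom n (beta * (len x)%:R))).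
  apply: ler_sum_subset => [x|x _]; first exact: coprime_len_gt0.
  exact: trunc_geom_ge0.
apply: le_trans (@sum_by_len n (fun m => trunc_geom n (beta * m%:R)) _) _.
  by move=> m; exact: trunc_geom_ge0.
have c0 : 0 < 54 / beta ^+ 2 by rewrite divr_gt0 // exprn_gt0.
(* At most m + 1 <= 2 m vectors have length m, and 27 * 2 = 54; the cubic bound is then dominated by
   a telescoping sum of total at most 1. *)
apply: (@le_trans _ _ (54 / beta ^+ 2 * \sum_(0 <= m < 2 * n)
    ((1 + beta * m%:R)^-1 - (1 + beta * m.+1%:R)^-1))); last first.
  rewrite (telescope_down (fun m => (1 + beta * m%:R)^-1)) // mulr0 addr0 invr1.
  rewrite ger_pMr // gerBl invr_ge0 addr_ge0 // mulr_ge0 // ltW //.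
rewrite big_add1 /= mulr_sumr; apply: ler_sum => m _.
have m0 : (0 : R) <= m%:R by [].
have bm : 0 <= beta * m%:R by rewrite mulr_ge0 // ltW.
have s0 : 0 < beta * m.+1%:R by rewrite mulr_gt0.
apply: (@le_trans _ _ (27 / (beta * m.+1%:R * (1 + beta * m.+1%:R) ^+ 2) * (2 * m.+1%:R))).
  apply: ler_pM => //; first exact: trunc_geom_ge0.
    exact: trunc_geom_le_cube.
  by rewrite -!natr1; lra.
have -> : 27 / (beta * m.+1%:R * (1 + beta * m.+1%:R) ^+ 2) * (2 * m.+1%:R) =
    54 / beta ^+ 2 * (beta / (1 + beta * m.+1%:R) ^+ 2).
  field; rewrite !gt_eqF //; lra.
rewrite ler_pM2l // -natr1.
have -> : (1 + beta * m%:R)^-1 - (1 + beta * (m%:R + 1))^-1 =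
   beta / ((1 + beta * m%:R) * (1 + beta * (m%:R + 1))).
  by field; apply/andP; split; rewrite gt_eqF //; lra.
rewrite ler_pM2l // lef_pV2 ?posrE ?expr2 ?mulr_gt0 //; try lra.
by rewrite ler_pM2r; lra.
Qed.

Lemma energy_le (n : nat) (lam beta : R) : 0 <= lam -> 0 < beta ->
  energy n lam beta all_directions <= lam * (54 / beta ^+ 2).
Proof.
move=> l0 b0; apply: (le_trans (_ : _ <= lam *
  \sum_(x : grid n | coprime x.1 x.2) trunc_geom n (beta * (len x)%:R))).
  rewrite mulr_sumr /energy; under eq_bigl do rewrite andbT.
  by apply: ler_sum => x _; exact: edge_energy_le_lin.
by rewrite ler_wpM2l // sum_trunc_geom_le.
Qed.

(** Approximate homogeneity of degree -2 in beta, each cone getting a share 1 / N. Errors are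
    measured against [energy_ge]: a small beta makes the additive constant K negligible, a large
    beta * n does the same for the truncation by the grid. *)
Lemma energy_cone_le (N i p q : nat) (delta : R) :
  (i < N)%N -> (0 < p)%N -> (0 < q)%N -> 0 < delta ->
  exists b0 B0 : R, [/\ 0 < b0, 0 < B0 & forall n (beta lam : R),
    0 < beta <= b0 -> B0 <= beta * n%:R -> 0 < lam <= 1 ->
    energy n lam (beta * (p%:R / q%:R)) (in_cone N i) <=
    ((q%:R / p%:R) ^+ 2 / N%:R + delta) * energy n lam beta all_directions].
Proof.
move=> iN p0 q0 d0; have d2 : 0 < delta / 2 by lra.
have [K K0 hK] := primitive_count_cone_le iN p0 q0 d2.
set kappa := (q%:R / p%:R) ^+ 2 / N%:R + delta / 2 in hK.
pose c : R := energy_const R; have c0 : 0 < c := energy_const_gt0 R.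
have q1 : (0 : R) < q%:R by rewrite ltr0n.
have p1 : (0 : R) < p%:R by rewrite ltr0n.
have Kq : 0 <= K * q%:R by rewrite mulr_ge0.
have kappa0 : 0 <= kappa.
  by rewrite addr_ge0 ?(ltW d2) // divr_ge0 // sqr_ge0.
pose b0 := Num.min 1 (c * delta / (4 * (K * q%:R + 1))).
have cd : 0 < c * delta by rewrite mulr_gt0.
have b0' : 0 < b0.
  by rewrite lt_min ltr01 /= divr_gt0 //; lra.
have B0' : 0 < 1 + 4 * 27 * 4 / (c * delta) by rewrite addr_gt0 // divr_gt0 // !mulr_gt0.
exists b0, (1 + 4 * 27 * 4 / (c * delta)); split; [exact: b0'|exact: B0'|].
move=> n beta lam /andP[beta0]; rewrite le_min => /andP[beta1 betaK] bn lam01.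
have /andP[lam0 lam1] := lam01; have lam0' := ltW lam0.
have B1 : 4 * 27 * 4 / (c * delta) <= beta * n%:R by lra.
have B2 : 1 <= beta * n%:R.
  by apply: le_trans bn; rewrite lerDl divr_ge0 // ?(ltW cd) // !mulr_ge0.
have n0 : (0 < n)%N.
  rewrite lt0n; apply/eqP => e; move: B2; rewrite e mulr0; lra.
have n0' : (0 : R) < n%:R by rewrite ltr0n.
have Phi_ge := @energy_ge R n lam beta lam01 (_ : 0 < beta <= 1) B2.
have {}Phi_ge : c * lam / beta ^+ 2 <= energy n lam beta all_directions.
  by apply: Phi_ge; rewrite beta0.
set Phi := energy n lam beta all_directions in Phi_ge *.
(* A common scale for both sides: x sits at level p * len x with inverse temperature beta * (p / q),
   and y at level q * len y with beta. *)
pose h l := edge_energy n lam (beta / q%:R * l%:R).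
have bq : 0 < beta / q%:R by rewrite divr_gt0.
have h0 l : 0 <= h l by exact: edge_energy_ge0.
have hd l : h l.+1 <= h l.
  by apply: edge_energy_le => //; rewrite ler_pM2l // ler_nat.
(* Levels above q * n are set aside, since they would involve primitive vectors of length greater
   than n, which need not fit in the grid. *)
have split_sum : energy n lam (beta * (p%:R / q%:R)) (in_cone N i) =
   \sum_(x : grid n | coprime x.1 x.2 && in_cone N i x.1 x.2 && (p * len x <= q * n)%N)
      h (p * len x)%N +
   \sum_(x : grid n | coprime x.1 x.2 && in_cone N i x.1 x.2 && ~~ (p * len x <= q * n)%N)
      h (p * len x)%N.
  rewrite -bigID /=; apply: eq_bigr => x _; congr edge_energy.
  by rewrite natrM; field; rewrite gt_eqF.
have head : \sum_(x : grid n | coprime x.1 x.2 && in_cone N i x.1 x.2 &&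
     (p * len x <= q * n)%N) h (p * len x)%N <= kappa * Phi + K * h 1%N.
  apply: le_trans (@layer_compare R h _ _ _ (fun y : grid n => coprime y.1 y.2 && (len y <= n)%N)
     (fun x => p * len x)%N (fun y => q * len y)%N kappa K (q * n) h0 hd _ K0 _ _ _) _.
  - by rewrite muln_gt0 q0.
  - move=> x /andP[/andP[/coprime_len_gt0 hx _] ->].
    by rewrite muln_gt0 p0 hx.
  - by move=> y /andP[/coprime_len_gt0 hy hn]; rewrite muln_gt0 q0 hy leq_mul2l hn orbT.
  - move=> l lL; apply: (@le_trans _ _ (primitive_count (in_cone N i) (l %/ p))%:R).
      rewrite ler_nat /primitive_count /lattice_count.
      apply: leq_trans _ (@card_lattice_widen
        (fun a b => coprime a b && in_cone N i a b) n _ _ (leqnn _)).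
      apply: subset_leq_card; apply/fintype.subsetP => x; rewrite !unfold_in /=.
      move=> /andP[/andP[/andP[h1 ->] _] h2]; have := coprime_len_gt0 h1.
      by rewrite /len => ->; rewrite h1 leq_divRL // mulnC h2.
    apply: le_trans (hK l) _; rewrite lerD2r ler_wpM2l // ler_nat.
    have lq : (l %/ q <= n)%N by rewrite -ltnS ltn_divLR // (leq_ltn_trans lL) // mulnC ltn_pmul2r.
    apply: (leq_trans (@card_lattice_widen _ _ n _ lq)).
    apply: subset_leq_card; apply/fintype.subsetP => x; rewrite !unfold_in /=.
    move=> /andP[/andP[_ h2] /andP[-> _]] /=; rewrite (leq_trans h2 lq) /=.
    by rewrite leq_divRL // mulnC in h2.
  rewrite lerD2r ler_wpM2l // /Phi /energy.
  have -> : \sum_(y : grid n | coprime y.1 y.2 && (len y <= n)%N) h (q * len y)%N =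
     \sum_(y : grid n | coprime y.1 y.2 && (len y <= n)%N)
         edge_energy n lam (beta * (len y)%:R).
    apply: eq_bigr => y _; congr edge_energy.
    by rewrite natrM; field; rewrite gt_eqF.
  by apply: ler_sum_subset => [y /andP[->]//|y _]; exact: edge_energy_ge0.
(* At most (n + 1) ^ 2 <= 4 * n ^ 2 vectors are left. Each has energy O(lam / (beta * n) ^ 3), so
   that they total lam / beta ^ 2 times O(1 / (beta * n)). *)
have tail : \sum_(x : grid n | coprime x.1 x.2 && in_cone N i x.1 x.2 &&
     ~~ (p * len x <= q * n)%N) h (p * len x)%N <= 4 * n%:R ^+ 2 * h (q * n)%N.
  apply: (@le_trans _ _ (\sum_(x : grid n | coprime x.1 x.2 && in_cone N i x.1 x.2 &&
     ~~ (p * len x <= q * n)%N) h (q * n)%N)).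
    apply: ler_sum => x /andP[_]; rewrite -ltnNge => /ltnW hx.
    by apply: edge_energy_le => //; rewrite ler_pM2l // ler_nat.
  rewrite sumr_const -[leLHS]mulr_natl; apply: ler_wpM2r; first exact: h0.
  apply: (@le_trans _ _ #|{: grid n}|%:R); first by rewrite ler_nat max_card.
  rewrite card_prod !card_ord natrM -natr1.
  have : (1 : R) <= n%:R by rewrite ler1n.
  by move: (n%:R : R) => y y1; nra.
have err1 : K * h 1%N <= delta / 4 * Phi.
  apply: (@le_trans _ _ (delta / 4 * (c * lam / beta ^+ 2))); last first.
    by rewrite ler_pM2l //; lra.
  apply: (@le_trans _ _ (K * (lam * (q%:R / beta)))).
    rewrite ler_wpM2l // /h mulr1; apply: le_trans (edge_energy_le_lin _ _ lam0') _.
    rewrite ler_pM2l // -[leRHS]invf_div; exact: trunc_geom_le_inv.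
  have -> : K * (lam * (q%:R / beta)) = lam / beta ^+ 2 * (K * q%:R * beta).
    by field; rewrite gt_eqF.
  have -> : delta / 4 * (c * lam / beta ^+ 2) = lam / beta ^+ 2 * (c * delta / 4).
    by field; rewrite gt_eqF.
  rewrite ler_pM2l ?divr_gt0 ?exprn_gt0 //.
  move: betaK; rewrite ler_pdivlMr; last by lra.
  lra.
have err2 : 4 * n%:R ^+ 2 * h (q * n)%N <= delta / 4 * Phi.
  apply: (@le_trans _ _ (delta / 4 * (c * lam / beta ^+ 2))); last first.
    by rewrite ler_pM2l //; lra.
  have -> : h (q * n)%N = edge_energy n lam (beta * n%:R).
    by rewrite /h natrM; congr edge_energy; field; rewrite gt_eqF.
  have s0 : 0 < beta * n%:R by rewrite mulr_gt0.
  apply: (@le_trans _ _ (4 * n%:R ^+ 2 * (lam * (27 / (beta * n%:R) ^+ 3)))).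
    rewrite ler_pM2l ?mulr_gt0 ?exprn_gt0 //.
    apply: le_trans (edge_energy_le_lin _ _ lam0') _; rewrite ler_pM2l //.
    apply: le_trans (trunc_geom_le_cube _ s0) _; rewrite ler_pM2l //.
    have s1 : 0 < 1 + beta * n%:R by lra.
    rewrite lef_pV2 ?posrE ?exprn_gt0 ?mulr_gt0 ?exprn_gt0 //.
    rewrite exprS ler_pM2l // ler_pXn2r ?nnegrE ?(ltW s0) ?(ltW s1) //; lra.
  have -> : 4 * n%:R ^+ 2 * (lam * (27 / (beta * n%:R) ^+ 3)) =
     lam / beta ^+ 2 * (108 / (beta * n%:R)).
    by field; rewrite !gt_eqF.
  have -> : delta / 4 * (c * lam / beta ^+ 2) = lam / beta ^+ 2 * (c * delta / 4).
    by field; rewrite gt_eqF.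
  rewrite ler_pM2l ?divr_gt0 ?exprn_gt0 //.
  move: B1; rewrite !ler_pdivrMr //; lra.
rewrite split_sum; move: head tail err1 err2; rewrite /kappa.
move: (h _) (h _) => x y; lra.
Qed.

End EnergyCompare.

(** * Edge configurations and their sizes *)

(* A set of edges with distinct directions, encoded by the multiplicity along
   each primitive direction. *)
Definition config (n : nat) : Type := {ffun grid n -> 'I_n.+1}.

Definition edge_number (n : nat) (w : config n) : nat :=
  #|[pred x | (0 < w x)%N]|.

Definition supported (n : nat) (Q : pred (grid n)) (w : config n) : bool :=
  [forall x, (0 < w x)%N ==> Q x].

(** Distributing the product: at each x in Q, the term 1 stands for multiplicity 0 and the others
    for the positive multiplicities. *)
Lemma sum_config (A : comNzRingType) (n : nat) (Q : pred (grid n))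
    (g : grid n -> nat -> A) :
  \sum_(w : config n | supported Q w) \prod_(x | (0 < w x)%N) g x (w x) =
  \prod_(x | Q x) (1 + \sum_(1 <= m < n.+1) g x m).
Proof.
pose G (x : grid n) (m : 'I_n.+1) : A :=
  if (0 < m)%N then (if Q x then g x m else 0) else 1.
transitivity (\prod_x \sum_m G x m); last first.
  rewrite [RHS]big_mkcond; apply: eq_bigr => x _.
  rewrite big_ord_recl /G /= big_add1 big_mkord /=.
  case: (Q x); first by congr (_ + _); apply: eq_bigr.
  by rewrite big1 ?addr0.
rewrite bigA_distr_bigA [LHS]big_mkcond; apply: eq_bigr => w _.
case: (boolP (supported Q w)) => [/forallP hw|].
  rewrite big_mkcond; apply: eq_bigr => x _; rewrite /G.
  by have := hw x; case: ltnP => //= _ ->.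
rewrite negb_forall => /existsP[x]; rewrite negb_imply => /andP[wx /negbTE Qx].
by rewrite (bigD1 x) //= /G wx Qx mul0r.
Qed.

(** * Log-concave sequences and their modes *)

Section LogConcave.
Variable R : realFieldType.

(* The coefficients of a product of factors 1 + u X with u >= 0: Newton's
   inequalities, in the form stable under multiplication by such a factor. *)
Definition log_concave (a : nat -> R) : Prop :=
  [/\ a 0%N = 1, forall i, 0 <= a i,
     forall i j, (i <= j)%N -> a i * a j.+1 <= a i.+1 * a j &
     forall j, j.+1%:R * a j.+1 <= a 1%N * a j].

Lemma log_concave_mulDX (u : R) (p : {poly R}) : 0 <= u ->
  log_concave (nth 0 p) -> log_concave (nth 0 ((1 + u *: 'X) * p)).
Proof.
move=> u0 [p0 pp plc pn].
have cE i : ((1 + u *: 'X) * p)`_i = p`_i + u * (if i is i'.+1 then p`_i' else 0).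
  by rewrite mulrDl mul1r -scalerAl coefD coefZ coefXM; case: i.
split.
- by rewrite cE mulr0 addr0.
- by move=> [|i]; rewrite cE addr_ge0 // mulr_ge0.
- move=> i j ij; rewrite !cE.
  case: j ij => [|j] ij.
    case: i ij => // _; have := plc 0%N 0%N isT; rewrite p0 !mul1r.
    have := mulr_ge0 u0 (pp 1%N); have := mulr_ge0 u0 u0; nra.
  have h1 := plc i j.+1 ij.
  case: i ij h1 => [|i] ij h1.
    have h2 := plc 0%N j isT; rewrite p0 mulr0 addr0 in h1 *.
    have h3 := pp 1%N; have h4 := pp j; have h5 := pp j.+1.
    have e1 := mulr_ge0 u0 (mulr_ge0 h3 h4).
    have e2 := mulr_ge0 (mulr_ge0 u0 u0) h4.
    move: h1 e1 e2; rewrite !mul1r; lra.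
  have h2 : p`_i * p`_j.+1 <= p`_i.+1 * p`_j by apply: plc.
  (* Two steps through the product of the coefficients i + 1 and j + 1; this path needs i < j, and
     for i = j both sides are equal. *)
  have h3 : p`_i * p`_j.+2 <= p`_i.+2 * p`_j.
    case: (leqP i.+1 j) => h.
      apply: (le_trans (plc i j.+1 _)); first by rewrite ltnW // ltnW.
      exact: plc.
    have -> : i = j by lia.
    by rewrite mulrC.
  have k2 := ler_wpM2l u0 h3.
  have k3 := ler_wpM2l (mulr_ge0 u0 u0) h2.
  by move: h1 k2 k3; lra.
- move=> j; rewrite !cE p0 mulr1; have h1 := pn j.
  case: j h1 => [|j] h1.
    by move: h1; rewrite p0 mulr0 addr0 !mulr1 mul1r; lra.
  have h2 := ler_wpM2l u0 (pn j).
  have h3 := mulr_ge0 (mulr_ge0 u0 u0) (pp j).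
  move: h1 h2 h3; rewrite -!(natr1 j.+1) -!(natr1 j); lra.
Qed.

Lemma log_concave_prod (I : Type) (r : seq I) (P : pred I) (u : I -> R) :
  (forall i, 0 <= u i) ->
  log_concave (nth 0 (\prod_(i <- r | P i) (1 + u i *: 'X))).
Proof.
move=> u0; elim/big_rec: _ => [|i p _ hp]; last exact: log_concave_mulDX.
have c1 i : (1 : {poly R})`_i = (i == 0%N)%:R by rewrite coef1.
split.
- by rewrite c1.
- by move=> i; rewrite c1 ler0n.
- by move=> i j _; rewrite !c1 /= mulr0 mul0r.
- by move=> j; rewrite !c1 /= mulr0 mul0r.
Qed.

Lemma coef1_prod (I : Type) (r : seq I) (P : pred I) (u : I -> R) :
  (\prod_(i <- r | P i) (1 + u i *: 'X))`_1 = \sum_(i <- r | P i) u i.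
Proof.
suff : (\prod_(i <- r | P i) (1 + u i *: 'X))`_0 = 1 /\
  (\prod_(i <- r | P i) (1 + u i *: 'X))`_1 = \sum_(i <- r | P i) u i by case.
elim/big_rec2: _ => [|i s p _ [h0 h1]]; first by rewrite !coef1.
have cE i' : ((1 + u i *: 'X) * p)`_i' = p`_i' + u i * (if i' is k.+1 then p`_k else 0).
  by rewrite mulrDl mul1r -scalerAl coefD coefZ coefXM; case: i'.
by rewrite !cE h0 h1 mulr0 addr0 mulr1 addrC.
Qed.

(* The activity making K.+1 the mode of i |-> lam ^ i * a i, or 1 when the
   mode is already smaller. *)
Definition mode_activity (a : nat -> R) (K : nat) : R :=
  if a K.+1 <= a K then 1 else a K / a K.+1.

(** In both cases lam ^ i has the single value lam ^ (K + 1) on these sizes, so that counting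
    configurations and weighing them by their number of edges differ by one common factor. *)
Definition near_mode (a : nat -> R) (K i : nat) : bool :=
  if a K.+1 <= a K then (i <= K.+1)%N else i == K.+1.

Lemma mode_activity_itv a K : log_concave a -> 0 < mode_activity a K <= 1.
Proof.
move=> [a0 ap alc an]; rewrite /mode_activity; case: (leP (a K.+1) (a K)) => h.
  by rewrite ltr01 lexx.
have p1 : 0 < a K.+1 by apply: le_lt_trans h.
have : 0 < a K.
  rewrite lt_neqAle ap andbT; apply/eqP => e.
  by have := alc 0%N K isT; rewrite a0 mul1r -e mulr0 leNgt p1.
by move=> p0; rewrite divr_gt0 // ler_pdivrMr // mul1r ltW.
Qed.

Lemma near_mode_pow a K i : near_mode a K i ->
  mode_activity a K ^+ i = mode_activity a K ^+ K.+1.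
Proof.
rewrite /near_mode /mode_activity; case: ifP => _; first by rewrite !expr1n.
by move=> /eqP ->.
Qed.

Lemma near_mode_le a K i : near_mode a K i -> (i <= K.+1)%N.
Proof. by rewrite /near_mode; case: ifP => // _ /eqP ->. Qed.

(** If lam < 1, the terms K and K + 1 are equal, and log-concavity makes the sequence increase up to
    K + 1 and decrease afterwards. If lam = 1, it decreases from K on and all smaller sizes are in
    the sum. *)
Lemma mode_max a K : log_concave a -> forall i,
  mode_activity a K ^+ i * a i <=
  \sum_(j < K.+2 | near_mode a K j) mode_activity a K ^+ j * a j.
Proof.
move=> hlc i; have [a0 ap alc an] := hlc.
have /andP[l0 l1] := mode_activity_itv K hlc.
set lam := mode_activity a K in l0 l1 *; set b := fun i => lam ^+ i * a i.
have bp j : 0 <= b j by rewrite mulr_ge0 // exprn_ge0 // ltW.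
have blc k j : (k <= j)%N -> b k * b j.+1 <= b k.+1 * b j.
  move=> kj; rewrite /b.
  have -> : lam ^+ k * a k * (lam ^+ j.+1 * a j.+1) =
     lam ^+ (k + j.+1) * (a k * a j.+1) by rewrite exprD; ring.
  have -> : lam ^+ k.+1 * a k.+1 * (lam ^+ j * a j) =
     lam ^+ (k + j.+1) * (a k.+1 * a j) by rewrite -addSnnS exprD; ring.
  by rewrite ler_wpM2l ?exprn_ge0 ?(ltW l0) // alc.
have term (k : 'I_K.+2) : near_mode a K k ->
    b k <= \sum_(j < K.+2 | near_mode a K j) lam ^+ j * a j.
  by move=> hk; rewrite (bigD1 k) //= lerDl; apply: sumr_ge0 => j _; exact: bp.
have dec : (forall j, (K <= j)%N -> b j.+1 <= b j) /\
   (a K.+1 <= a K \/ forall j, (j <= K)%N -> b j <= b j.+1).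
  rewrite /b /lam /mode_activity; case: (leP (a K.+1) (a K)) => h; split.
  - move=> j Kj; rewrite !expr1n !mul1r.
    have := ap K; rewrite le_eqVlt => /orP[/eqP e|p].
      (* A zero coefficient forces the next ones to vanish, as a (j + 1) <= a 1 * a j. *)
      have z : forall d, a (K + d)%N = 0.
        elim=> [|d IH]; first by rewrite addn0.
        apply/eqP; rewrite eq_le ap andbT addnS.
        by have := alc 0%N (K + d)%N isT; rewrite a0 IH mulr0 mul1r.
      by rewrite -(subnKC Kj) -addnS !z.
    rewrite -(ler_pM2l p) (le_trans (alc _ _ Kj)) // ler_wpM2r //.
  - by left.
  - move=> j Kj; have p1 : 0 < a K.+1 by apply: le_lt_trans h.
    have := l0; rewrite /lam /mode_activity leNgt h /= => q0.
    have pK : 0 < a K by rewrite -(pmulr_lgt0 _ (_ : 0 < (a K.+1)^-1)) ?invr_gt0.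
    have := alc _ _ Kj; rewrite exprSr -mulrA ler_pM2l ?exprn_gt0 // => hh.
    by rewrite mulrAC ler_pdivrMr // [leRHS]mulrC.
  - right=> j jK; have p1 : 0 < a K.+1 by apply: le_lt_trans h.
    have := l0; rewrite /lam /mode_activity leNgt h /= => q0.
    have := alc _ _ jK; rewrite exprSr -mulrA ler_pM2l ?exprn_gt0 // => hh.
    by rewrite mulrAC ler_pdivlMr // [leRHS]mulrC.
case: dec => dec inc.
have decK d : b (K.+1 + d)%N <= b K.+1.
  elim: d => [|d IH]; first by rewrite addn0.
  by rewrite addnS (le_trans (dec _ _)) // ltnW // leq_addr.
have mK : near_mode a K (@ord_max K.+1) by rewrite /near_mode; case: ifP => //=.
case: (leqP K.+1 i) => Ki.
  apply: le_trans (term ord_max mK).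
  by have := decK (i - K.+1)%N; rewrite subnKC.
case: inc => [h|inc].
  by apply: (term (Ordinal (ltnW (Ki : i.+1 < K.+2)%N))); rewrite /near_mode h /= ltnW.
apply: le_trans (term ord_max mK).
have up d : (d <= K.+1)%N -> b (K.+1 - d)%N <= b K.+1.
  elim: d => [|d IH] hd; first by rewrite subn0.
  apply: le_trans (IH (ltnW hd)).
  have -> : (K.+1 - d = (K.+1 - d.+1).+1)%N by rewrite subnSK.
  by apply: inc; rewrite subSS leq_subr.
have -> : i = (K.+1 - (K.+1 - i))%N by rewrite subKn // ltnW.
by apply: up; rewrite leq_subr.
Qed.

End LogConcave.

Definition config_len (n : nat) (w : config n) : nat := (\sum_x w x * len x)%N.

(** * Gibbs sums over configurations *)

Section Gibbs.
Variable R : realType.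

Lemma prod_config (A : comNzRingType) (n : nat) (w : config n) (z : A)
    (c : grid n -> A) :
  \prod_(x | (0 < w x)%N) (c x * z) = (\prod_(x | (0 < w x)%N) c x) * z ^+ edge_number w.
Proof. by rewrite big_split /= prodr_const. Qed.

Lemma expR_config (n : nat) (w : config n) (s : grid n -> R) :
  \prod_(x | (0 < w x)%N) expR (- ((w x)%:R * s x)) = expR (- \sum_x (w x)%:R * s x).
Proof.
rewrite -sumrN expR_sum [LHS]big_mkcond; apply: eq_bigr => x _.
by case: (ltnP 0 (w x)) => // ; rewrite leqn0 => /eqP ->; rewrite mul0r oppr0 expR0.
Qed.

Lemma gibbs_sum (n : nat) (Q : pred (grid n)) (lam : R) (s : grid n -> R) :
  \sum_(w : config n | supported Q w)
     lam ^+ edge_number w * expR (- \sum_x (w x)%:R * s x) =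
  \prod_(x | Q x) (1 + lam * trunc_geom n (s x)).
Proof.
transitivity (\prod_(x | Q x)
    (1 + \sum_(1 <= m < n.+1) (expR (- (m%:R * s x)) * lam))); last first.
  by apply: eq_bigr => x _; rewrite -mulr_suml mulrC.
rewrite -(sum_config Q (fun x m => expR (- (m%:R * s x)) * lam)).
by apply: eq_bigr => w _; rewrite prod_config expR_config mulrC.
Qed.

Lemma gibbs_energy (n : nat) (P : pred (grid n)) (lam : R) (s : grid n -> R) :
  0 <= lam ->
  \sum_(w : config n | supported P w)
     lam ^+ edge_number w * expR (- \sum_x (w x)%:R * s x) =
  expR (\sum_(x | P x) edge_energy n lam (s x)).
Proof.
move=> l0; rewrite gibbs_sum expR_sum; apply: eq_bigr => x _.
by rewrite lnK // posrE ltr_pwDl // mulr_ge0 // trunc_geom_ge0.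
Qed.

Definition size_weight (n : nat) (Q : pred (grid n)) (beta : R) (j : nat) : R :=
  \sum_(w : config n | supported Q w && (edge_number w == j))
     expR (- (beta * (config_len w)%:R)).

Lemma config_lenE (n : nat) (w : config n) (beta : R) :
  \sum_x (w x)%:R * (beta * (len x)%:R) = beta * (config_len w)%:R.
Proof.
rewrite /config_len natr_sum mulr_sumr; apply: eq_bigr => x _.
by rewrite natrM mulrCA.
Qed.

(** The variable X marks the edges; the product has the shape for which [log_concave_prod]
    applies. *)
Lemma size_weight_coef (n : nat) (Q : pred (grid n)) (beta : R) (j : nat) :
  size_weight Q beta j =
  (\prod_(x | Q x) (1 + trunc_geom n (beta * (len x)%:R) *: 'X))`_j.
Proof.
have -> : \prod_(x | Q x) (1 + trunc_geom n (beta * (len x)%:R) *: 'X) =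
   \prod_(x | Q x) (1 + \sum_(1 <= m < n.+1)
      ((expR (- (m%:R * (beta * (len x)%:R))))%:P * 'X)).
  apply: eq_bigr => x _; congr (_ + _).
  by rewrite -mulr_suml -rmorph_sum mul_polyC.
rewrite -(sum_config Q (fun x m => (expR (- (m%:R * (beta * (len x)%:R))))%:P * 'X)).
rewrite coef_sum /size_weight big_mkcondr /=; apply: eq_bigr => w _.
rewrite prod_config -rmorph_prod expR_config config_lenE coefCM coefXn.
by rewrite eq_sym; case: eqP; rewrite ?mulr1 ?mulr0.
Qed.

Lemma size_weight_log_concave (n : nat) (Q : pred (grid n)) (beta : R) :
  log_concave (size_weight Q beta).
Proof.
have := @log_concave_prod R _ (index_enum (grid n)) Q
  (fun x => trunc_geom n (beta * (len x)%:R)) (fun x => trunc_geom_ge0 _ _).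
case=> h0 h1 h2 h3; split=> [|i|i j ij|j]; rewrite !size_weight_coef; [exact: h0|exact: h1|exact: h2|exact: h3].
Qed.

Lemma size_weight1 (n : nat) (Q : pred (grid n)) (beta : R) :
  size_weight Q beta 1 = \sum_(x | Q x) trunc_geom n (beta * (len x)%:R).
Proof. by rewrite size_weight_coef coef1_prod. Qed.

Lemma expR_le_pow2 (y : R) (m : nat) : 2 * y + 4 <= m%:R -> 4 * expR y <= 2 ^+ m.
Proof.
move=> hm.
have h1 : expR (1 / 2) <= 2 :> R.
  have := @expR_ge1Dx R (- (1 / 2)); rewrite expRN => h.
  rewrite -[leLHS]invrK -[leRHS]invrK lef_pV2 ?posrE ?invr_gt0 ?expR_gt0 //; lra.
have h2 : (2 : R) <= expR 1 by have := @expR_ge1Dx R 1; lra.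
have h3 : (4 : R) <= expR 2.
  have -> : (2 : R) = 1 + 1 by lra.
  rewrite expRD; have := expR_gt0 (1 : R); nra.
apply: (@le_trans _ _ (expR (y + 2))).
  by rewrite expRD mulrC ler_pM2l ?expR_gt0.
apply: (@le_trans _ _ (expR (m%:R * (1 / 2)))); first by rewrite ler_expR; lra.
by rewrite expRM_natl; apply: lerXn2r; rewrite ?nnegrE ?expR_ge0.
Qed.

(* Concentration of the number of edges follows from doubling the activity; the
   near-mode sizes then carry a polynomial fraction of the total mass. *)
Lemma near_mode_mass (n : nat) (Q : pred (grid n)) (beta lam Phi : R) (K : nat) :
  lam = mode_activity (size_weight Q beta) K ->
  Phi = \sum_(x | Q x) edge_energy n lam (beta * (len x)%:R) ->
  3 / 4 * expR Phi <= (2 * Phi + 6) *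
    \sum_(w : config n |
        supported Q w && near_mode (size_weight Q beta) K (edge_number w))
       lam ^+ edge_number w * expR (- (beta * (config_len w)%:R)).
Proof.
set a := size_weight Q beta => lamE PhiE.
have hlc : log_concave a by exact: size_weight_log_concave.
have /andP[l0 l1] := mode_activity_itv K hlc; rewrite -lamE in l0 l1.
have l0' := ltW l0.
have Phi0 : 0 <= Phi by rewrite PhiE; apply: sumr_ge0 => x _; exact: edge_energy_ge0.
pose f (w : config n) := lam ^+ edge_number w * expR (- (beta * (config_len w)%:R)).
have f0 w : 0 <= f w by rewrite mulr_ge0 ?exprn_ge0 ?expR_ge0.
have total : \sum_(w : config n | supported Q w) f w = expR Phi.
  rewrite PhiE -gibbs_energy //; apply: eq_bigr => w _.
  by rewrite config_lenE.
have byS j : \sum_(w : config n | supported Q w && (edge_number w == j)) f w =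
    lam ^+ j * a j.
  by rewrite /a /size_weight mulr_sumr; apply: eq_bigr => w /andP[_ /eqP <-].
set W := \sum_(w | _) _.
have WE : W = \sum_(j < K.+2 | near_mode a K j) lam ^+ j * a j.
  under [RHS]eq_bigr do rewrite -byS.
  rewrite /W (partition_big (fun w : config n => inord (edge_number w) : 'I_K.+2)
    (fun j => near_mode a K j)) /=; last first.
    by move=> w /andP[_ h]; rewrite inordK // ltnS (near_mode_le h).
  apply: eq_bigr => j hj; apply: eq_bigl => w.
  case: (supported Q w) => //=; apply/andP/eqP => [[h /eqP <-]|->].
    by rewrite inordK // ltnS (near_mode_le h).
  by split => //; rewrite inord_val.
have W0 : 0 <= W by apply: sumr_ge0 => w _; exact: f0.
have hmax j : lam ^+ j * a j <= W by rewrite WE lamE; exact: mode_max.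
(* With m the integer part of 2 * Phi + 4, the power 2 ^ (m + 1) is at least 4 * exp Phi, as the
   tail requires, and only m + 1 sizes remain, each of mass at most W by [mode_max]. *)
have m0 : 0 <= 2 * Phi + 4 by lra.
have /andP[t1 t2] := truncn_itv m0.
set m := Num.truncn _ in t1 t2.
have head : \sum_(w : config n | supported Q w && (edge_number w <= m)%N) f w <=
    m.+1%:R * W.
  rewrite (partition_big (fun w : config n => inord (edge_number w) : 'I_m.+1) predT) //=.
  apply: (@le_trans _ _ (\sum_(j < m.+1) W)).
    apply: ler_sum => j _; apply: le_trans (hmax j); rewrite -byS.
    apply: ler_sum_subset => [w /andP[/andP[-> h] /eqP <-]|w _]; last exact: f0.
    by rewrite inordK //= ltnS.
  by rewrite sumr_const card_ord -[leLHS]mulr_natl.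
have tail : \sum_(w : config n | supported Q w && ~~ (edge_number w <= m)%N) f w <=
    1 / 4 * expR Phi.
  have p2 : 0 < (2 ^+ m.+1 : R) by rewrite exprn_gt0.
  have h1 : 2 ^+ m.+1 * \sum_(w : config n | supported Q w && ~~ (edge_number w <= m)%N) f w
     <= \sum_(w : config n | supported Q w)
       (2 * lam) ^+ edge_number w * expR (- \sum_x (w x)%:R * (beta * (len x)%:R)).
    rewrite mulr_sumr.
    apply: (@le_trans _ _ (\sum_(w : config n | supported Q w && ~~ (edge_number w <= m)%N)
       (2 * lam) ^+ edge_number w * expR (- \sum_x (w x)%:R * (beta * (len x)%:R)))).
      apply: ler_sum => w /andP[_]; rewrite -ltnNge => hw.
      rewrite config_lenE /f exprMn -mulrA ler_wpM2r //.
        by rewrite mulr_ge0 ?exprn_ge0 ?expR_ge0.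
      by rewrite ler_weXn2l // ler1n.
    apply: ler_sum_subset => [w /andP[->]//|w _].
    by rewrite mulr_ge0 ?expR_ge0 ?exprn_ge0 ?mulr_ge0.
  (* Doubling the activity at most squares the partition function, because 1 + 2 u <= (1 + u) ^
     2. *)
  have h2 : \sum_(w : config n | supported Q w)
       (2 * lam) ^+ edge_number w * expR (- \sum_x (w x)%:R * (beta * (len x)%:R)) <=
       expR Phi * expR Phi.
    rewrite gibbs_sum -expRD PhiE -big_split expR_sum.
    apply: ler_prod => x _; have := trunc_geom_ge0 n (beta * (len x)%:R).
    rewrite expRD /edge_energy; move: (trunc_geom _ _) => u u0.
    have lu := mulr_ge0 l0' u0.
    by rewrite lnK ?posrE; [apply/andP; split; nra|lra].
  have h3 : 4 * expR Phi <= 2 ^+ m.+1.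
    by apply: expR_le_pow2; rewrite ltW.
  have e0 := expR_gt0 Phi.
  rewrite -(ler_pM2l p2); apply: (le_trans h1); apply: (le_trans h2).
  move: h3 e0; move: (_ ^+ _) (expR Phi) => y e; nra.
move: total; rewrite (bigID (fun w => edge_number w <= m)%N) /= => total.
have : m.+1%:R * W <= (2 * Phi + 6) * W by rewrite ler_wpM2r // -natr1; lra.
move: head tail total; lra.
Qed.

End Gibbs.

(** * Calibration *)

Section ChooseBeta.
Local Open Scope classical_set_scope.
Variable R : realType.

Lemma continuous_sum (I : Type) (r : seq I) (P : pred I) (F : I -> R -> R) :
  (forall i, continuous (F i)) -> continuous (fun b => \sum_(i <- r | P i) F i b).
Proof.
move=> hF x; elim: r => [|i r IH].
  rewrite (_ : (fun b => _) = (fun=> 0)); first exact: cvg_cst.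
  by apply/funext => b; rewrite big_nil.
case: (boolP (P i)) => Pi.
  rewrite (_ : (fun b => _) = (F i \+ (fun b => \sum_(i <- r | P i) F i b))).
    by apply: continuousD => //; exact: hF.
  by apply/funext => b; rewrite big_cons Pi.
rewrite (_ : (fun b => _) = (fun b => \sum_(i <- r | P i) F i b)) //.
by apply/funext => b; rewrite big_cons (negbTE Pi).
Qed.

Lemma continuous_expR_lin (c : R) : continuous (fun b : R => expR (- (b * c))).
Proof.
move=> x; apply: continuous_comp; last exact: continuous_expR.
by apply: continuousN; apply: continuousM => //; exact: cvg_cst.
Qed.

Variables (n : nat) (Q : pred (grid n)) (K : nat).

Lemma size_weight_continuous (j : nat) : continuous (fun b : R => size_weight Q b j).
Proof. by apply: continuous_sum => w; exact: continuous_expR_lin. Qed.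

Lemma size_weight_gt0 (j : nat) (b b' : R) :
  0 < size_weight Q b j -> 0 < size_weight Q b' j.
Proof.
move=> h.
have [w hw] : exists w : config n, supported Q w && (edge_number w == j).
  apply/existsP; apply: contraTT h; rewrite negb_exists => /forallP h.
  by rewrite /size_weight big1 ?ltxx // => w hw; move: (h w); rewrite hw.
rewrite /size_weight (bigD1 w) //= ltr_pwDl ?expR_gt0 //.
by apply: sumr_ge0 => *; exact: expR_ge0.
Qed.

(** The activity is the minimum of 1 and a quotient of continuous functions. Whether the denominator
    is positive depends on the existence of a configuration with K + 1 edges, not on beta. *)
Lemma mode_activity_continuous :
  continuous (fun b : R => mode_activity (size_weight Q b) K).
Proof.
case: (boolP (0 < size_weight Q (0 : R) K.+1)) => h0.
  have h b := @size_weight_gt0 K.+1 0 b h0.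
  rewrite (_ : (fun b => _) = (fun=> 1) \min
     (fun b => size_weight Q b K / size_weight Q b K.+1)); last first.
    apply/funext => b; rewrite /= /mode_activity minEle ler_pdivlMr // mul1r.
    by [].
  move=> x; apply: continuous_min; first exact: cvg_cst.
  apply: continuousM; first exact: size_weight_continuous.
  apply: continuousV; last exact: size_weight_continuous.
  by rewrite gt_eqF.
rewrite (_ : (fun b => _) = (fun=> 1)); first by move=> x; exact: cvg_cst.
apply/funext => b; rewrite /mode_activity.
have h1 : size_weight Q b K.+1 <= 0.
  by rewrite leNgt; apply: contra h0; exact: size_weight_gt0.
by rewrite (le_trans h1) //; case: (size_weight_log_concave Q b).
Qed.

Lemma energy_mode_continuous :
  continuous (fun b : R => energy n (mode_activity (size_weight Q b) K) b all_directions).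
Proof.
apply: continuous_sum => x b.
apply: (@continuous_comp _ _ _ (fun b => 1 + mode_activity (size_weight Q b) K *
   trunc_geom n (b * (len x)%:R)) (@ln R)).
  apply: continuousD; first exact: cvg_cst.
  apply: continuousM; first exact: mode_activity_continuous.
  apply: continuous_sum => m {}b.
  have := @continuous_expR_lin (m%:R * (len x)%:R) b.
  by under eq_fun do rewrite mulrCA.
apply: continuous_ln; rewrite ltr_pwDl // mulr_ge0 ?trunc_geom_ge0 //.
by have /andP[/ltW] := mode_activity_itv K (size_weight_log_concave Q b).
Qed.

End ChooseBeta.

Lemma natr_large (R : realType) (x : R) : exists n0, forall n, (n0 <= n)%N -> x <= n%:R.
Proof.
exists (Num.bound `|x|) => n hn; apply: (le_trans (ler_norm x)).
by apply: ltW; apply: (lt_le_trans (archi_boundP (normr_ge0 x))); rewrite ler_nat.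
Qed.

(** The last clause of [log_concave], at index K. It bounds the activity from below when many edges
    are asked for, which keeps the energy large as K grows. *)
Lemma mode_activity_lt1 (R : realFieldType) (a : nat -> R) (K : nat) :
  log_concave a -> mode_activity a K < 1 -> K.+1%:R <= mode_activity a K * a 1%N.
Proof.
move=> [a0 ap alc an]; rewrite /mode_activity; case: (leP (a K.+1) (a K)) => h.
  by rewrite ltxx.
move=> _; have p1 : 0 < a K.+1 by apply: le_lt_trans h.
by rewrite mulrAC ler_pdivlMr // [leRHS]mulrC.
Qed.

Section Calibration.
Local Open Scope classical_set_scope.

(* Since the energy is nearly homogeneous of degree -2 in beta, the equation
   energy = beta n puts the mean of both coordinates of the endpoint near n. *)
Lemma choose_beta (R : realType) (C : nat -> nat -> bool) (b0 B0 : R) :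
  0 < b0 <= 1 -> 1 <= B0 ->
  exists n0 k0, forall n K, (n0 <= n)%N -> (k0 <= K)%N ->
  exists beta : R, [/\ 0 < beta <= b0, B0 <= beta * n%:R &
    energy n (mode_activity
      (size_weight (fun x : grid n => coprime x.1 x.2 && C x.1 x.2) beta) K)
      beta all_directions = beta * n%:R].
Proof.
move=> /andP[b00 b01] B01.
have c0 := energy_const_gt0 R; set c := energy_const R in c0.
have B00 : 0 < B0 by lra.
have [n1 hn1] := natr_large (B0 / b0).
have [n2 hn2] := natr_large (54 / b0 ^+ 3).
have [n3 hn3] := natr_large (B0 ^+ 3 / c).
have [k0 hk0] := natr_large (54 * B0 / c).
exists (maxn 1 (maxn n1 (maxn n2 n3))), k0 => n K; rewrite !geq_max.
move=> /and4P[n0 /hn1 h1 /hn2 h2 /hn3 h3] /hk0 hk.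
have n0' : (1 : R) <= n%:R by rewrite ler1n.
have n0'' : (0 : R) < n%:R by lra.
set Q := (fun x : grid n => coprime x.1 x.2 && C x.1 x.2).
pose lam (b : R) := mode_activity (size_weight Q b) K.
pose f (b : R) := energy n (lam b) b all_directions - b * n%:R.
have lo_hi : B0 / n%:R <= b0.
  by move: h1; rewrite !ler_pdivrMr // mulrC.
have lam01 b : 0 < lam b <= 1.
  exact: mode_activity_itv (size_weight_log_concave _ _).
have fc : {within `[B0 / n%:R, b0], continuous f}.
  apply: continuous_subspaceT => b; apply: (@continuousB _ _ _
    (fun b => energy n (lam b) b all_directions) (fun b => b * n%:R)).
    exact: energy_mode_continuous.
  by apply: continuousM => //; exact: cvg_cst.
have lo0 : 0 < B0 / n%:R by rewrite divr_gt0.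
(* At beta = B0 / n the energy has to reach B0. If lam = 1, it is at least c * n ^ 2 / B0 ^ 2; if
   lam < 1, [mode_activity_lt1] bounds it below by c * (K + 1) / 54. This is where n and K must both
   be large. *)
have flo : 0 <= f (B0 / n%:R).
  rewrite /f divfK ?gt_eqF // subr_ge0; set b := B0 / n%:R in lo0 lo_hi *.
  have bn : b * n%:R = B0 by rewrite divfK ?gt_eqF.
  apply: le_trans (energy_ge (lam01 b) _ _); last 2 first.
  - by rewrite lo0 (le_trans lo_hi).
  - by rewrite bn.
  have b2 : 0 < b ^+ 2 by rewrite exprn_gt0.
  rewrite -/c ler_pdivlMr //.
  have /andP[l0 l1] := lam01 b.
  move: l1; rewrite le_eqVlt => /orP[/eqP ->|l1].
    rewrite mulr1 -(ler_pM2r (_ : 0 < n%:R ^+ 2)) ?exprn_gt0 // -mulrA -exprMn bn.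
    move: h3; rewrite ler_pdivrMr // => h3.
    rewrite -exprS; apply: (le_trans h3); rewrite mulrC ler_pM2l //; nra.
  have := mode_activity_lt1 (size_weight_log_concave Q b) l1; rewrite -/(lam b) size_weight1.
  move=> hK.
  have h54 : \sum_(x | Q x) trunc_geom n (b * (len x)%:R) <= 54 / b ^+ 2.
    apply: le_trans (sum_trunc_geom_le n lo0).
    by apply: ler_sum_subset => [x /andP[]//|x _]; exact: trunc_geom_ge0.
  have := le_trans hK (ler_wpM2l (ltW l0) h54).
  rewrite mulrA ler_pdivlMr // => hh.
  move: hk; rewrite ler_pdivrMr // => hk.
  have hKr : K%:R <= K.+1%:R :> R by rewrite ler_nat.
  have := ler_wpM2r (ltW c0) hKr.
  have := ler_wpM2l (ltW c0) hh.
  have := ler_wpM2r (ltW b2) hk.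
  have := ler_wpM2r (ltW b2) (ler_wpM2r (ltW c0) hKr).
  by lra.
(* At b0 the energy is at most 54 / b0 ^ 2 for every n, whereas b0 * n grows. *)
have fhi : f b0 <= 0.
  rewrite subr_le0; have /andP[l0 l1] := lam01 b0.
  apply: le_trans (energy_le _ (ltW l0) b00) _.
  apply: (@le_trans _ _ (54 / b0 ^+ 2)).
    by rewrite ger_pMl // divr_gt0 // exprn_gt0.
  rewrite ler_pdivrMr ?exprn_gt0 //.
  by move: h2; rewrite ler_pdivrMr ?exprn_gt0 // => h2; lra.
have [|b /andP[bl bh] fb] := @IVT R f _ _ 0 lo_hi fc.
  by rewrite ge_min fhi orbT le_max flo.
exists b; split.
- by rewrite (lt_le_trans lo0) ?bl //=.
- by rewrite -ler_pdivrMr.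
- by apply/eqP; rewrite -subr_eq0; apply/eqP.
Qed.

End Calibration.

(** * Exponential tilting and counting *)

Definition cone_len (N i n : nat) (w : config n) : nat :=
  (\sum_(x : grid n | in_cone N i x.1 x.2) w x * len x)%N.

Section Tilt.
Variable R : realType.

Lemma energy_cone_le_all (N p q : nat) (delta : R) :
  (0 < p)%N -> (0 < q)%N -> 0 < delta ->
  exists b0 B0 : R, [/\ 0 < b0, 0 < B0 & forall n (beta lam : R) i, (i < N)%N ->
    0 < beta <= b0 -> B0 <= beta * n%:R -> 0 < lam <= 1 ->
    energy n lam (beta * (p%:R / q%:R)) (in_cone N i) <=
    ((q%:R / p%:R) ^+ 2 / N%:R + delta) * energy n lam beta all_directions].
Proof.
move=> p0 q0 d0.
suff h M : (M <= N)%N -> exists b0 B0 : R, [/\ 0 < b0, 0 < B0 &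
    forall n (beta lam : R) i, (i < M)%N ->
    0 < beta <= b0 -> B0 <= beta * n%:R -> 0 < lam <= 1 ->
    energy n lam (beta * (p%:R / q%:R)) (in_cone N i) <=
    ((q%:R / p%:R) ^+ 2 / N%:R + delta) * energy n lam beta all_directions].
  exact: h.
elim: M => [|M IH] MN; first by exists 1, 1; split.
have [b1 [B1 [b10 B10 h1]]] := IH (ltnW MN).
have [b2 [B2 [b20 B20 h2]]] := energy_cone_le MN p0 q0 d0.
exists (Num.min b1 b2), (Num.max B1 B2); split.
- by rewrite lt_min b10.
- by rewrite lt_max B10.
move=> n beta lam i; rewrite ltnS leq_eqVlt le_min ge_max.
move=> /orP[/eqP ->|iM] /and3P[k1 k2 k3] /andP[k4 k5] k6.
  by apply: h2 => //; rewrite k1.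
by apply: h1 => //; rewrite k1.
Qed.

Lemma energy_cones n lam beta N : (0 < N)%N ->
  energy n lam beta all_directions =
  \sum_(i < N) energy n lam beta (in_cone N i) :> R.
Proof.
move=> N0; rewrite /energy.
rewrite (partition_big (fun x : grid n => Ordinal (cone_lt x.1 x.2 N0)) predT) //=.
by apply: eq_bigr => i _; apply: eq_bigl => x; rewrite andbT.
Qed.

Lemma inv_sqr_le (t : R) : `|t| <= 1 / 3 -> (1 - t)^-1 ^+ 2 <= 1 + 2 * t + 8 * t ^+ 2.
Proof.
rewrite ler_norml => /andP[h1 h2].
have p : 0 < (1 - t) ^+ 2 by rewrite exprn_gt0 //; lra.
rewrite exprVn -div1r ler_pdivrMr //.
have : 0 <= t ^+ 2 * (5 - 14 * t) by rewrite mulr_ge0 ?sqr_ge0 //; lra.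
have : 0 <= t ^+ 2 * t ^+ 2 by rewrite mulr_ge0 ?sqr_ge0.
lra.
Qed.

(** The Chernoff exponent. Tilting by t multiplies the energy of a cone by about (1 - t) ^ -2 = 1 +
    2 t + O(t ^ 2), which corresponds to a mean length 2 n / N; a deviation eta gains 2 * |t| * eta
    against a cost of second order in t. The energy of a cone is bounded below by the total minus
    the upper bounds on the other cones. *)
Lemma cone_energy_tilt (N : nat) (eta : R) : (0 < N)%N -> 0 < eta ->
  exists q : nat, exists c b0 B0 : R, [/\ (3 <= q)%N, 0 < c <= 1, 0 < b0, 0 < B0 &
    forall n (beta lam : R), 0 < beta <= b0 -> B0 <= beta * n%:R -> 0 < lam <= 1 ->
    energy n lam beta all_directions = beta * n%:R -> forall i, (i < N)%N ->
    energy n lam beta (in_cone N i) <= (N%:R^-1 + eta) * (beta * n%:R) /\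
    forall t, `|t| = q%:R^-1 ->
      energy n lam (beta * (1 - t)) (in_cone N i) - energy n lam beta (in_cone N i)
        - (t / N%:R + `|t| * eta) * 2 * (beta * n%:R) <= - (c * (beta * n%:R))].
Proof.
move=> N0 eta0; have N0' : (0 : R) < N%:R by rewrite ltr0n.
have N1 : (1 : R) <= N%:R by rewrite ler1n.
(* With tau = 1 / q, the second-order cost 8 * tau ^ 2 / N is at most half of the gain 2 * tau *
   eta. *)
have [q0 hq0] := natr_large (3 + 8 / (N%:R * eta)).
have := hq0 _ (leqnn _); move: q0 {hq0} => q hq.
have e8 : 0 < 8 / (N%:R * eta) by rewrite divr_gt0 // mulr_gt0.
have q3 : (3 <= q)%N by rewrite -(ler_nat R); lra.
have q0 : (0 < q)%N by lia.
have q0' : (0 : R) < q%:R by rewrite ltr0n.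
pose tau : R := q%:R^-1; have tau0 : 0 < tau by rewrite invr_gt0.
have tau3 : tau <= 1 / 3.
  by rewrite div1r lef_pV2 ?posrE // ler_nat.
have tau8 : 8 * tau / N%:R <= eta.
  have : 8 / (N%:R * eta) <= q%:R by lra.
  rewrite ler_pdivrMr ?mulr_gt0 // => h.
  by rewrite ler_pdivrMr // /tau ler_pdivrMr //; lra.
(* The error delta of the tilted cone and the error N * delta of the lower bound cost together at
   most half of tau * min(eta, 1). The minimum with 1 keeps c at most 1. *)
pose delta := tau * Num.min eta 1 / (4 * N%:R).
have m0 : 0 < Num.min eta 1 by rewrite lt_min eta0 /=.
have m1 : Num.min eta 1 <= 1 by rewrite ge_min lexx orbT.
have m2 : Num.min eta 1 <= eta by rewrite ge_min lexx.
have delta0 : 0 < delta by rewrite divr_gt0 // mulr_gt0.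
have Ndelta : 4 * N%:R * delta = tau * Num.min eta 1.
  by rewrite /delta mulrC divfK // gt_eqF // mulr_gt0.
have qm : (0 < q - 1)%N by rewrite subn_gt0 (leq_trans _ q3).
have [b1 [B1 [b10 B10 h1]]] := energy_cone_le_all N (ltn0Sn 0) (ltn0Sn 0) delta0.
have [b2 [B2 [b20 B20 h2]]] := energy_cone_le_all N qm q0 delta0.
have [b3 [B3 [b30 B30 h3]]] := energy_cone_le_all N (ltn0Sn q) q0 delta0.
exists q, (tau * Num.min eta 1 / 2), (Num.min b1 (Num.min b2 b3)), (Num.max B1 (Num.max B2 B3)).
split => //.
- apply/andP; split; first by rewrite divr_gt0 // mulr_gt0.
  by move: (Num.min _ _) m0 m1 => m *; nra.
- by rewrite !lt_min b10 b20.
- by rewrite !lt_max B10.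
move=> n beta lam; rewrite !le_min !ge_max => /and4P[be0 be1 be2 be3].
move=> /and3P[bn1 bn2 bn3] lam01 PhiE i iN.
have {}h1 j : (j < N)%N -> energy n lam beta (in_cone N j) <=
    (N%:R^-1 + delta) * (beta * n%:R).
  move=> jN; have := h1 n beta lam j jN; rewrite be0 be1 PhiE => /(_ isT bn1 lam01).
  by rewrite !divr1 expr1n mulr1 mul1r.
set Phi := beta * n%:R in PhiE h1 *.
have Phi0 : 0 < Phi by rewrite (lt_le_trans B10).
have dle : delta <= eta.
  have : 4 * delta <= 4 * N%:R * delta by rewrite ler_wpM2r ?(ltW delta0) //; lra.
  have := ler_wpM2r (ltW m0) tau3; rewrite Ndelta; lra.
split.
  apply: (le_trans (h1 i iN)); rewrite ler_pM2r //; lra.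
have low : (N%:R^-1 - N%:R * delta) * Phi <= energy n lam beta (in_cone N i).
  have := PhiE; rewrite (energy_cones _ _ _ N0) (bigD1 (Ordinal iN)) //= => e.
  have : \sum_(j < N | j != Ordinal iN) energy n lam beta (in_cone N j) <=
     (N%:R - 1) * ((N%:R^-1 + delta) * Phi).
    apply: (@le_trans _ _ (\sum_(j < N | j != Ordinal iN) (N%:R^-1 + delta) * Phi)).
      by apply: ler_sum => j _; exact: h1.
    rewrite sumr_const -[leLHS]mulr_natl ler_wpM2r //.
      by rewrite mulr_ge0 ?addr_ge0 ?invr_ge0 // ltW.
    rewrite (cardC1 (Ordinal iN)) card_ord -subn1 natrB //.
  have -> : (N%:R - 1) * ((N%:R^-1 + delta) * Phi) =
     (1 - N%:R^-1 + (N%:R - 1) * delta) * Phi by field; rewrite gt_eqF.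
  have := mulr_gt0 delta0 Phi0.
  move: e; move: (energy _ _ _ _) (\sum_(_ < _ | _) _) => x y; lra.
move=> t ht.
have key : energy n lam (beta * (1 - t)) (in_cone N i) <=
    ((1 - t)^-1 ^+ 2 / N%:R + delta) * Phi.
  have [h|h] : t = tau \/ t = - tau.
    by move: ht; rewrite -/tau; case: (ger0P t) => _ e; [left|right]; lra.
    rewrite h.
    have := h2 n beta lam i iN; rewrite be0 be2 PhiE => /(_ isT bn2 lam01).
    rewrite natrB //; congr (energy _ _ (_ * _) _ <= (_ ^+ 2 / _ + _) * _).
      by rewrite /tau; field; rewrite gt_eqF.
    by rewrite /tau; field; rewrite !gt_eqF //; have : (3 : R) <= q%:R by [rewrite ler_nat]; lra.
  rewrite h.
  have := h3 n beta lam i iN; rewrite be0 be3 PhiE => /(_ isT bn3 lam01).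
  rewrite -natr1; congr (energy _ _ (_ * _) _ <= (_ ^+ 2 / _ + _) * _).
    by rewrite /tau; field; rewrite gt_eqF.
  by rewrite /tau; field; rewrite !gt_eqF //; lra.
have t2 : t ^+ 2 = tau ^+ 2 by rewrite -(real_normK (num_real t)) ht.
have := @inv_sqr_le t; rewrite ht -/tau t2 => /(_ tau3) sq.
have sqN : (1 - t)^-1 ^+ 2 / N%:R <= N%:R^-1 + 2 * (t / N%:R) + tau * (8 * tau / N%:R).
  have -> : N%:R^-1 + 2 * (t / N%:R) + tau * (8 * tau / N%:R) =
    (1 + 2 * t + 8 * tau ^+ 2) / N%:R by field; rewrite gt_eqF.
  by rewrite ler_wpM2r // invr_ge0 ltW.
have taueta := ler_wpM2l (ltW tau0) tau8.
have mm := ler_wpM2l (ltW tau0) m2.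
have small : (N%:R + 1) * delta <= tau * Num.min eta 1 / 2.
  have : (N%:R + 1) * delta <= 2 * N%:R * delta by rewrite ler_pM2r //; lra.
  by move: Ndelta; lra.
have fin : (1 - t)^-1 ^+ 2 / N%:R + delta - (N%:R^-1 - N%:R * delta)
   - (t / N%:R + tau * eta) * 2 <= - (tau * Num.min eta 1 / 2) by lra.
have := ler_wpM2r (ltW Phi0) fin.
move: key low; move: (energy _ _ _ _) (energy _ _ _ _) => x y; lra.
Qed.

(** Exponential Markov inequality: replacing beta by beta * (1 - t) in the cone i multiplies a
    weight by exp (t * beta * length in the cone), which on E is at least exp (t * beta * x0). *)
Lemma gibbs_tilt (n N i : nat) (C : nat -> nat -> bool) (E : pred (config n))
    (lam beta t x0 : R) :
  0 <= lam -> (forall a b, in_cone N i a b -> C a b) ->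
  (forall w, E w -> 0 <= beta * t * ((cone_len N i w)%:R - x0)) ->
  \sum_(w : config n |
      supported (fun x : grid n => coprime x.1 x.2 && C x.1 x.2) w && E w)
    lam ^+ edge_number w * expR (- (beta * (config_len w)%:R)) <=
  expR (energy n lam beta C +
    (energy n lam (beta * (1 - t)) (in_cone N i) - energy n lam beta (in_cone N i))
    - t * beta * x0).
Proof.
move=> lam0 hC hE.
set Q := (fun x : grid n => coprime x.1 x.2 && C x.1 x.2).
pose s (x : grid n) : R := (if in_cone N i x.1 x.2 then beta * (1 - t) else beta) * (len x)%:R.
have sE (w : config n) : \sum_x (w x)%:R * s x =
    beta * (config_len w)%:R - beta * t * (cone_len N i w)%:R.
  rewrite -config_lenE /cone_len natr_sum mulr_sumr [in X in _ - X]big_mkcond -sumrB.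
  apply: eq_bigr => x _; rewrite /s natrM; case: ifP => _; ring.
have eE : \sum_(x | Q x) edge_energy n lam (s x) = energy n lam beta C +
   (energy n lam (beta * (1 - t)) (in_cone N i) - energy n lam beta (in_cone N i)).
  rewrite /energy -/Q !(bigID (fun x : grid n => in_cone N i x.1 x.2) Q) /=.
  have e (F : grid n -> R) : \sum_(x | Q x && in_cone N i x.1 x.2) F x =
      \sum_(x : grid n | coprime x.1 x.2 && in_cone N i x.1 x.2) F x.
    apply: eq_bigl => x; rewrite /Q.
    by case: (boolP (in_cone N i x.1 x.2)) => [/hC ->|]; rewrite ?andbT ?andbF.
  rewrite !e.
  have -> : \sum_(x : grid n | coprime x.1 x.2 && in_cone N i x.1 x.2)
      edge_energy n lam (s x) =
    \sum_(x : grid n | coprime x.1 x.2 && in_cone N i x.1 x.2)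
      edge_energy n lam (beta * (1 - t) * (len x)%:R).
    by apply: eq_bigr => x /andP[_ h]; rewrite /s h.
  have -> : \sum_(x | Q x && ~~ in_cone N i x.1 x.2) edge_energy n lam (s x) =
    \sum_(x | Q x && ~~ in_cone N i x.1 x.2) edge_energy n lam (beta * (len x)%:R).
    by apply: eq_bigr => x /andP[_ /negbTE h]; rewrite /s h.
  by move: (\sum_(_ | _) _) (\sum_(_ | _) _) (\sum_(_ | _) _) => x y z; ring.
rewrite -eE expRD -gibbs_energy // mulr_suml.
apply: (@le_trans _ _ (\sum_(w | supported Q w && E w)
   lam ^+ edge_number w * expR (- \sum_x (w x)%:R * s x) * expR (- (t * beta * x0)))).
  apply: ler_sum => w /andP[_ /hE hw].
  rewrite -mulrA ler_wpM2l ?exprn_ge0 // -expRD ler_expR sE; lra.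
apply: ler_sum_subset => [w /andP[]//|w _].
by rewrite !mulr_ge0 ?expR_ge0 ?exprn_ge0.
Qed.

End Tilt.

Definition prim_in (C : nat -> nat -> bool) (n : nat) (x : grid n) : bool :=
  coprime x.1 x.2 && C x.1 x.2.

(* Indices of the cones around the diagonal, for 4 s ^ 2 cones in all; the
   proportion 1 / s of middle cones dominates the fluctuations of order 1 / s ^ 2
   of the directions of a balanced configuration. *)
Definition middle (s i : nat) : bool :=
  (2 * s ^ 2 - 2 * s <= i < 2 * s ^ 2 + 2 * s)%N.

Definition off_middle (s a b : nat) : bool := ~~ middle s (cone (4 * s ^ 2) a b).

(** * Upper bound for heavy configurations, lower bound for balanced ones *)

Section Counting.
Variable R : realType.

Definition balanced (s n : nat) (w : config n) : bool :=
  [forall i : 'I_(4 * s ^ 2), middle s i ||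
    (`|(cone_len (4 * s ^ 2) i w)%:R - 2 * n%:R / (4 * s ^ 2)%:R|
       <= 2 * n%:R / (4 * s ^ 2)%:R ^+ 2 :> R)].

Definition tilted_energies (N n q : nat) (eta c beta lam : R) : Prop :=
  forall i, (i < N)%N ->
    energy n lam beta (in_cone N i) <= (N%:R^-1 + eta) * (beta * n%:R) /\
    forall t, `|t| = q%:R^-1 ->
      energy n lam (beta * (1 - t)) (in_cone N i) - energy n lam beta (in_cone N i)
        - (t / N%:R + `|t| * eta) * 2 * (beta * n%:R) <= - (c * (beta * n%:R)).

Lemma deviation_mass (N n q i : nat) (eta c beta lam : R) (C : nat -> nat -> bool)
    (up : bool) :
  (0 < q)%N -> 0 < beta -> 0 <= lam -> tilted_energies N n q eta c beta lam ->
  (i < N)%N -> (forall a b, in_cone N i a b -> C a b) ->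
  \sum_(w : config n | supported (@prim_in C n) w &&
     (if up then (N%:R^-1 + eta) * (2 * n%:R) <= (cone_len N i w)%:R
      else (cone_len N i w)%:R <= (N%:R^-1 - eta) * (2 * n%:R)))
    lam ^+ edge_number w * expR (- (beta * (config_len w)%:R)) <=
  expR (energy n lam beta C - c * (beta * n%:R)).
Proof.
move=> q0 beta0 lam0 ht iN hC.
have q1 : (0 : R) < q%:R^-1 by rewrite invr_gt0 ltr0n.
have [_ {}ht] := ht i iN.
pose t : R := if up then q%:R^-1 else - q%:R^-1.
have tE : `|t| = q%:R^-1.
  by rewrite /t; case: (up); rewrite ?normrN ger0_norm // ltW.
pose x0 : R := (N%:R^-1 + (if up then eta else - eta)) * (2 * n%:R).
have := @gibbs_tilt R n N i C (fun w => if up then (N%:R^-1 + eta) * (2 * n%:R)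
    <= (cone_len N i w)%:R else (cone_len N i w)%:R <= (N%:R^-1 - eta) * (2 * n%:R))
    lam beta t x0 lam0 hC.
move=> h; apply: (le_trans (h _)).
  move=> w; rewrite -mulrA => hw; rewrite mulr_ge0 ?(ltW beta0) //.
  move: hw; rewrite /t /x0; case: (up) => hw.
    by rewrite mulr_ge0 ?(ltW q1) // subr_ge0.
  by rewrite mulr_le0 ?oppr_le0 ?(ltW q1) // subr_le0.
rewrite ler_expR; have := ht t tE; rewrite tE.
have -> : t * beta * x0 = (t / N%:R + q%:R^-1 * eta) * 2 * (beta * n%:R).
  by rewrite /x0 /t; case: (up); ring.
lra.
Qed.

(** Each configuration counted here weighs at least lam ^ (K + 1) * exp (- 2 * beta * n), which
    accounts for two of the three beta * n; the third is the energy. *)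
Lemma heavy_cone_count (N n q i K : nat) (eta c beta lam : R) :
  (0 < q)%N -> 0 < beta -> 0 < lam <= 1 -> tilted_energies N n q eta c beta lam ->
  (i < N)%N -> energy n lam beta all_directions = beta * n%:R ->
  #|[pred w : config n | [&& supported (@prim_in all_directions n) w,
      (edge_number w <= K.+1)%N, (config_len w <= 2 * n)%N &
      (N%:R^-1 + eta) * (2 * n%:R) <= (cone_len N i w)%:R]]|%:R * lam ^+ K.+1 <=
  expR (3 * (beta * n%:R) - c * (beta * n%:R)).
Proof.
move=> q0 beta0 /andP[lam0 lam1] ht iN PhiE.
have h := deviation_mass true q0 beta0 (ltW lam0) ht iN
  (C := all_directions) (fun _ _ _ => isT).
rewrite PhiE in h.
have -> : 3 * (beta * n%:R) - c * (beta * n%:R) =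
  2 * (beta * n%:R) + (beta * n%:R - c * (beta * n%:R)) by ring.
rewrite expRD -ler_pdivrMl ?expR_gt0 // -expRN mulrC.
apply: le_trans h.
rewrite -mulrA -sum1_card natr_sum mulr_suml.
apply: (@le_trans _ _ (\sum_(w in [pred w : config n | [&& supported (@prim_in all_directions n) w,
      (edge_number w <= K.+1)%N, (config_len w <= 2 * n)%N &
      (N%:R^-1 + eta) * (2 * n%:R) <= (cone_len N i w)%:R]])
    lam ^+ edge_number w * expR (- (beta * (config_len w)%:R)))).
  apply: ler_sum => w; rewrite unfold_in /= => /and4P[_ h1 h2 _].
  rewrite mul1r ler_pM ?expR_ge0 ?exprn_ge0 ?(ltW lam0) //.
    by rewrite ler_wiXn2l // ltW.
  rewrite ler_expR lerN2 mulrCA ler_pM2l //.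
  by rewrite -natrM ler_nat.
apply: ler_sum_subset => [w|w _]; first by rewrite unfold_in => /and4P[-> _ _ ->].
by rewrite mulr_ge0 ?expR_ge0 // exprn_ge0 // ltW.
Qed.

Lemma config_len_cones (N n : nat) (w : config n) : (0 < N)%N ->
  config_len w = (\sum_(i < N) cone_len N i w)%N.
Proof.
move=> N0; rewrite /config_len.
by rewrite (partition_big (fun x : grid n => Ordinal (cone_lt x.1 x.2 N0)) predT).
Qed.

Lemma card_middle (s : nat) : (0 < s)%N ->
  #|[pred i : 'I_(4 * s ^ 2) | middle s i]| = (4 * s)%N.
Proof.
by move=> s0; rewrite card_interval; nia.
Qed.

(** The 4 s ^ 2 - 4 s outer cones alone give 2 n (1 - 1 / s) (1 - 1 / (4 s ^ 2)). *)
Lemma balanced_len (s n : nat) (w : config n) : (0 < s)%N -> balanced s w ->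
  2 * n%:R * (1 - 2 / s%:R) <= (config_len w)%:R :> R.
Proof.
move=> s0 /forallP bal; have s1 : (1 : R) <= s%:R by rewrite ler1n.
have N0 : (0 < 4 * s ^ 2)%N by rewrite muln_gt0 expn_gt0 s0.
rewrite (config_len_cones w N0) natr_sum.
apply: (@le_trans _ _ (\sum_(i < 4 * s ^ 2 | ~~ middle s i)
   (2 * n%:R / (4 * s ^ 2)%:R - 2 * n%:R / (4 * s ^ 2)%:R ^+ 2))); last first.
  rewrite [leRHS](bigID (fun i : 'I_(4 * s ^ 2) => middle s i)) /=.
  rewrite -[leLHS]add0r lerD ?sumr_ge0 //.
  apply: ler_sum => i hi; have := bal i; rewrite (negbTE hi) /= ler_norml.
  lra.
have cardE : #|[pred i : 'I_(4 * s ^ 2) | ~~ middle s i]|%:R =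
    4 * s%:R ^+ 2 - 4 * s%:R :> R.
  have := cardC [pred i : 'I_(4 * s ^ 2) | middle s i]; rewrite card_middle // card_ord.
  move=> /(congr1 (fun k => k%:R : R)); rewrite natrD !natrM => e.
  rewrite (_ : #|[pred i : 'I_(4 * s ^ 2) | ~~ middle s i]| =
    #|[predC [pred i : 'I_(4 * s ^ 2) | middle s i]]|); last by apply: eq_card.
  by move: e; move: (#|_|%:R : R) => x e; lra.
rewrite sumr_const -[leRHS]mulr_natl cardE (natrM _ 4) natrX.
have -> : (4 * s%:R ^+ 2 - 4 * s%:R) * (2 * n%:R / (4 * s%:R ^+ 2) -
    2 * n%:R / (4 * s%:R ^+ 2) ^+ 2) =
    2 * n%:R * ((1 - s%:R^-1) * (1 - (4 * s%:R ^+ 2)^-1)) :> R.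
  by field; rewrite gt_eqF //; lra.
rewrite ler_wpM2l ?mulr_ge0 //.
have i0 : 0 < (s%:R : R)^-1 by rewrite invr_gt0; lra.
have i1 : (s%:R : R)^-1 <= 1 by rewrite invf_le1 //; lra.
rewrite invfM -exprVn.
move: (s%:R^-1 : R) i0 i1 => x x0 x1.
have : 0 <= x * (1 - x) by rewrite mulr_ge0 //; lra.
have : 0 <= x ^+ 2 * x by rewrite mulr_ge0 ?sqr_ge0 ?ltW.
lra.
Qed.

(** The loss 6 / s is made of 2 / s for the energy of the middle cones and 4 / s for the length
    missing from 2 n. The last hypothesis makes unbalanced configurations negligible within the
    near-mode mass. *)
Lemma balanced_count (s n q K : nat) (c beta lam : R) :
  (0 < s)%N -> (0 < q)%N -> 0 < beta ->
  lam = mode_activity (size_weight (@prim_in (off_middle s) n) beta) K ->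
  tilted_energies (4 * s ^ 2) n q ((4 * s ^ 2)%:R ^- 2) c beta lam ->
  energy n lam beta all_directions = beta * n%:R ->
  (2 * (beta * n%:R) + 6) * (2 * (4 * s ^ 2)%:R) * expR (- (c * (beta * n%:R))) <= 1 / 4 ->
  expR (3 * (beta * n%:R) - 6 / s%:R * (beta * n%:R)) <=
  (4 * (beta * n%:R) + 12) * (lam ^+ K.+1 *
    #|[pred w : config n | [&& supported (@prim_in (off_middle s) n) w,
        (edge_number w <= K.+1)%N & balanced s w]]|%:R).
Proof.
move=> s0 q0 beta0 lamE ht PhiE small.
have s1 : (1 : R) <= s%:R by rewrite ler1n.
have s0' : (0 : R) < s%:R by rewrite ltr0n.
have N0 : (0 < 4 * s ^ 2)%N by rewrite muln_gt0 expn_gt0 s0.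
set N := (4 * s ^ 2)%N in ht N0 small *.
have N0' : (0 : R) < N%:R by rewrite ltr0n.
have NE : N%:R = 4 * s%:R ^+ 2 :> R by rewrite natrM natrX.
set Phi := beta * n%:R in PhiE small *.
have Phi0 : 0 <= Phi by rewrite mulr_ge0 // ltW.
have /andP[lam0 lam1] := mode_activity_itv K
  (size_weight_log_concave (@prim_in (off_middle s) n) beta).
rewrite -lamE in lam0 lam1.
set Q := @prim_in (off_middle s) n in lamE *.
pose Phi2 := energy n lam beta (off_middle s).
have := near_mode_mass lamE (erefl (\sum_(x | Q x) edge_energy n lam (beta * (len x)%:R))).
rewrite -/(energy n lam beta (off_middle s)) -/Phi2.
set near := (fun w : config n => near_mode (size_weight Q beta) K (edge_number w)).
pose f (w : config n) := lam ^+ edge_number w * expR (- (beta * (config_len w)%:R)).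
have f0 w : 0 <= f w by rewrite mulr_ge0 ?exprn_ge0 ?expR_ge0 ?(ltW lam0).
set W := \sum_(w | supported Q w && near w) f w => mass.
have Phi2_le : Phi2 <= Phi by rewrite -PhiE; apply: energy_mono => //; exact: ltW.
have Phi2_0 : 0 <= Phi2 by apply: sumr_ge0 => x _; apply: edge_energy_ge0; exact: ltW.
have Phi2_ge : Phi * (1 - 2 / s%:R) <= Phi2.
  have PE : Phi2 + \sum_(i < N | middle s i) energy n lam beta (in_cone N i) = Phi.
    rewrite -PhiE /Phi2 /energy [RHS](bigID (fun x : grid n => off_middle s x.1 x.2)) /=.
    congr (_ + _); first by apply: eq_bigl => x; rewrite andbT.
    rewrite [RHS](partition_big (fun x : grid n => Ordinal (cone_lt x.1 x.2 N0))
      (fun i : 'I_N => middle s i)) /=; last first.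
      by move=> x /andP[_]; rewrite negbK.
    apply: eq_bigr => i hi; apply: eq_bigl => x.
    rewrite andbT /off_middle negbK -/N -(inj_eq val_inj) /= /in_cone.
    by case: eqP => [->|]; rewrite ?hi ?andbF ?andbT.
  have : \sum_(i < N | middle s i) energy n lam beta (in_cone N i) <=
     4 * s%:R * ((N%:R^-1 + N%:R ^- 2) * Phi).
    apply: (@le_trans _ _ (\sum_(i < N | middle s i) (N%:R^-1 + N%:R ^- 2) * Phi)).
      by apply: ler_sum => i _; have [] := ht i (ltn_ord i).
    by rewrite sumr_const card_middle // -[leLHS]mulr_natl natrM.
  have -> : 4 * s%:R * ((N%:R^-1 + N%:R ^- 2) * Phi) =
      Phi * (s%:R^-1 + (4 * s%:R ^+ 3)^-1).
    by rewrite NE; field; rewrite gt_eqF.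
  have : Phi * (s%:R^-1 + (4 * s%:R ^+ 3)^-1) <= Phi * (2 / s%:R).
    have -> : 2 / s%:R = s%:R^-1 + s%:R^-1 :> R by field; rewrite gt_eqF.
    rewrite ler_wpM2l // lerD2l.
    rewrite lef_pV2 ?posrE ?mulr_gt0 ?exprn_gt0 //.
    rewrite !exprS expr0 mulr1; have := mulr_ge0 (ltW s0') (ltW s0'); nra.
  by move: PE; lra.
pose dev (up : bool) (i : 'I_N) (w : config n) : bool :=
  if up then (N%:R^-1 + N%:R ^- 2) * (2 * n%:R) <= ((cone_len N i w)%:R : R)
  else ((cone_len N i w)%:R : R) <= (N%:R^-1 - N%:R ^- 2) * (2 * n%:R).
have devm up (i : 'I_N) : ~~ middle s i -> \sum_(w | supported Q w && dev up i w) f w <=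
    expR (Phi2 - c * Phi).
  move=> hi; apply: (deviation_mass up q0 beta0 (ltW lam0) ht (ltn_ord i)).
  by move=> a b /eqP h; rewrite /off_middle -/N h.
have devE up i w : dev up i w = if up
  then (N%:R^-1 + N%:R ^- 2) * (2 * n%:R) <= ((cone_len N i w)%:R : R)
  else ((cone_len N i w)%:R : R) <= (N%:R^-1 - N%:R ^- 2) * (2 * n%:R) by [].
clearbody dev.
pose good (w : config n) :=
  [&& supported Q w, (edge_number w <= K.+1)%N & balanced s w].
have union : W <= \sum_(w | supported Q w && near w && balanced s w) f w +
   \sum_(i < N | ~~ middle s i) (\sum_(w | supported Q w && dev true i w) f w +
                     \sum_(w | supported Q w && dev false i w) f w).
  rewrite /W (bigID (fun w => balanced s w)) /= lerD2l.
  under [leRHS]eq_bigr do rewrite [X in X + _]big_mkcond [X in _ + X]big_mkcond -big_split /=.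
  rewrite exchange_big /= [leLHS]big_mkcond; apply: ler_sum => w _.
  have nn i : 0 <= (if supported Q w && dev true i w then f w else 0) +
     (if supported Q w && dev false i w then f w else 0).
    by rewrite addr_ge0 //; case: ifP.
  case: ifP => [/andP[/andP[hs _]]|_]; last by apply: sumr_ge0 => i _; exact: nn.
  rewrite negb_forall => /existsP[i]; rewrite negb_or => /andP[hi hd].
  rewrite (bigD1 i) // -[leLHS]addr0.
  apply: lerD; last by apply: sumr_ge0 => j _; exact: nn.
  rewrite hs !andTb.
  move: hd; rewrite -/N ler_norml negb_and -!ltNge => /orP[h|h].
    have -> : dev false i w.
      by rewrite devE; apply: ltW; move: h; rewrite -[2 * n%:R / _ ^+ 2]/(2 * n%:R * _); lra.
    by rewrite lerDr; case: ifP.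
  have -> : dev true i w.
    by rewrite devE; apply: ltW; move: h; rewrite -[2 * n%:R / _ ^+ 2]/(2 * n%:R * _); lra.
  by rewrite lerDl; case: ifP.
have devsum : \sum_(i < N | ~~ middle s i) (\sum_(w | supported Q w && dev true i w) f w +
      \sum_(w | supported Q w && dev false i w) f w) <= 2 * N%:R * expR (Phi2 - c * Phi).
  apply: (@le_trans _ _ (\sum_(i < N) 2 * expR (Phi2 - c * Phi))).
    rewrite [leLHS]big_mkcond; apply: ler_sum => i _; case: ifP => hi.
      by have := devm true i hi; have := devm false i hi; lra.
    by rewrite mulr_ge0 ?expR_ge0.
  by rewrite sumr_const card_ord -[leLHS]mulr_natl; lra.
have goodsum : \sum_(w | supported Q w && near w && balanced s w) f w <=
    lam ^+ K.+1 * #|[pred w | good w]|%:R * expR (- (beta * (2 * n%:R * (1 - 2 / s%:R)))).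
  rewrite mulrAC -sum1_card natr_sum mulr_sumr.
  apply: (@le_trans _ _ (\sum_(w | supported Q w && near w && balanced s w)
     lam ^+ K.+1 * expR (- (beta * (2 * n%:R * (1 - 2 / s%:R)))))).
    apply: ler_sum => w /andP[/andP[_ hn] hb].
    rewrite /f lamE (near_mode_pow hn) -lamE ler_pM2l ?exprn_gt0 //.
    by rewrite ler_expR lerN2 ler_pM2l // balanced_len.
  under [leRHS]eq_bigr do rewrite mulr1.
  apply: ler_sum_subset => [w /andP[/andP[h1 h2] h3]|w _].
    by rewrite unfold_in /= /good h1 h3 (near_mode_le h2).
  by rewrite mulr_ge0 ?expR_ge0 ?exprn_ge0 ?(ltW lam0).
set G := _ * #|_|%:R in goodsum *.
have G0 : 0 <= G by rewrite mulr_ge0 ?exprn_ge0 ?(ltW lam0).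
rewrite expRD in devsum.
set e2 := expR Phi2 in mass devsum.
set ec := expR (- (c * Phi)) in small devsum.
have e20 : 0 < e2 by exact: expR_gt0.
have ec0 : 0 < ec by exact: expR_gt0.
have W0 : 0 <= W by apply: sumr_ge0.
(* The near-mode sizes account for 3 / 4 of exp Phi2 and the deviations for at most 1 / 4, so half
   is left; hence 4 * Phi + 12, twice 2 * Phi + 6. *)
have main : e2 <= (4 * Phi + 12) * (G * expR (- (beta * (2 * n%:R * (1 - 2 / s%:R))))).
  set X := G * _ in goodsum *.
  have m1 : 3 / 4 * e2 <= (2 * Phi + 6) * W.
    apply: (le_trans mass); rewrite ler_wpM2r //; lra.
  have m2 : W <= X + 2 * N%:R * (e2 * ec) by lra.
  have P6 : 0 <= 2 * Phi + 6 by lra.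
  have := ler_wpM2l P6 m2.
  have := ler_wpM2r (ltW e20) small.
  by move: m1; lra.
have eE : 0 < expR (- (beta * (2 * n%:R * (1 - 2 / s%:R)))) by exact: expR_gt0.
rewrite -(ler_pM2r eE) -[leRHS]mulrA; apply: (le_trans _ main).
rewrite -expRD ler_expR.
have -> : beta * (2 * n%:R * (1 - 2 / s%:R)) = 2 * Phi * (1 - 2 / s%:R).
  by rewrite /Phi; ring.
by move: Phi2_ge; lra.
Qed.

End Counting.

(** * Chains as lists of edges *)

Section EdgeLists.
Local Open Scope nat_scope.

Definition vec : Type := (nat * nat)%type.

Definition vlen (e : vec) : nat := e.1 + e.2.

(** Slopes are compared by cross-multiplication, which covers vertical edges as well. *)
Definition steep (e f : vec) : bool := e.2 * f.1 < f.2 * e.1.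

Definition vgcd (e : vec) : nat := gcdn e.1 e.2.

Definition direction (e : vec) : vec := (e.1 %/ vgcd e, e.2 %/ vgcd e).

Definition scale (d : nat) (e : vec) : vec := (d * e.1, d * e.2).

Definition strict_edges (es : seq vec) : bool :=
  all (fun e => 0 < vlen e) es && sorted steep es.

Definition vsum (es : seq vec) : vec := (\sum_(e <- es) e.1, \sum_(e <- es) e.2).

Lemma steep_trans : transitive steep.
Proof.
move=> [a b] [c d] [e f]; rewrite /steep /= => h1 h2.
have a0 : 0 < a by case: a h1 h2 => //; lia.
have c0 : 0 < c by case: c h1 h2 => //; lia.
have b0 : 0 < b by case: b h1 h2 => //; lia.
have f0 : 0 < f by case: f h2 => //; lia.
case: (posnP (d * e)) => [->|]; first by rewrite muln_gt0 f0.
rewrite muln_gt0 => /andP[d0 e0].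
rewrite -(ltn_pmul2l (_ : 0 < a * b)) ?muln_gt0 ?a0 //.
have := ltn_mul h1 h2; nia.
Qed.

Lemma steep_irr : irreflexive steep.
Proof. by move=> e; rewrite /steep mulnC ltnn. Qed.

Lemma scale_direction (e : vec) : scale (vgcd e) (direction e) = e.
Proof.
by case: e => a b; rewrite /scale /direction /vgcd /= !(mulnC (gcdn a b))
  !divnK ?dvdn_gcdl ?dvdn_gcdr.
Qed.

Lemma vgcd_gt0 (e : vec) : (0 < vgcd e) = (0 < vlen e).
Proof. by rewrite /vgcd gcdn_gt0 addn_gt0. Qed.

Lemma direction_coprime (e : vec) : 0 < vlen e ->
  coprime (direction e).1 (direction e).2.
Proof.
rewrite -vgcd_gt0 => g0; rewrite /coprime -(eqn_pmul2l g0) muln1 muln_gcdr.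
by rewrite (congr1 vgcd (scale_direction e) : gcdn _ _ = _).
Qed.

Lemma direction_scale (d : nat) (x : vec) : 0 < d -> coprime x.1 x.2 ->
  (vgcd (scale d x) = d) * (direction (scale d x) = x).
Proof.
move=> d0 cx; have g : vgcd (scale d x) = d.
  by rewrite /vgcd /scale /= -muln_gcdr (eqP cx) muln1.
split => //; rewrite /direction g /scale /= !mulKn //.
by case: (x).
Qed.

Lemma vlen_scale d x : vlen (scale d x) = d * vlen x.
Proof. by rewrite /vlen /scale mulnDr. Qed.

Lemma steep_parallel d d' x : steep (scale d x) (scale d' x) = false.
Proof. by rewrite /steep /scale /= ltnNge mulnACA [X in X <= _]mulnACA; lia. Qed.

Lemma steep_direction e f : steep e f -> direction e != direction f.
Proof.
move=> h; apply: contraTneq h => h.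
by rewrite -(scale_direction e) -(scale_direction f) h steep_parallel.
Qed.

Lemma coprime_parallel (x y : vec) : coprime x.1 x.2 -> coprime y.1 y.2 ->
  x.2 * y.1 = y.2 * x.1 -> x = y.
Proof.
case: x y => [a b] [c d] /= ce cf h.
have a_c : a %| c by rewrite -(Gauss_dvdr _ ce) h dvdn_mull.
have c_a : c %| a by rewrite -(Gauss_dvdr _ cf) -h dvdn_mull.
have b_d : b %| d by rewrite -(@Gauss_dvdl _ _ a) 1?coprime_sym // -h dvdn_mulr.
have d_b : d %| b by rewrite -(@Gauss_dvdl _ _ c) 1?coprime_sym // h dvdn_mulr.
by congr (_, _); apply/eqP; rewrite eqn_dvd ?a_c ?b_d.
Qed.

Lemma parallel_direction e f : 0 < vlen e -> 0 < vlen f ->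
  e.2 * f.1 = f.2 * e.1 -> direction e = direction f.
Proof.
move=> e0 f0 h.
apply: coprime_parallel; try exact: direction_coprime.
have := scale_direction e; have := scale_direction f.
move: e0 f0; rewrite -!vgcd_gt0.
move: (direction e) (direction f) (vgcd e) (vgcd f) => x y g k g0 k0 hf he.
move: h; rewrite -he -hf /scale /= mulnACA [in RHS]mulnACA (mulnC k) => /eqP.
by rewrite eqn_pmul2l ?muln_gt0 ?g0 // => /eqP.
Qed.

Lemma vsum_cons e es : vsum (e :: es) = (e.1 + (vsum es).1, e.2 + (vsum es).2).
Proof. by rewrite /vsum !big_cons. Qed.

Lemma vlen_vsum es : vlen (vsum es) = \sum_(e <- es) vlen e.
Proof. by rewrite /vlen /= -big_split. Qed.

Lemma strict_edges_uniq es : strict_edges es -> uniq (map direction es).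
Proof.
case/andP=> _; rewrite sorted_pairwise; last exact: steep_trans.
rewrite uniq_pairwise pairwise_map; apply: sub_pairwise => e f.
exact: steep_direction.
Qed.

Lemma strict_edges_rem e es : strict_edges es -> strict_edges (rem e es).
Proof.
case/andP=> h1 h2; apply/andP; split.
  by apply/allP => x /mem_rem; move: x; apply/allP.
by apply: (subseq_sorted steep_trans (rem_subseq e es)).
Qed.

Lemma strict_edges_eq es es' : strict_edges es -> strict_edges es' ->
  es =i es' -> es = es'.
Proof.
case/andP=> _ h1 /andP[_ h2].
exact: (irr_sorted_eq steep_trans steep_irr h1 h2).
Qed.

Definition gentler (e f : vec) : bool := e.2 * f.1 <= f.2 * e.1.

(** The relation [gentler] is total but not transitive, because of the zero vector; totality alone
    orders consecutive edges, and distinct directions make that order strict. *)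
Lemma strict_edges_sort es : all (fun e => 0 < vlen e) es ->
  uniq (map direction es) -> strict_edges (sort gentler es).
Proof.
move=> h u; apply/andP; split; first by rewrite all_sort.
have tot : total gentler by move=> e f; rewrite /gentler leq_total.
have := sort_sorted tot es.
have : uniq (map direction (sort gentler es)).
  by rewrite (perm_uniq (perm_map _ (permEl (perm_sort _ es)))).
have : all (fun e => 0 < vlen e) (sort gentler es) by rewrite all_sort.
case: (sort gentler es) => //= e s; elim: s e => //= f s IH e.
case/andP=> e0 /andP[f0 hs] /andP[]; rewrite in_cons negb_or => /andP[ef _] uf.
case/andP; rewrite /gentler => hef hp; rewrite IH ?f0 //= andbT.
rewrite /steep ltn_neqAle hef andbT; apply: contra ef => /eqP h'.
by rewrite (parallel_direction e0 f0 h').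
Qed.

End EdgeLists.

(** * Correspondence between edge lists and configurations *)

Section ConfigLists.
Local Open Scope nat_scope.

Lemma uniq_map_inj (S T : eqType) (f : S -> T) (s : seq S) :
  uniq (map f s) -> {in s &, injective f}.
Proof.
move=> u x y xs ys fxy.
have hx : index x s < size s by rewrite index_mem.
have hy : index y s < size s by rewrite index_mem.
have := @nth_uniq _ (f x) (map f s) (index x s) (index y s).
rewrite !size_map => /(_ hx hy u); rewrite !(nth_map x) // !nth_index // fxy eqxx.
by move/esym/eqP => e; rewrite -(nth_index x xs) e nth_index.
Qed.

Section Configs.
Variable n : nat.

Definition to_grid (e : vec) : grid n := (inord e.1, inord e.2).

Definition of_grid (x : grid n) : vec := (val x.1, val x.2).

Lemma of_grid_inj : injective of_grid.
Proof. by move=> [a b] [c d] [] /val_inj -> /val_inj ->. Qed.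

Lemma to_gridK (e : vec) : e.1 <= n -> e.2 <= n -> of_grid (to_grid e) = e.
Proof. by case: e => a b /= ha hb; rewrite /of_grid /= !inordK. Qed.

Definition config_of (es : seq vec) : config n :=
  [ffun x => inord (\sum_(e <- es | direction e == of_grid x) vgcd e)].

(** Keeps directions and multiplicities within 0..n, where [inord] is faithful. *)
Definition fits (es : seq vec) : bool :=
  [&& all (fun e => 0 < vlen e) es, (vsum es).1 <= n & (vsum es).2 <= n].

Lemma leq_sum_mem (es : seq vec) (f : vec -> nat) e :
  e \in es -> f e <= \sum_(e' <- es) f e'.
Proof. by move=> h; rewrite (big_rem e) //= leq_addr. Qed.

Lemma fits_le es e : fits es -> e \in es -> (e.1 <= n) * (e.2 <= n).
Proof.
case/and3P=> _ h1 h2 he; split.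
  exact: leq_trans (leq_sum_mem (fun e => e.1) he) h1.
exact: leq_trans (leq_sum_mem (fun e => e.2) he) h2.
Qed.

Lemma fits_direction es e : fits es -> e \in es ->
  of_grid (to_grid (direction e)) = direction e.
Proof.
move=> h he; have [h1 h2] := fits_le h he.
by apply: to_gridK; rewrite /direction /= (leq_trans (leq_div _ _)).
Qed.

Lemma config_ofE es x : fits es ->
  config_of es x = \sum_(e <- es | direction e == of_grid x) vgcd e :> nat.
Proof.
case/and3P=> /allP h0 h1 h2; rewrite ffunE inordK // ltnS.
(* A nonzero coordinate of x bounds the multiplicity along x by the same coordinate of the sum; and
   x = 0 is the direction of no nonzero edge. *)
case: (posnP x.1) => [x1|x1]; last first.
  apply: leq_trans h1; rewrite /vsum /= big_mkcond big_seq [leqRHS]big_seq.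
  apply: leq_sum => e _; case: eqP => // de.
  rewrite -[in leqRHS](scale_direction e) de /scale /=.
  by rewrite leq_pmulr.
case: (posnP x.2) => [x2|x2]; last first.
  apply: leq_trans h2; rewrite /vsum /= big_mkcond big_seq [leqRHS]big_seq.
  apply: leq_sum => e _; case: eqP => // de.
  rewrite -[in leqRHS](scale_direction e) de /scale /=.
  by rewrite leq_pmulr.
rewrite big_seq_cond big_pred0 // => e; apply/negP => /andP[/h0 he /eqP de].
by have := direction_coprime he; rewrite de /= x1 x2.
Qed.

Lemma sum_config_of es (C : nat -> nat -> bool) (g : vec -> nat) : fits es ->
  (forall d a b, 0 < d -> C (d * a) (d * b) = C a b) ->
  (forall d x, g (scale d x) = d * g x) ->
  \sum_(x : grid n | C x.1 x.2) config_of es x * g (of_grid x) =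
  \sum_(e <- es | C e.1 e.2) g e.
Proof.
move=> hf hC hg; have /and3P[/allP h0 _ _] := hf.
rewrite [LHS](eq_bigr (fun x =>
    \sum_(e <- es | direction e == of_grid x) vgcd e * g (of_grid x))); last first.
  by move=> x _; rewrite config_ofE // big_distrl.
rewrite (exchange_big_dep xpredT) //= [RHS]big_mkcond big_seq [RHS]big_seq.
apply: eq_bigr => e he.
have g0 : 0 < vgcd e by rewrite vgcd_gt0 h0.
have CE : C e.1 e.2 = C (direction e).1 (direction e).2.
  by rewrite -[in LHS](scale_direction e) /scale /= hC.
have gE : g e = vgcd e * g (direction e) by rewrite -hg scale_direction.
rewrite CE; case: ifP => hc.
  rewrite (bigD1 (to_grid (direction e))) /=; last first.
    by have := fits_direction hf he; rewrite -[in X in _ = X -> _]/(direction e)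
      => ->; rewrite eqxx andbT; move: (fits_direction hf he) => -[-> ->].
  rewrite (fits_direction hf he) -gE big1 ?addn0 // => x /andP[/andP[_ /eqP ex]].
  by rewrite ex (_ : to_grid (of_grid x) = x) ?eqxx // /to_grid /=;
    case: (x) => a b /=; rewrite !inord_val.
rewrite big1 // => x /andP[hx /eqP ex]; move: hc; rewrite ex /=.
by rewrite hx.
Qed.

Lemma config_of_gt0 es x : fits es ->
  (0 < config_of es x) = (of_grid x \in map direction es).
Proof.
move=> hf; have /and3P[/allP h0 _ _] := hf; rewrite config_ofE //; apply/idP/mapP.
  rewrite lt0n; apply: contraNP => h.
  rewrite big_seq_cond big_pred0 // => e; apply/negP => /andP[he /eqP de].
  by apply: h; exists e.
case=> e he ->; rewrite (big_rem e) //= eqxx ltn_addr // vgcd_gt0; exact: h0.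
Qed.

Lemma config_of_mem es e : fits es -> uniq (map direction es) -> e \in es ->
  config_of es (to_grid (direction e)) = vgcd e :> nat.
Proof.
move=> hf u he; rewrite config_ofE // (fits_direction hf he).
rewrite (big_rem e he) /= eqxx big_seq_cond big_pred0 ?addn0 // => f.
rewrite (mem_rem_uniq _ (map_uniq u)) inE.
apply/negP => /andP[/andP[fe hfe] /eqP d].
by move: fe; rewrite (uniq_map_inj u hfe he d) /= eqxx.
Qed.

Lemma edge_number_config_of es : fits es -> uniq (map direction es) ->
  edge_number (config_of es) = size es.
Proof.
move=> hf u; rewrite /edge_number cardE -(size_map of_grid) -(size_map direction es).
apply: perm_size; apply: uniq_perm => //.
  by rewrite map_inj_uniq ?enum_uniq //; exact: of_grid_inj.
move=> d; apply/mapP/idP => [[x]|/mapP[e he ->]].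
  by rewrite mem_enum unfold_in /= config_of_gt0 // => h ->.
exists (to_grid (direction e)); last by rewrite (fits_direction hf he).
by rewrite mem_enum unfold_in /= config_of_gt0 // (fits_direction hf he) map_f.
Qed.

(** A direction and its multiplicity give back the edge, and strictly increasing slopes fix the
    order of the edges. *)
Lemma config_of_inj es es' : fits es -> fits es' ->
  strict_edges es -> strict_edges es' -> config_of es = config_of es' -> es = es'.
Proof.
have sub es1 es2 : fits es1 -> fits es2 -> strict_edges es1 -> strict_edges es2 ->
    config_of es1 = config_of es2 -> {subset es1 <= es2}.
  move=> f1 f2 s1 s2 ec e he.
  have u1 := strict_edges_uniq s1; have u2 := strict_edges_uniq s2.
  have : 0 < config_of es2 (to_grid (direction e)).
    by rewrite -ec config_of_gt0 // (fits_direction f1 he) map_f.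
  rewrite config_of_gt0 // (fits_direction f1 he) => /mapP[e' he' de].
  have := config_of_mem f1 u1 he; rewrite ec de config_of_mem // => ge.
  by rewrite -(scale_direction e) de -ge scale_direction.
move=> f1 f2 s1 s2 ec; apply: strict_edges_eq => // e.
by apply/idP/idP; apply: sub.
Qed.

Definition edges_of (w : config n) : seq vec :=
  [seq scale (w x) (of_grid x) | x <- enum {: grid n} & 0 < w x].

Definition primitive_config (w : config n) : bool :=
  supported (fun x : grid n => coprime x.1 x.2) w.

Lemma direction_edges_of w : primitive_config w ->
  map direction (edges_of w) = [seq of_grid x | x <- enum {: grid n} & 0 < w x].
Proof.
move=> /forallP hw; rewrite /edges_of -map_comp; apply/eq_in_map => x.
rewrite mem_filter => /andP[wx _]; have := hw x; rewrite wx => cx.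
by have [_ e] := direction_scale wx (cx : coprime (of_grid x).1 (of_grid x).2); exact: e.
Qed.

Lemma edges_of_gt0 w : primitive_config w -> all (fun e => 0 < vlen e) (edges_of w).
Proof.
move=> /forallP hw; apply/allP => e /mapP[x]; rewrite mem_filter => /andP[wx _] ->.
have := hw x; rewrite wx /= => /coprime_len_gt0.
by rewrite vlen_scale muln_gt0 wx.
Qed.

Lemma edges_of_uniq w : primitive_config w -> uniq (map direction (edges_of w)).
Proof.
move=> hw; rewrite direction_edges_of // (map_inj_uniq of_grid_inj).
exact/filter_uniq/enum_uniq.
Qed.

Lemma sum_edges_of w (g : vec -> nat) : (forall d x, g (scale d x) = d * g x) ->
  \sum_(e <- edges_of w) g e = \sum_x w x * g (of_grid x).
Proof.
move=> hg; rewrite /edges_of big_map big_filter big_enum_cond big_mkcond /=.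
by apply: eq_bigr => x _; rewrite hg; case: (w x) => -[|m].
Qed.

Lemma size_edges_of w : size (edges_of w) = edge_number w.
Proof.
rewrite /edges_of size_map /edge_number cardE; apply: perm_size.
apply: uniq_perm => [||x]; [exact/filter_uniq/enum_uniq|exact: enum_uniq|].
by rewrite mem_filter !mem_enum unfold_in /= andbT.
Qed.

Lemma config_of_edges_of w es : primitive_config w -> perm_eq es (edges_of w) ->
  config_of es = w.
Proof.
move=> hw hp; have /forallP hw' := hw; apply/ffunP => x; rewrite ffunE.
rewrite (perm_big _ hp) /= /edges_of big_map big_filter_cond.
have cop y : 0 < w y -> coprime (of_grid y).1 (of_grid y).2.
  by have := hw' y => + wy; rewrite wy.
rewrite big_enum_cond /= (eq_bigl (fun y => (0 < w y) && (y == x))); last first.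
  move=> y; case: (boolP (0 < w y)) => //= wy.
  have [_ ->] := direction_scale wy (cop y wy).
  by apply/eqP/eqP => [/of_grid_inj|->].
rewrite big_mkcondl /= big_pred1_eq; apply: val_inj => /=.
case: (posnP (w x)) => wx; first by rewrite wx inordK.
have [-> _] := direction_scale wx (cop x wx).
by rewrite inord_val.
Qed.

End Configs.

End ConfigLists.

Definition vabs (e : int * int) : vec := (absz e.1, absz e.2).

Definition vint (e : vec) : int * int := (e.1%:Z, e.2%:Z).

Definition vadd (p e : vec) : vec := (p.1 + e.1, p.2 + e.2)%N.

(** * Convex chains as walks along their edges *)

Section Chains.
Variable n : nat.
Implicit Types (p q : grid n) (c : seq (grid n)) (e f : vec) (es : seq vec).

Definition steps c : seq vec := map vabs (edges c).

Definition nonneg_edge (e : int * int) : bool := (0 <= e.1) && (0 <= e.2).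

Lemma edge_vabs p q : nonneg_edge (edge p q) ->
  of_grid q = vadd (of_grid p) (vabs (edge p q)).
Proof.
rewrite /nonneg_edge /edge /= !subr_ge0 !lez_nat => /andP[h1 h2].
rewrite /of_grid /vadd /vabs /=.
by move: h1 h2; move: (val p.1) (val p.2) (val q.1) (val q.2) => a b c d *;
  congr (_, _); lia.
Qed.

Lemma walk_edges p c : all nonneg_edge (pairmap (@edge n) p c) ->
  map (@of_grid n) c = scanl vadd (of_grid p) (map vabs (pairmap (@edge n) p c)).
Proof.
elim: c p => //= q c IH p /andP[h1 h2].
by rewrite -(edge_vabs h1) -IH.
Qed.

Lemma vadd_vsum (v e : vec) es : vadd v (vsum (e :: es)) = vadd (vadd v e) (vsum es).
Proof. by rewrite vsum_cons /vadd /= !addnA. Qed.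

Lemma vadd_vsum0 (v : vec) : vadd v (vsum [::]) = v.
Proof. by rewrite /vsum !big_nil /vadd !addn0; case: v. Qed.

Lemma nth_walk p c l : all nonneg_edge (pairmap (@edge n) p c) ->
  (l <= size c)%N ->
  of_grid (nth p (p :: c) l) =
  vadd (of_grid p) (vsum (take l (map vabs (pairmap (@edge n) p c)))).
Proof.
elim: c p l => [|q c IH] p [|l] //=; try by rewrite vadd_vsum0.
case/andP=> h1 h2 hl; rewrite vadd_vsum -(edge_vabs h1) -IH //.
case: l hl => // l hl; congr of_grid.
by apply: set_nth_default.
Qed.

Lemma vint_edges p es :
  ((of_grid p).1 + (vsum es).1 <= n)%N -> ((of_grid p).2 + (vsum es).2 <= n)%N ->
  pairmap (@edge n) p (map (@to_grid n) (scanl vadd (of_grid p) es)) = map vint es.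
Proof.
elim: es p => [//|e es IH] p; rewrite !vsum_cons => /= h1 h2.
have e1 : of_grid (to_grid n (vadd (of_grid p) e)) = vadd (of_grid p) e.
  by apply: to_gridK; rewrite /vadd /=; lia.
rewrite -[in scanl _ _ _]e1 IH ?e1 /vadd /= -?addnA //.
congr (_ :: _); rewrite /edge; have [-> ->] := e1.
by rewrite /vint /= !PoszD !(addrC (Posz p.1), addrC (Posz p.2)) !addrK.
Qed.

Lemma slope_steep e f : (0 < vlen e)%N -> (0 < vlen f)%N ->
  (slope (vint e) < slope (vint f))%O = steep e f.
Proof.
case: e f => [a b] [c d]; rewrite /vlen /slope /steep /vint /= => e0 f0.
case: a e0 => [|a] e0; case: c f0 => [|c] f0 //=.
- by rewrite ltxx !muln0.
- by rewrite muln0 ltNge leey.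
- by move: f0; rewrite add0n => f0; rewrite ltry muln0 muln_gt0 f0.
rewrite lte_fin ltr_pdivrMr ?ltr0z // mulrAC ltr_pdivlMr ?ltr0z //.
by rewrite -!pmulrn -!natrM ltr_nat.
Qed.

Let slope_steep_in : {in (fun e => 0 < vlen e)%N &,
  relpre vint (fun a b => (slope a < slope b)%O) =2 steep}.
Proof. by move=> e f; exact: slope_steep. Qed.

Lemma convex_chain_nonneg c : convex_chain c ->
  all nonneg_edge (pairmap (@edge n) (grid_origin n) c).
Proof.
by case/and3P=> _ h _; apply: sub_all h => e /and3P[h1 h2 _]; apply/andP.
Qed.

Lemma vabsK (e : int * int) : nonneg_edge e -> vint (vabs e) = e.
Proof.
case: e => a b /andP[/= ha hb]; rewrite /vint /vabs /=.
by rewrite !gez0_abs.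
Qed.

Lemma steps_strict c : convex_chain c -> strict_edges (steps c).
Proof.
move=> hc; have hn := convex_chain_nonneg hc; case/and3P: hc => _ h1 h2.
have E : edges c = map vint (steps c).
  rewrite /steps -map_comp -[LHS]map_id; apply/eq_in_map => e he.
  by rewrite /= vabsK //; apply: (allP hn).
have h3 : all (fun e => 0 < vlen e)%N (steps c).
  move: h1; rewrite E all_map; apply: sub_all => -[a b] /=.
  by rewrite /vlen /= addn_gt0 !lt0n; case: a => [|a] //; case: b.
rewrite /strict_edges h3 /=; move: h2; rewrite E sorted_map.
by rewrite (eq_in_sorted slope_steep_in h3).
Qed.

Lemma size_steps c : size (steps c) = size c.
Proof. by rewrite size_map size_pairmap. Qed.

Lemma chain_vertex c l : convex_chain c -> (l <= size c)%N ->
  of_grid (nth (grid_origin n) (grid_origin n :: c) l) = vsum (take l (steps c)).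
Proof.
move=> hc hl; by rewrite nth_walk //; exact: convex_chain_nonneg.
Qed.

Lemma steps_vsum c : convex_chain c -> vsum (steps c) = (n, n).
Proof.
move=> hc; have := chain_vertex hc (leqnn _).
rewrite -{2}(size_steps c) take_size => <-.
by case/and3P: hc => /eqP; rewrite (last_nth (grid_origin n)) => ->.
Qed.

Lemma steps_fits c : convex_chain c -> fits n (steps c).
Proof.
move=> hc; have /andP[h _] := steps_strict hc.
by rewrite /fits h steps_vsum //= leqnn.
Qed.

Lemma steps_inj c c' : convex_chain c -> convex_chain c' -> steps c = steps c' -> c = c'.
Proof.
move=> /convex_chain_nonneg h1 /convex_chain_nonneg h2 e.
apply: (inj_map (@of_grid_inj n)).
by rewrite (walk_edges h1) (walk_edges h2) -/(steps c) e.
Qed.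

Lemma steps_surj es : strict_edges es -> vsum es = (n, n) ->
  exists2 c, convex_chain c & steps c = es.
Proof.
move=> /andP[h1 h2] hs.
pose c := map (@to_grid n) (scanl vadd (of_grid (grid_origin n)) es).
have E : edges c = map vint es by apply: vint_edges; rewrite hs.
have S : steps c = es.
  rewrite /steps E -map_comp -[RHS]map_id; apply: eq_map => -[a b] //.
exists c => //.
have ha : all (fun a => [&& 0 <= a.1, 0 <= a.2 & a != (0, 0)]) (edges c).
  rewrite E all_map; apply: sub_all h1 => -[[|a] [|b]] //.
apply/and3P; split => //.
  have hn : all nonneg_edge (pairmap (@edge n) (grid_origin n) c).
    by apply: sub_all ha => e /and3P[k1 k2 _]; apply/andP.
  have := nth_walk hn (leqnn _); rewrite -/(steps c).
  rewrite -{2}(size_steps c) take_size S hs -last_nth => e.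
  by apply/eqP/(@of_grid_inj n); rewrite e.
rewrite E sorted_map.
by rewrite (eq_in_sorted slope_steep_in h1).
Qed.

End Chains.

(** * The endpoint of a balanced configuration and its completion *)

Lemma cone_bounds (N a b : nat) :
  (cone N a b * (a + b) <= N * b <= (cone N a b).+1 * (a + b))%N.
Proof.
case: (posnP (a + b)) => [e|h]; last by rewrite cone_ge //= cone_le.
by have [-> ->] : a = 0%N /\ b = 0%N; [lia|rewrite addn0 !muln0].
Qed.

Definition config_vec (n : nat) (w : config n) : vec :=
  (\sum_x w x * x.1, \sum_x w x * x.2)%N.

Lemma sum_cone_len (N n : nat) (w : config n) (g : nat -> nat) : (0 < N)%N ->
  (\sum_(i < N) g i * cone_len N i w)%N =
  (\sum_(x : grid n) g (cone N x.1 x.2) * (w x * len x))%N.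
Proof.
move=> N0.
rewrite [RHS](partition_big (fun x : grid n => Ordinal (cone_lt x.1 x.2 N0)) predT) //=.
apply: eq_bigr => i _; rewrite /cone_len big_distrr /=.
apply: eq_big => [x|x]; first by rewrite -(inj_eq val_inj).
by rewrite /in_cone => /eqP ->.
Qed.

(** In the cone i the second coordinate is between i / N and (i + 1) / N of the length, so the cone
    lengths determine both coordinates up to 1 / N of the total length. *)
Lemma config_vec_bounds (N n : nat) (w : config n) : (0 < N)%N ->
  [/\ (\sum_(i < N) i * cone_len N i w <= N * (config_vec w).2)%N,
      (N * (config_vec w).2 <= \sum_(i < N) i.+1 * cone_len N i w)%N,
      (\sum_(i < N) (N - i.+1) * cone_len N i w <= N * (config_vec w).1)%N &
      (N * (config_vec w).1 <= \sum_(i < N) (N - i) * cone_len N i w)%N].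
Proof.
move=> N0; rewrite (@sum_cone_len N n w id) // (@sum_cone_len N n w succn) //.
rewrite (@sum_cone_len N n w (fun i => N - i.+1)%N) // (@sum_cone_len N n w (fun i => N - i)%N) //.
rewrite /config_vec /= !big_distrr /=.
have wl (m a b d e : nat) : (a * d <= b * e)%N -> (a * (m * d) <= b * (m * e))%N.
  by move=> h; rewrite mulnCA [leqRHS]mulnCA leq_mul2l h orbT.
split; apply: leq_sum => x _; apply: wl; have /andP[h1 h2] := cone_bounds N x.1 x.2 => //.
  by move: h2; rewrite /len mulnBl mulnDr leq_subLR; move: (_.+1 * _)%N => *; lia.
by move: h1; rewrite /len mulnBl mulnDr; move: (cone _ _ _ * _)%N => *; lia.
Qed.

Lemma card_off_middle (s : nat) : (0 < s)%N ->
  #|[pred i : 'I_(4 * s ^ 2) | ~~ middle s i]| = (4 * s ^ 2 - 4 * s)%N.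
Proof.
move=> s0; have := cardC [pred i : 'I_(4 * s ^ 2) | middle s i].
rewrite card_middle // card_ord => e.
rewrite (_ : #|_| = #|[predC [pred i : 'I_(4 * s ^ 2) | middle s i]]|).
  by rewrite -[in RHS]e addKn.
by apply: eq_card.
Qed.

Lemma middle_rev (s i : nat) : (i < 4 * s ^ 2)%N ->
  middle s (4 * s ^ 2 - i.+1) = middle s i.
Proof. by rewrite /middle; move: (s ^ 2)%N => m; lia. Qed.

(** The reflection of the indices preserves the middle, so the mean of the other indices is (4 s ^ 2
    - 1) / 2. *)
Lemma sum_off_middle (R : realType) (s : nat) : (0 < s)%N ->
  \sum_(i < 4 * s ^ 2 | ~~ middle s i) (i%:R : R) =
  (4 * s%:R ^+ 2 - 1) * (4 * s%:R ^+ 2 - 4 * s%:R) / 2.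
Proof.
move=> s0; set T := \sum_(_ < _ | _) _.
have e : T = \sum_(i < 4 * s ^ 2 | ~~ middle s i) ((4 * s%:R ^+ 2 - 1) - i%:R).
  rewrite /T (reindex_inj rev_ord_inj) /=; apply: eq_big => i.
    by rewrite middle_rev.
  by rewrite natrB // natrM natrX -natr1 => _; ring.
have : T + T = (4 * s%:R ^+ 2 - 1) * (4 * s%:R ^+ 2 - 4 * s%:R).
  rewrite {2}e /T -big_split /=.
  under eq_bigr do rewrite addrC subrK.
  rewrite sumr_const card_off_middle // -[LHS]mulr_natr natrB ?(natrM _ 4) ?natrX //.
  by rewrite leq_mul2l /=; nia.
lra.
Qed.

(** For 4 s ^ 2 cones, t ^ 2 / 4 is the inverse of their number. The factor 1 - t is the proportion
    of outer cones; one factor 1 - t ^ 2 / 4 or 1 + t ^ 2 / 4 comes from the tolerance on cone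
    lengths, the other from the width of a cone. *)
Lemma balanced_vec (R : realType) (s n : nat) (w : config n) :
  (0 < s)%N -> balanced R s w ->
  (forall i, middle s i -> cone_len (4 * s ^ 2) i w = 0%N) ->
  let t := (s%:R : R)^-1 in
  [/\ n%:R * ((1 - t) * (1 - t ^+ 2 / 4) ^+ 2) <= (config_vec w).1%:R,
     (config_vec w).1%:R <= n%:R * ((1 - t) * (1 + t ^+ 2 / 4) ^+ 2),
     n%:R * ((1 - t) * (1 - t ^+ 2 / 4) ^+ 2) <= (config_vec w).2%:R &
     (config_vec w).2%:R <= n%:R * ((1 - t) * (1 + t ^+ 2 / 4) ^+ 2)].
Proof.
move=> s0 /forallP bal mid0 t.
have s1 : (1 : R) <= s%:R by rewrite ler1n.
have s0' : (0 : R) < s%:R by rewrite ltr0n.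
have N0 : (0 < 4 * s ^ 2)%N by rewrite muln_gt0 expn_gt0 s0.
have [] := config_vec_bounds w N0.
set N := (4 * s ^ 2)%N in bal mid0 N0 *.
have NE : N%:R = 4 * s%:R ^+ 2 :> R by rewrite natrM natrX.
have N0' : (0 : R) < N%:R by rewrite ltr0n.
have tE : s%:R * t = 1 by rewrite /t divff // gt_eqF.
pose a : R := 2 * n%:R / N%:R * (1 - N%:R^-1).
pose b : R := 2 * n%:R / N%:R * (1 + N%:R^-1).
have D1 (i : 'I_N) : ~~ middle s i -> a <= (cone_len N i w)%:R <= b.
  move=> hi; have := bal i; rewrite (negbTE hi) /= ler_norml -/N.
  have -> : 2 * n%:R / N%:R ^+ 2 = 2 * n%:R / N%:R * N%:R^-1 :> R.
    by rewrite expr2 invfM mulrA.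
  by rewrite /a /b; lra.
have lo (g : nat -> nat) :
    \sum_(i < N | ~~ middle s i) (g i)%:R * a <= (\sum_(i < N) g i * cone_len N i w)%N%:R.
  rewrite natr_sum [leRHS](bigID (fun i : 'I_N => middle s i)) /=.
  rewrite -[leLHS]add0r lerD ?sumr_ge0 //; apply: ler_sum => i /D1 /andP[h _].
  by rewrite natrM ler_wpM2l.
have hi (g : nat -> nat) :
    (\sum_(i < N) g i * cone_len N i w)%N%:R <= \sum_(i < N | ~~ middle s i) (g i)%:R * b.
  rewrite natr_sum [leLHS](bigID (fun i : 'I_N => middle s i)) /=.
  rewrite big1 ?add0r => [|i hi]; last by rewrite mid0 // muln0.
  by apply: ler_sum => i /D1 /andP[_ h]; rewrite natrM ler_wpM2l.
have S0 := sum_off_middle R s0; rewrite -/N -NE in S0.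
have Sc : \sum_(i < N | ~~ middle s i) (1 : R) = N%:R - 4 * s%:R.
  rewrite sumr_const card_off_middle // natrB ?(natrM _ 4) ?natrX ?NE //.
  by rewrite leq_mul2l /=; nia.
have S1 : \sum_(i < N | ~~ middle s i) (i.+1%:R : R) = (N%:R + 1) * (N%:R - 4 * s%:R) / 2.
  under eq_bigr do rewrite -natr1.
  by rewrite big_split /= S0 Sc; field.
have S2 : \sum_(i < N | ~~ middle s i) ((N - i.+1)%N%:R : R) = (N%:R - 1) * (N%:R - 4 * s%:R) / 2.
  rewrite (eq_bigr (fun i : 'I_N => N%:R * 1 - i.+1%:R)) => [|i _]; last first.
    by rewrite mulr1 natrB.
  by rewrite sumrB -mulr_sumr Sc S1; field.
have S3 : \sum_(i < N | ~~ middle s i) ((N - i)%N%:R : R) = (N%:R + 1) * (N%:R - 4 * s%:R) / 2.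
  rewrite (eq_bigr (fun i : 'I_N => N%:R * 1 - i%:R)) => [|i _]; last first.
    by rewrite mulr1 natrB // ltnW.
  by rewrite sumrB -mulr_sumr Sc S0; field.
have loE : (N%:R - 1) * (N%:R - 4 * s%:R) / 2 * a =
    N%:R * (n%:R * ((1 - t) * (1 - t ^+ 2 / 4) ^+ 2)).
  by rewrite /a NE /t; field; rewrite gt_eqF.
have hiE : (N%:R + 1) * (N%:R - 4 * s%:R) / 2 * b =
    N%:R * (n%:R * ((1 - t) * (1 + t ^+ 2 / 4) ^+ 2)).
  by rewrite /b NE /t; field; rewrite gt_eqF.
rewrite -!(ler_nat R) => h1 h2 h3 h4.
split; rewrite -(ler_pM2l N0').
- have := lo (fun i => N - i.+1)%N; rewrite -mulr_suml S2 loE => h.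
  by rewrite -[leRHS]natrM (le_trans h h3).
- have := hi (fun i => N - i)%N; rewrite -mulr_suml S3 hiE => h.
  by rewrite -[leLHS]natrM (le_trans h4 h).
- have := lo id; rewrite -mulr_suml S0 loE => h.
  by rewrite -[leRHS]natrM (le_trans h h1).
- have := hi succn; rewrite -mulr_suml S1 hiE => h.
  by rewrite -[leLHS]natrM (le_trans h2 h).
Qed.

(** The missing vector has length more than n * t, while its coordinates differ by at most n * t ^ 2
    * (1 - t). Its relative imbalance is thus below t = 1 / s, and the middle cones are those of
    imbalance up to 1 / s. *)
Lemma completion_middle (R : realType) (s n : nat) (w : config n) :
  (1 < s)%N -> (0 < n)%N -> balanced R s w ->
  (forall i, middle s i -> cone_len (4 * s ^ 2) i w = 0%N) ->
  [/\ ((config_vec w).1 <= n)%N, ((config_vec w).2 <= n)%N,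
      (0 < (n - (config_vec w).1) + (n - (config_vec w).2))%N &
      middle s (cone (4 * s ^ 2) (n - (config_vec w).1) (n - (config_vec w).2))].
Proof.
move=> s2 n0 bal mid0; have s0 : (0 < s)%N by exact: ltnW.
have k2 : (2 * s <= 2 * s ^ 2)%N by rewrite leq_mul2l expnS leq_pmulr ?expn_gt0 ?s0.
have k1 : (2 * s ^ 2 - 2 * s <= (4 * s ^ 2).-1)%N.
  by rewrite -ltnS prednK ?muln_gt0 ?expn_gt0 ?s0 //; move: (s ^ 2)%N s0 k2 => m; lia.
have [] := balanced_vec s0 bal mid0.
set t := (s%:R : R)^-1.
have s1 : (2 : R) <= s%:R by rewrite ler_nat.
have n1 : (0 : R) < n%:R by rewrite ltr0n.
have tE : s%:R * t = 1 by rewrite /t divff // gt_eqF //; lra.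
have t0 : 0 < t by rewrite invr_gt0; lra.
have t1 : t <= 1 / 2 by rewrite div1r lef_pV2 ?posrE //; lra.
move: (config_vec w) => [X Y] /=.
have t2 : 0 <= t ^+ 2 by rewrite sqr_ge0.
have t12 : t ^+ 2 <= t / 2 by rewrite expr2; nra.
have t4 : 0 <= t ^+ 2 * t ^+ 2 <= t ^+ 2 / 4.
  by rewrite mulr_ge0 //=; nra.
set U := (1 - t) * (1 + t ^+ 2 / 4) ^+ 2.
set L := (1 - t) * (1 - t ^+ 2 / 4) ^+ 2.
have UL : U - L = (1 - t) * t ^+ 2 by rewrite /U /L; field.
have U1 : U < 1 - t / 2.
  have : U = (1 - t) * (1 + t ^+ 2 / 2 + t ^+ 2 * t ^+ 2 / 16) by rewrite /U; field.
  move=> ->; have : 0 <= t * t ^+ 2 by rewrite mulr_ge0 // ltW.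
  have : 0 <= t * (t ^+ 2 * t ^+ 2) by rewrite !mulr_ge0 // ltW.
  by move: t4 => /andP[]; lra.
move=> X1 X2 Y1 Y2.
have nU : n%:R * U < n%:R * (1 - t / 2) by rewrite ltr_pM2l.
have nt : 0 < n%:R * t by rewrite mulr_gt0.
have Xn : (X <= n)%N by rewrite -(ler_nat R); lra.
have Yn : (Y <= n)%N by rewrite -(ler_nat R); lra.
have Ee : ((n - X) + (n - Y))%N%:R = 2 * n%:R - X%:R - Y%:R :> R.
  by rewrite natrD !natrB //; ring.
have e0 : (0 < (n - X) + (n - Y))%N by rewrite -(ltr0n R) Ee; lra.
have nUL : n%:R * U - n%:R * L = n%:R * t * t * (1 - t).
  by rewrite -mulrBr UL; ring.
have snt : s%:R * (n%:R * t * t * (1 - t)) = n%:R * t * (1 - t).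
  by transitivity (s%:R * t * (n%:R * t * (1 - t))); [ring|rewrite tE mul1r].
have snt2 : 0 <= n%:R * t * t by rewrite mulr_ge0 // ltW.
have d1 : s%:R * (Y%:R - X%:R) <= n%:R * t * (1 - t).
  by rewrite -snt ler_pM2l; lra.
have d2 : s%:R * (X%:R - Y%:R) <= n%:R * t * (1 - t).
  by rewrite -snt ler_pM2l; lra.
have sum_lt : n%:R * t * (1 - t) < 2 * n%:R - X%:R - Y%:R.
  have : n%:R * t < 2 * n%:R - X%:R - Y%:R by lra.
  by lra.
split => //; apply/andP; split.
  rewrite /cone leq_min leq_divRL //; rewrite k1 andbT.
  rewrite -(ler_nat R) natrM Ee natrB //.
  rewrite !natrM ?natrX !natrB //.
  have : 2 * s%:R * (s%:R * (Y%:R - X%:R)) <= 2 * s%:R * (2 * n%:R - X%:R - Y%:R) :> R.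
    by rewrite ler_pM2l; lra.
  lra.
rewrite /cone gtn_min ltn_divLR // -(ltr_nat R) !natrM Ee natrD !natrM ?natrX natrB //.
have : 2 * s%:R * (s%:R * (X%:R - Y%:R)) < 2 * s%:R * (2 * n%:R - X%:R - Y%:R) :> R.
  by rewrite ltr_pM2l; lra.
move=> h; apply/orP; left; lra.
Qed.

Lemma vsum_perm (es es' : seq vec) : perm_eq es es' -> vsum es = vsum es'.
Proof. by move=> h; rewrite /vsum !(perm_big _ h). Qed.

Lemma supported_sub (n : nat) (P Q : pred (grid n)) (w : config n) :
  (forall x, P x -> Q x) -> supported P w -> supported Q w.
Proof.
by move=> h /forallP hw; apply/forallP => x; apply/implyP => /(implyP (hw x)) /h.
Qed.

Lemma off_middle_scale (s d a b : nat) : (0 < d)%N ->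
  off_middle s (d * a) (d * b) = off_middle s a b.
Proof. by move=> d0; rewrite /off_middle cone_scale. Qed.

Lemma off_middle_direction (s : nat) (e : vec) : (0 < vlen e)%N ->
  off_middle s e.1 e.2 = off_middle s (direction e).1 (direction e).2.
Proof.
rewrite -vgcd_gt0 => g0.
by rewrite -[in LHS](scale_direction e) /scale /= off_middle_scale.
Qed.

Lemma config_vec_edges_of (n : nat) (w : config n) : vsum (edges_of w) = config_vec w.
Proof.
by rewrite /vsum !(@sum_edges_of n w) //; case=> [d x|d x].
Qed.

(* A balanced configuration misses the endpoint by a vector lying in the middle
   cones, where it has no edge: adding this vector yields a chain. *)
Lemma balanced_completion (R : realType) (s n : nat) (w : config n) :
  (1 < s)%N -> (0 < n)%N -> supported (@prim_in (off_middle s) n) w -> balanced R s w ->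
  exists2 c : seq (grid n), convex_chain c & (size c = (edge_number w).+1) /\
    config_of n [seq e <- steps c | off_middle s e.1 e.2] = w.
Proof.
move=> s1 n0 hw bal.
have hp : primitive_config w by apply: supported_sub hw => x /andP[].
have mid0 i : middle s i -> cone_len (4 * s ^ 2) i w = 0%N.
  move=> hi; rewrite /cone_len big1 // => x /eqP hx.
  have /forallP/(_ x) := hw; rewrite /prim_in /off_middle hx hi andbF.
  by case: (val (w x)).
have [X1 Y1 e0 em] := completion_middle s1 n0 bal mid0.
set e : vec := ((n - (config_vec w).1)%N, (n - (config_vec w).2)%N).
set L := edges_of w.
have offL : all (fun f : vec => off_middle s f.1 f.2) L.
  apply/allP => f /mapP[x]; rewrite mem_filter => /andP[wx _] -> /=.
  by rewrite off_middle_scale //; have /forallP/(_ x) := hw; rewrite wx => /andP[].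
have off_e : off_middle s e.1 e.2 = false by rewrite /off_middle em.
have Lgt0 : all (fun f => 0 < vlen f)%N (e :: L) by rewrite /= e0 edges_of_gt0.
have Lu : uniq (map direction (e :: L)).
  rewrite /= edges_of_uniq // andbT; apply/negP => /mapP[f fL ef].
  have := allP offL f fL; have := off_e.
  have f0 : (0 < vlen f)%N by move: Lgt0 => /andP[_ /allP/(_ f fL)].
  by rewrite (off_middle_direction s f0) (@off_middle_direction s e) // ef => ->.
have sE := strict_edges_sort Lgt0 Lu.
have pE : perm_eq (sort gentler (e :: L)) (e :: L) by rewrite perm_sort.
have vE : vsum (sort gentler (e :: L)) = (n, n).
  by rewrite (vsum_perm pE) vsum_cons config_vec_edges_of /= !subnK.
have [c hc cE] := steps_surj sE vE.
exists c => //; split.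
  by rewrite -size_steps cE size_sort /= size_edges_of.
rewrite cE; apply: config_of_edges_of => //.
apply: (perm_trans (perm_filter _ pE)); rewrite /= off_e.
by rewrite (all_filterP offL).
Qed.

(** Keeping the edges of a chain outside the middle cones defines a map to configurations; by
    [balanced_completion] its image contains the balanced ones, the added edge bringing K + 1 to K +
    2. *)
Lemma balanced_le_chains (R : realType) (s n K : nat) : (1 < s)%N -> (0 < n)%N ->
  (#|[pred w : config n | [&& supported (@prim_in (off_middle s) n) w,
        (edge_number w <= K.+1)%N & balanced R s w]]| <=
   #|[pred c : K.+2.-bseq (grid n) | convex_chain c]|)%N.
Proof.
move=> s1 n0.
pose F (c : K.+2.-bseq (grid n)) := config_of n [seq e <- steps c | off_middle s e.1 e.2].
apply: leq_trans (leq_imset_card F _).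
apply: subset_leq_card; apply/fintype.subsetP => w.
rewrite unfold_in => /and3P[h1 h2 h3].
have [c hc [sc cE]] := balanced_completion s1 n0 h1 h3.
have hsz : (size c <= K.+2)%N by rewrite sc.
by apply/imsetP; exists (Bseq hsz).
Qed.

(** * Removal of one edge from a heavy chain *)

Lemma leq_card_rel (S T : finType) (P : pred S) (Q : pred T) (r : S -> T -> Prop) :
  (forall x, P x -> exists2 y, Q y & r x y) ->
  (forall x x' y, P x -> P x' -> r x y -> r x' y -> x = x') ->
  (#|P| <= #|Q|)%N.
Proof.
move=> h1 h2; pose f x := [pick y | Q y && `[< r x y >]].
have fP x : P x -> exists2 y, f x = Some y & Q y /\ r x y.
  move=> /h1[y Qy rxy]; rewrite /f; case: pickP => [z /andP[Qz /asboolP rz]|/(_ y)].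
    by exists z.
  by rewrite Qy /= => /asboolP.
rewrite -(card_in_imset (f := f)) => [|x x' Px Px' e].
  rewrite -(card_imset (f := Some) Q); last by move=> ? ? [].
  apply: subset_leq_card; apply/fintype.subsetP => _ /imsetP[x Px ->].
  by have [y -> [Qy _]] := fP x Px; apply/imsetP; exists y.
have [y ey [_ r1]] := fP x Px; have [y' ey' [_ r2]] := fP x' Px'.
by move: e; rewrite ey ey' => -[yy]; apply: (h2 x x' y) => //; rewrite yy.
Qed.

Definition cone_steps (N i n : nat) (c : seq (grid n)) : nat :=
  (\sum_(e <- steps c | in_cone N i e.1 e.2) vlen e)%N.

Lemma in_cone_scale (N i d a b : nat) : (0 < d)%N ->
  in_cone N i (d * a) (d * b) = in_cone N i a b.
Proof. by move=> d0; rewrite /in_cone cone_scale. Qed.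

Lemma cone_len_config_of (N i n : nat) (es : seq vec) : fits n es ->
  cone_len N i (config_of n es) = (\sum_(e <- es | in_cone N i e.1 e.2) vlen e)%N.
Proof.
move=> hf; rewrite -(sum_config_of (C := in_cone N i) (g := vlen) hf) //.
  by move=> *; exact: in_cone_scale.
exact: vlen_scale.
Qed.

Lemma config_len_config_of (n : nat) (es : seq vec) : fits n es ->
  config_len (config_of n es) = (\sum_(e <- es) vlen e)%N.
Proof.
move=> hf; rewrite -(sum_config_of (C := fun _ _ => true) (g := vlen) hf) //.
exact: vlen_scale.
Qed.

Lemma fits_rem (n : nat) e (es : seq vec) : fits n es -> fits n (rem e es).
Proof.
case/and3P=> h0 h1 h2; apply/and3P; split.
- by apply/allP => x /mem_rem; move: x; apply/allP.
- apply: leq_trans h1; rewrite /vsum /=.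
  case: (boolP (e \in es)) => he; last by rewrite rem_id.
  by rewrite [leqRHS](big_rem e) //= leq_addl.
- apply: leq_trans h2; rewrite /vsum /=.
  case: (boolP (e \in es)) => he; last by rewrite rem_id.
  by rewrite [leqRHS](big_rem e) //= leq_addl.
Qed.

Lemma config_of_supported (n : nat) (es : seq vec) : fits n es ->
  supported (@prim_in all_directions n) (config_of n es).
Proof.
move=> hf; apply/forallP => x; apply/implyP; rewrite config_of_gt0 // => /mapP[e he ex].
have /and3P[/allP/(_ e he) h0 _ _] := hf.
by rewrite /prim_in andbT; have := direction_coprime h0; rewrite -ex.
Qed.

(* An edge is removed because the Chernoff bound for the free edges misses the
   factor gained by imposing the endpoint; the endpoint then determines the
   removed edge. *)
Lemma heavy_removal (R : realType) (N i n : nat) (eta : R) (c : seq (grid n)) :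
  0 <= eta -> (N%:R^-1 + eta) * 2 <= 1 ->
  convex_chain c -> (1 < size c)%N ->
  (N%:R^-1 + eta) * (2 * n%:R) < (cone_steps N i c)%:R ->
  exists2 e, e \in steps c &
   (N%:R^-1 + eta) * (2 * n%:R) <= (cone_len N i (config_of n (rem e (steps c))))%:R.
Proof.
move=> eta0 hN hc hs heavy.
have hf := steps_fits hc.
(* Removing an edge outside the cone leaves the length in the cone unchanged. If all edges lie in
   the cone, two of them cannot both be longer than n, and removing one of length at most n leaves
   at least n, which is enough by [hN]. *)
case: (boolP (has (fun e : vec => ~~ in_cone N i e.1 e.2) (steps c))).
  case/hasP=> e he hni; exists e => //.
  rewrite cone_len_config_of ?fits_rem //.
  move: heavy; rewrite /cone_steps (big_rem e he) /= (negbTE hni) => /ltW //.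
move=> /hasPn allin.
have [e he le] : exists2 e, e \in steps c & (vlen e <= n)%N.
  have := vlen_vsum (steps c); rewrite (steps_vsum hc) /vlen /=.
  have := size_steps c; move: hs; case: (steps c) => [|e [|f es]] => [h1 h2|h1 h2|_ _].
  - by move: h1; rewrite -h2.
  - by move: h1; rewrite -h2.
  rewrite !big_cons => hsum.
  case: (leqP (vlen e) n) => h1; first by exists e; rewrite ?inE ?eqxx.
  exists f; first by rewrite !inE eqxx orbT.
  by move: h1 hsum; rewrite /vlen; lia.
exists e => //; rewrite cone_len_config_of ?fits_rem //.
have E : (vlen e + \sum_(f <- rem e (steps c) | in_cone N i f.1 f.2) vlen f = 2 * n)%N.
  transitivity (\sum_(f <- steps c) vlen f)%N.
    rewrite [RHS](big_rem e) //=; congr (_ + _)%N.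
    rewrite big_mkcond big_seq [RHS]big_seq; apply: eq_bigr => f /mem_rem /allin.
    by rewrite negbK => ->.
  by rewrite -vlen_vsum (steps_vsum hc) /vlen /= mul2n addnn.
apply: (@le_trans _ _ n%:R); last first.
  rewrite ler_nat -(leq_add2l (vlen e)) E mul2n -addnn leq_add2r //.
by rewrite mulrA ler_piMl.
Qed.

Lemma small_chain (n : nat) (c : seq (grid n)) : (0 < n)%N ->
  convex_chain c -> (size c <= 1)%N -> c = [:: (ord_max, ord_max)].
Proof.
move=> n0 /and3P[/eqP h _ _]; case: c h => [|p [|q c]] //= h _.
  by have := congr1 (fun x : grid n => val x.1) h => /= e; rewrite -e in n0.
by rewrite h.
Qed.

(** The 1 stands for the one-edge chain, to which [heavy_removal] does not apply. For the others the
    removal is injective: the remaining lists agree, and the common endpoint (n, n) gives back the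
    removed edge. *)
Lemma heavy_chain_count (R : realType) (N i n K : nat) (eta : R) :
  (0 < n)%N -> 0 <= eta -> (N%:R^-1 + eta) * 2 <= 1 ->
  (#|[pred c : K.+2.-bseq (grid n) | convex_chain c &
      ((N%:R^-1 + eta) * (2 * n%:R) < (cone_steps N i c)%:R)%R]| <=
   1 + #|[pred w : config n | [&& supported (@prim_in all_directions n) w,
      (edge_number w <= K.+1)%N, (config_len w <= 2 * n)%N &
      ((N%:R^-1 + eta) * (2 * n%:R) <= (cone_len N i w)%:R)%R]]|)%N.
Proof.
move=> n0 eta0 hN.
set P := [pred c : _ | _ & _].
rewrite -(cardID (fun c : K.+2.-bseq (grid n) => (size c <= 1)%N) P).
apply: leq_add.
  apply: (@leq_trans #|[set c : K.+2.-bseq (grid n) | bseqval c == [:: (ord_max, ord_max)]]|).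
    apply: subset_leq_card; apply/fintype.subsetP => c.
    rewrite !inE => /andP[/andP[hc _] hs].
    by apply/eqP; apply: small_chain.
  rewrite leqNgt; apply/negP => /card_gt1P[c [d [hc hd]]] /negP; apply.
  by move: hc hd; rewrite !inE => /eqP hc /eqP hd; apply/eqP/val_inj; rewrite /= hc hd.
apply: (@leq_card_rel _ _ _ _ (fun (c : K.+2.-bseq (grid n)) w =>
   exists2 e, e \in steps c & w = config_of n (rem e (steps c)))).
  move=> c; rewrite !inE -ltnNge => /andP[hs /andP[hc heavy]].
  have [e he hl] := heavy_removal eta0 hN hc hs heavy.
  have hf := fits_rem e (steps_fits hc).
  exists (config_of n (rem e (steps c))); last by exists e.
  rewrite /= config_of_supported //= hl andbT.
  rewrite edge_number_config_of //; last exact/strict_edges_uniq/strict_edges_rem/steps_strict.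
  rewrite size_rem // size_steps config_len_config_of //.
  apply/andP; split; first by have := size_bseq c; case: (size c).
  rewrite -vlen_vsum /vlen mul2n -addnn; have /and3P[_ h1 h2] := hf.
  exact: leq_add.
move=> c d w; rewrite !inE => /andP[_ /andP[hc _]] /andP[_ /andP[hd _]].
case=> e he -> [f hf] ew; apply: val_inj; apply: steps_inj => //=.
have fe := fits_rem e (steps_fits hc); have ff := fits_rem f (steps_fits hd).
have re : rem e (steps c) = rem f (steps d).
  by apply: (config_of_inj fe ff) => //; apply/strict_edges_rem/steps_strict.
have pc := perm_to_rem he; have pd := perm_to_rem hf.
have ef : e = f.
  have := vsum_perm pc; have := vsum_perm pd.
  rewrite !vsum_cons !steps_vsum // re; move: (vsum _) => v.
  by case: (e) (f) => [a b] [a' b'] /= [h1 h2] [h3 h4]; clear -h1 h2 h3 h4;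
    congr (_, _); lia.
apply: strict_edges_eq; try exact: steps_strict.
move=> x; rewrite (perm_mem pc) (perm_mem pd) re ef //.
Qed.

(** * The limit shape *)

Local Open Scope classical_set_scope.

Lemma cone_steep (N : nat) (e f : vec) : (0 < vlen e)%N -> (0 < vlen f)%N ->
  steep e f -> (cone N e.1 e.2 <= cone N f.1 f.2)%N.
Proof.
rewrite /steep /vlen /cone => e0 f0 h; rewrite leq_min geq_minr andbT geq_min.
apply/orP; left; rewrite leq_divRL //.
rewrite -(leq_pmul2r e0) mulnAC.
apply: (@leq_trans (N * e.2 * (f.1 + f.2))).
  by rewrite leq_mul2r leq_trunc_div orbT.
rewrite -!mulnA leq_mul2l; apply/orP; right; nia.
Qed.

Lemma filter_take (T : Type) (P : pred T) (r : rel T) (s : seq T) :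
  (forall x y, r x y -> P y -> P x) -> pairwise r s ->
  [seq x <- s | P x] = take (count P s) s.
Proof.
move=> h; elim: s => //= x s IH /andP[hx hs].
case: (boolP (P x)) => [_|/negbTE Px] /=; first by rewrite IH.
have c0 : count P s = 0%N.
  apply/eqP; rewrite -leqn0 leqNgt -has_count -all_predC.
  by apply: sub_all hx => y /h hy /=; apply: contraFN Px.
rewrite c0 take0; have := size_filter P s; rewrite c0.
by case: [seq x <- s | P x].
Qed.

Lemma leq_vsum_take (es : seq vec) (k l : nat) : (k <= l)%N ->
  ((vsum (take k es)).1 <= (vsum (take l es)).1)%N /\
  ((vsum (take k es)).2 <= (vsum (take l es)).2)%N.
Proof.
move=> kl; have -> : take l es = take k es ++ take (l - k) (drop k es).
  by rewrite -takeD subnKC.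
by rewrite /vsum /= !big_cat /= !leq_addr.
Qed.

Section Shape.
Variables (N n : nat) (c : seq (grid n)).
Hypotheses (N0 : (0 < N)%N) (hc : convex_chain c).

Let es := steps c.

Definition before (j : nat) (e : vec) : bool := (cone N e.1 e.2 < j)%N.

(** Edges sorted by slope are sorted by cone, so those counted here form a prefix of the chain and
    this number is the index of a vertex. *)
Definition cut (j : nat) : nat := count (before j) es.

Lemma filter_before j : [seq e <- es | before j e] = take (cut j) es.
Proof.
have /andP[h1 h2] := steps_strict hc.
apply: (@filter_take _ _ (fun e f => (cone N e.1 e.2 <= cone N f.1 f.2)%N)).
  by move=> x y; exact: leq_ltn_trans.
have : pairwise steep es by rewrite -sorted_pairwise //; exact: steep_trans.
apply: (sub_in_pairwise (P := fun e => (0 < vlen e)%N)) => // e f he hf.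
exact: cone_steep.
Qed.

Lemma cut_le j : (cut j <= size es)%N.
Proof. exact: count_size. Qed.

Lemma nth_before l j : (l < size es)%N ->
  before j (nth (0%N, 0%N) es l) = (l < cut j)%N.
Proof.
move=> hl; apply/idP/idP => h; last first.
  have : nth (0%N, 0%N) es l \in take (cut j) es.
    by rewrite -(nth_take _ h) mem_nth // size_take_min leq_min h hl.
  by rewrite -filter_before mem_filter => /andP[].
rewrite ltnNge; apply/negP => lc.
have e : es = take (cut j) es ++ drop (cut j) es by rewrite cat_take_drop.
have : count (before j) (drop (cut j) es) = 0%N.
  have := congr1 (count (before j)) e; rewrite count_cat -filter_before.
  rewrite (count_filter _ _ es) (eq_count (a2 := before j)); last by move=> x /=; rewrite andbb.
  by rewrite -/(cut j); lia.
move/eqP; rewrite -leqn0 leqNgt -has_count => /negP; apply.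
apply/hasP; exists (nth (0%N, 0%N) es l) => //.
rewrite -[X in nth _ _ X](subnKC lc) -nth_drop mem_nth // size_drop.
by rewrite ltn_sub2r // (leq_ltn_trans lc).
Qed.

Lemma vsum_cut j : (j <= N)%N ->
  [/\ vlen (vsum (take (cut j) es)) = (\sum_(i < j) cone_steps N i c)%N,
     (\sum_(i < j) i * cone_steps N i c <= N * (vsum (take (cut j) es)).2)%N &
     (N * (vsum (take (cut j) es)).2 <= \sum_(i < j) i.+1 * cone_steps N i c)%N].
Proof.
move=> jN; rewrite -filter_before vlen_vsum /vsum /= !big_filter.
have part (g : nat -> nat) : (\sum_(i < j) g i * cone_steps N i c =
    \sum_(e <- es | before j e) g (cone N e.1 e.2) * vlen e)%N.
  case: j jN => [|j] jN.
    by rewrite big_ord0 big_pred0.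
  rewrite [RHS](partition_big (fun e : vec => inord (cone N e.1 e.2) : 'I_j.+1) predT) //=.
  apply: eq_bigr => i _; rewrite /cone_steps big_distrr /=.
  apply: eq_big => [e|e]; last by move=> /eqP ->.
  rewrite /before /in_cone; apply/eqP/andP => [->|[h /eqP <-]].
    by rewrite ltn_ord inord_val.
  by rewrite inordK.
split.
- transitivity (\sum_(i < j) 1 * cone_steps N i c)%N; last first.
    by apply: eq_bigr => i _; rewrite mul1n.
  by rewrite (part (fun=> 1%N)); apply: eq_bigr => e _; rewrite mul1n.
- rewrite (part id) big_distrr /=; apply: leq_sum => e _.
  by have /andP[] := cone_bounds N e.1 e.2.
- rewrite (part succn) big_distrr /=; apply: leq_sum => e _.
  by have /andP[] := cone_bounds N e.1 e.2.
Qed.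

Lemma cut_all : cut N = size es.
Proof. by rewrite -[RHS](count_predT es); apply: eq_count => e; rewrite /before cone_lt. Qed.

Lemma sum_cone_steps : (\sum_(i < N) cone_steps N i c = 2 * n)%N.
Proof.
have [<- _ _] := vsum_cut (leqnn N).
by rewrite cut_all take_size (steps_vsum hc) /vlen /= mul2n addnn.
Qed.

End Shape.

(** * Distance from a chain with equal cone lengths to the parabola *)

Section Geometry.
Variable R : realType.

Lemma euclidean_dist_le (a b : R * R) :
  euclidean_dist a b <= `|a.1 - b.1| + `|a.2 - b.2|.
Proof.
rewrite /euclidean_dist.
have h : 0 <= `|a.1 - b.1| + `|a.2 - b.2| by rewrite addr_ge0.
rewrite -(@ler_pXn2r _ 2) ?nnegrE ?sqrtr_ge0 // sqr_sqrtr ?addr_ge0 ?sqr_ge0 //.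
rewrite [leRHS]sqrrD !real_normK ?num_real //.
have : 0 <= `|a.1 - b.1| * `|a.2 - b.2| by rewrite mulr_ge0.
by move: (`|_| * _) (_ ^+ 2) (_ ^+ 2) => x y z; lra.
Qed.

Lemma hausdorff_dist_le (X Y : set (R * R)) (r : R) :
  (forall a, X a -> exists2 b, Y b & euclidean_dist a b <= r) ->
  (forall b, Y b -> exists2 a, X a & euclidean_dist a b <= r) ->
  (hausdorff_dist X Y <= r%:E)%E.
Proof.
move=> h1 h2; rewrite /hausdorff_dist ge_max; apply/andP; split.
  apply/ereal_supP => _ [a Xa <-]; apply: ge_ereal_inf.
  by have [b Yb ab] := h1 a Xa; exists (euclidean_dist a b)%:E; [exists b|rewrite lee_fin].
apply/ereal_supP => _ [b Yb <-]; apply: ge_ereal_inf.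
by have [a Xa ab] := h2 b Yb; exists (euclidean_dist a b)%:E; [exists a|rewrite lee_fin].
Qed.

Variables (N n : nat) (c : seq (grid n)).
Hypotheses (N0 : (0 < N)%N) (n0 : (0 < n)%N) (hc : convex_chain c).

Let es := steps c.

Definition vertex (l : nat) : R * R :=
  ((vsum (take l es)).1%:R / n%:R, (vsum (take l es)).2%:R / n%:R).

Lemma vertexE l : (l <= size c)%N ->
  scaled_point (nth (grid_origin n) (grid_origin n :: c) l) = vertex l.
Proof.
move=> hl; rewrite /vertex -(chain_vertex hc hl).
by rewrite /scaled_point.
Qed.

Lemma chain_curveP z : chain_curve c z <->
  exists2 l, (l < size c)%N & segment (vertex l) (vertex l.+1) z.
Proof.
have szip : size (zip (grid_origin n :: c) c) = size c.
  by rewrite size_zip /= minnE subSnn subn1.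
have nthE l : (l < size c)%N ->
    nth (grid_origin n, grid_origin n) (zip (grid_origin n :: c) c) l =
    (nth (grid_origin n) (grid_origin n :: c) l, nth (grid_origin n) c l).
  by move=> hl; rewrite nth_zip_cond szip hl.
split.
  case=> pq /(nthP (grid_origin n, grid_origin n))[l]; rewrite szip => hl <-.
  rewrite nthE //= => hz; exists l => //.
  by rewrite -(vertexE (ltnW hl)) -(vertexE hl).
case=> l hl hz.
exists (nth (grid_origin n, grid_origin n) (zip (grid_origin n :: c) c) l).
  by rewrite mem_nth // szip.
rewrite nthE //=.
by have := hz; rewrite -(vertexE (ltnW hl)) -(vertexE hl).
Qed.

Lemma vertex_in_curve l : (l <= size c)%N -> chain_curve c (vertex l).
Proof.
have c0 : (0 < size c)%N.
  case/and3P: hc => /eqP h _ _; case: (c) h => //= h.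
  by have := congr1 (fun x : grid n => val x.1) h => /= e; move: n0; rewrite -e.
rewrite leq_eqVlt => /orP[/eqP ->|hl]; apply/chain_curveP.
  exists (size c).-1; first by rewrite prednK.
  exists 1; first by rewrite /= in_itv /= ler01 lexx.
  by rewrite prednK // /line_path subrr !mul0r !add0r !mul1r; case: (vertex _).
exists l => //; exists 0; first by rewrite /= in_itv /= ler01 lexx.
by rewrite /line_path subr0 !mul1r !mul0r !addr0; case: (vertex l).
Qed.

Hypothesis flat : forall i, (i < N)%N ->
  (cone_steps N i c)%:R <= (N%:R^-1 + N%:R ^- 3) * (2 * n%:R) :> R.

Let h : R := N%:R^-1.

Let N0' : (0 : R) < N%:R. Proof. by rewrite ltr0n. Qed.
Let n0' : (0 : R) < n%:R. Proof. by rewrite ltr0n. Qed.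
Let h0 : 0 < h. Proof. by rewrite invr_gt0. Qed.
Let h1 : h <= 1. Proof. by rewrite invf_le1 // ler1n. Qed.
Let Nh : N%:R * h = 1. Proof. by rewrite /h divff // gt_eqF. Qed.

(** The lower bound follows from the upper ones, since the lengths add up to 2 n. The N - 1 errors N
    ^ -3 of the other cones add up to less than N ^ -2, whence the cubic tolerance in [flat]. *)
Lemma cone_steps_close i : (i < N)%N ->
  2 * n%:R * (h * (1 - h)) <= (cone_steps N i c)%:R <= 2 * n%:R * (h * (1 + h)).
Proof.
move=> iN; have h3 : N%:R ^- 3 = h * h * h :> R by rewrite -exprVn !exprS expr0 mulr1 mulrA.
have n2 : 0 < 2 * n%:R :> R by rewrite mulr_gt0.
have hh : h * h * h <= h * h by rewrite ler_piMr // mulr_ge0 // ltW.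
apply/andP; split; last first.
  apply: (le_trans (flat iN)); rewrite mulrC ler_pM2l // h3 -/h; lra.
have := sum_cone_steps N0 hc; move=> /(congr1 (fun k => k%:R : R)).
rewrite natr_sum (bigD1 (Ordinal iN)) //= natrM => e.
have : \sum_(j < N | j != Ordinal iN) (cone_steps N j c)%:R <=
    (N%:R - 1) * ((h + h * h * h) * (2 * n%:R)).
  apply: (@le_trans _ _ (\sum_(j < N | j != Ordinal iN) (h + h * h * h) * (2 * n%:R))).
    by apply: ler_sum => j _; rewrite -h3; exact: flat.
  rewrite sumr_const -[leLHS]mulr_natl ler_wpM2r //.
    by rewrite mulr_ge0 ?(ltW n2) // addr_ge0 ?mulr_ge0 // ltW.
  by rewrite (cardC1 (Ordinal iN)) card_ord -subn1 natrB.
have -> : (N%:R - 1) * ((h + h * h * h) * (2 * n%:R)) =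
   (N%:R * h - h + N%:R * h * h * h - h * h * h) * (2 * n%:R) by ring.
rewrite Nh mul1r => hs.
have : 0 <= h * h * h * (2 * n%:R) by rewrite !mulr_ge0 ?(ltW n2) // ltW.
move: e hs; move: (\sum_(_ < _ | _) _) (_%:R : R) => S D; lra.
Qed.

Lemma sum_ord_natr (j : nat) : \sum_(i < j) (i%:R : R) = j%:R * (j%:R - 1) / 2.
Proof.
elim: j => [|j IH]; first by rewrite big_ord0 !mul0r.
by rewrite big_ord_recr /= IH -natr1; field.
Qed.

(** With u = j / N, the first j cones have total scaled length about 2 u; the ordinate is about the
    sum of (i / N) * (2 / N) for i < j, that is u ^ 2, and the abscissa is the difference. *)
Lemma vertex_cut_close j : (j <= N)%N ->
  `|(vertex (cut N c j)).1 - (2 * (j%:R * h) - (j%:R * h) ^+ 2)| <= 5 * h /\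
  `|(vertex (cut N c j)).2 - (j%:R * h) ^+ 2| <= 3 * h.
Proof.
move=> jN; have [vl lo hi] := vsum_cut hc jN.
set v := vsum _ in vl lo hi.
have wS (g : nat -> nat) :
   2 * n%:R * (h * (1 - h)) * \sum_(i < j) (g i)%:R <= (\sum_(i < j) g i * cone_steps N i c)%N%:R
   <= 2 * n%:R * (h * (1 + h)) * \sum_(i < j) (g i)%:R.
  rewrite natr_sum !mulr_sumr; apply/andP; split; apply: ler_sum => i _.
    have /andP[a _] := cone_steps_close (leq_trans (ltn_ord i) jN).
    by rewrite natrM [leLHS]mulrC ler_wpM2l.
  have /andP[_ a] := cone_steps_close (leq_trans (ltn_ord i) jN).
  by rewrite natrM [leRHS]mulrC ler_wpM2l.
have /andP[l1 _] := wS id; have /andP[_ u1] := wS succn.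
have /andP[l2 u2] := wS (fun=> 1%N).
have S0 := sum_ord_natr j.
have S1 : \sum_(i < j) (i.+1%:R : R) = j%:R * (j%:R + 1) / 2.
  by under eq_bigr do rewrite -natr1; rewrite big_split /= S0 sumr_const card_ord; field.
have Sc : \sum_(i < j) (1 : R) = j%:R by rewrite sumr_const card_ord.
rewrite S0 in l1; rewrite S1 in u1; rewrite Sc in l2 u2.
have lo' : 2 * n%:R * (h * (1 - h)) * (j%:R * (j%:R - 1) / 2) <= N%:R * v.2%:R.
  by apply: (le_trans l1); rewrite -natrM ler_nat.
have hi' : N%:R * v.2%:R <= 2 * n%:R * (h * (1 + h)) * (j%:R * (j%:R + 1) / 2).
  by apply: le_trans u1; rewrite -natrM ler_nat.
have vl' : v.1%:R + v.2%:R = (\sum_(i < j) 1 * cone_steps N i c)%N%:R :> R.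
  by rewrite -natrD -/(vlen v) vl; congr (_%:R); apply: eq_bigr => i _; rewrite mul1n.
rewrite -vl' in l2 u2.
rewrite /vertex -/es -/v /=.
pose u : R := j%:R * h.
have u0 : 0 <= u by rewrite mulr_ge0 // ltW.
have u1' : u <= 1 by rewrite -Nh ler_wpM2r ?ler_nat // ltW.
set y : R := v.2%:R / n%:R; set x : R := v.1%:R / n%:R.
have yE : v.2%:R = n%:R * y by rewrite /y mulrC divfK // gt_eqF.
have xE : v.1%:R = n%:R * x by rewrite /x mulrC divfK // gt_eqF.
have nh : 0 < n%:R^-1 :> R by rewrite invr_gt0.
have ylo : (1 - h) * (u * (u - h)) <= y.
  rewrite -(ler_pM2l n0') -(ler_pM2l N0') -yE; apply: le_trans lo'.
  have -> : N%:R * (n%:R * ((1 - h) * (u * (u - h)))) =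
    2 * n%:R * ((N%:R * h) * h * (1 - h)) * (j%:R * (j%:R - 1) / 2) by rewrite /u; field.
  by rewrite Nh mul1r.
have yhi : y <= (1 + h) * (u * (u + h)).
  rewrite -(ler_pM2l n0') -(ler_pM2l N0') -yE; apply: (le_trans hi').
  have -> : N%:R * (n%:R * ((1 + h) * (u * (u + h)))) =
    2 * n%:R * ((N%:R * h) * h * (1 + h)) * (j%:R * (j%:R + 1) / 2) by rewrite /u; field.
  by rewrite Nh mul1r.
have slo : 2 * u * (1 - h) <= x + y.
  rewrite -(ler_pM2l n0') [leRHS]mulrDr -xE -yE; apply: le_trans l2; rewrite /u; lra.
have shi : x + y <= 2 * u * (1 + h).
  rewrite -(ler_pM2l n0') [leLHS]mulrDr -xE -yE; apply: (le_trans u2); rewrite /u; lra.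
have uu : 0 <= u * (1 - u) by rewrite mulr_ge0 //; lra.
have hu : 0 <= h * u <= h by rewrite mulr_ge0 ?(ltW h0) //= ger_pMr.
have huu : 0 <= h * u * u <= h.
  have /andP[a b] := hu; rewrite mulr_ge0 //=; apply: (le_trans _ b).
  by rewrite ler_piMr.
have hhu : 0 <= h * u * h <= h.
  have /andP[a b] := hu; rewrite mulr_ge0 ?(ltW h0) //=; apply: (le_trans _ b).
  by rewrite ler_piMr.
move: hu huu hhu => /andP[? ?] /andP[? ?] /andP[? ?].
rewrite -/u; have [k1 k2] : u ^+ 2 - 3 * h <= y /\ y <= u ^+ 2 + 3 * h by split; lra.
by rewrite !ler_norml; split; apply/andP; split; lra.
Qed.

(** The parameter is t = sqrt y, with sqrt (1 - x) = 1 - t; the tangent there has direction (1 - t,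
    t). *)
Definition parabola_point (t : R) : R * R := (2 * t - t ^+ 2, t ^+ 2).

Lemma parabola_pointP t : 0 <= t <= 1 -> parabola_arc (parabola_point t).
Proof.
move=> /andP[t0 t1]; rewrite /parabola_arc /parabola_point /=.
have e : 1 - (2 * t - t ^+ 2) = (1 - t) ^+ 2 by ring.
have s1 : 0 <= (1 - t) ^+ 2 by rewrite sqr_ge0.
have s2 : 0 <= t * (1 - t) by rewrite mulr_ge0 //; lra.
split.
- by apply/andP; split; lra.
- by rewrite sqr_ge0 /=; lra.
rewrite e !sqrtr_sqr (ger0_norm t0) ger0_norm; lra.
Qed.

Lemma parabola_arcP b : parabola_arc b ->
  exists2 t, 0 <= t <= 1 & b = parabola_point t :> R * R.
Proof.
case: b => x y [/= /andP[x0 x1] /andP[y0 y1] e].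
exists (Num.sqrt y).
  rewrite sqrtr_ge0 /=; have := sqrtr_ge0 (1 - x); lra.
have ys : Num.sqrt y ^+ 2 = y by rewrite sqr_sqrtr.
have xs : Num.sqrt (1 - x) ^+ 2 = 1 - x by rewrite sqr_sqrtr // subr_ge0.
have xe : Num.sqrt (1 - x) = 1 - Num.sqrt y by lra.
rewrite xe in xs; rewrite /parabola_point ys; congr (_, _); lra.
Qed.

(** A point of an edge in the cone i lies between the vertices at cuts i and i + 1, at l1-distance
    at most 4 h: the error is (4 + 5 + 3) h. Conversely t is within h of some j * h, which moves the
    coordinates on the parabola by 4 h and 2 h: the error is (9 + 5) h. *)
Lemma flat_chain_close :
  (hausdorff_dist (chain_curve c) (@parabola_arc R) <= (14 * h)%:E)%E.
Proof.
have jh j : (j <= N)%N -> 0 <= j%:R * h <= 1.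
  move=> jN; apply/andP; split; first by rewrite mulr_ge0 // ltW.
  by rewrite -[leRHS]Nh ler_wpM2r ?ler_nat // ltW.
apply: hausdorff_dist_le => [z /chain_curveP[l hl [t ht zE]]|b /parabola_arcP[t t01 ->]].
  have /andP[t0 t1] : 0 <= t <= 1 by move: ht; rewrite /= in_itv.
  have hl' : (l < size es)%N by rewrite /es size_steps.
  pose e := nth (0%N, 0%N) es l; pose i := cone N e.1 e.2.
  have iN : (i < N)%N by exact: cone_lt.
  have c1 : (cut N c i <= l)%N.
    by rewrite leqNgt -(nth_before N0 hc i hl') /before ltnn.
  have c2 : (l < cut N c i.+1)%N by rewrite -(nth_before N0 hc i.+1 hl') /before ltnS.
  have [v1 v2] := vertex_cut_close (ltnW iN).
  have [D1 _ _] := vsum_cut hc (ltnW iN).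
  have [D2 _ _] := vsum_cut hc iN.
  have /andP[_ Di] := cone_steps_close iN.
  move: D2; rewrite big_ord_recr /= -D1 /vlen => D2.
  exists (parabola_point (i%:R * h)); first by apply: parabola_pointP; apply/jh/ltnW.
  apply: (le_trans (euclidean_dist_le _ _)).
  have z1 : z.1 = (1 - t) * (vertex l).1 + t * (vertex l.+1).1 by rewrite -zE.
  have z2 : z.2 = (1 - t) * (vertex l).2 + t * (vertex l.+1).2 by rewrite -zE.
  have pp u : ((parabola_point u).1 = 2 * u - u ^+ 2) * ((parabola_point u).2 = u ^+ 2).
    by [].
  rewrite z1 z2 !pp.
  have vm k m : (k <= m)%N -> (vertex k).1 <= (vertex m).1 /\ (vertex k).2 <= (vertex m).2.
    by move=> /(leq_vsum_take es)[km1 km2]; split;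
      rewrite ler_wpM2r ?invr_ge0 ?ler_nat // ltW.
  have Dn : (vertex (cut N c i.+1)).1 + (vertex (cut N c i.+1)).2 <=
      (vertex (cut N c i)).1 + (vertex (cut N c i)).2 + 4 * h.
    rewrite /vertex /fst /snd -!mulrDl -!natrD D2 natrD mulrDl lerD2l ler_pdivrMr //.
    apply: (le_trans Di).
    have : 0 <= n%:R * h * (1 - h).
      by rewrite mulr_ge0 ?subr_ge0 ?h1 // mulr_ge0 // ltW.
    by lra.
  have [p1' q1'] := vm _ _ c1.
  have [p2' q2'] := vm _ _ (leqnSn l).
  have [p3' q3'] := vm _ _ c2.
  move: Dn p1' q1' p2' q2' p3' q3' v1 v2.
  move: (vertex (cut N c i)) (vertex (cut N c i.+1)) (vertex l) (vertex l.+1).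
  move=> [a1 a2] [d1 d2] [b1 b2] [e1 e2] /=.
  move=> Dn p1' q1' p2' q2' p3' q3' v1 v2.
  have conv (x y : R) : x <= y -> x <= (1 - t) * x + t * y <= y.
    move=> xy; have : 0 <= t * (y - x) by rewrite mulr_ge0 ?subr_ge0.
    have : 0 <= (1 - t) * (y - x) by rewrite mulr_ge0 ?subr_ge0.
    by move=> *; apply/andP; split; lra.
  have /andP[k1 k2] := conv _ _ p2'; have /andP[k3 k4] := conv _ _ q2'.
  move: k1 k2 k3 k4; move: (_ + t * e1) (_ + t * e2) => X Y k1 k2 k3 k4.
  set pa := 2 * _ - _ in v1 *; set pb := _ ^+ 2 in v2 *.
  have n1 : `|X - pa| <= (X - a1) + 5 * h.
    rewrite -(subrKA a1) (le_trans (ler_normD _ _)) // lerD //.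
    by rewrite ger0_norm // subr_ge0; lra.
  have n2 : `|Y - pb| <= (Y - a2) + 3 * h.
    rewrite -(subrKA a2) (le_trans (ler_normD _ _)) // lerD //.
    by rewrite ger0_norm // subr_ge0; lra.
  have := h0; lra.
have tN0 : 0 <= t * N%:R by have /andP[t0 _] := t01; rewrite mulr_ge0.
have /andP[j1 j2] := truncn_itv tN0; set j := Num.truncn _ in j1 j2.
have /andP[t0 t1] := t01.
have jN : (j <= N)%N by rewrite -(ler_nat R) (le_trans j1) // ger_pMl.
exists (vertex (cut N c j)).
  by apply: vertex_in_curve; rewrite -size_steps; exact: cut_le.
apply: (le_trans (euclidean_dist_le _ _)).
have [v1 v2] := vertex_cut_close jN.
have /andP[u0 u1] := jh _ jN.
have ut : j%:R * h <= t.
  by have := ler_wpM2r (ltW h0) j1; rewrite -mulrA Nh mulr1.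
have tu : t <= j%:R * h + h.
  by have := ler_wpM2r (ltW h0) (ltW j2); rewrite -mulrA Nh mulr1 -natr1 mulrDl mul1r.
move: v1 v2 u0 u1 ut tu; move: (j%:R * h) => u v1 v2 u0 u1 ut tu.
have d1 : `|t ^+ 2 - u ^+ 2| <= 2 * h.
  rewrite subr_sqr normrM ger0_norm ?subr_ge0 // ger0_norm ?addr_ge0 //.
  have : (t - u) * (t + u) <= h * 2 by rewrite ler_pM ?subr_ge0 ?addr_ge0 //; lra.
  by lra.
move: v1 v2 d1; move: (vertex _) => [X Y].
rewrite /parabola_point /= !ler_norml => /andP[? ?] /andP[? ?] /andP[? ?].
have n1 : `|X - (2 * t - t ^+ 2)| <= 9 * h by rewrite ler_norml; apply/andP; split; lra.
have n2 : `|Y - t ^+ 2| <= 5 * h by rewrite ler_norml; apply/andP; split; lra.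
lra.
Qed.

End Geometry.

(** * Choice of the parameters and conclusion *)

Lemma linear_expR_small (R : realType) (c M e : R) : 0 < c -> 0 < M -> 0 < e ->
  exists2 B, 1 <= B & forall y, B <= y -> M * (4 * y + 12) * expR (- (c * y)) <= e.
Proof.
move=> c0 M0 e0; have c2 : 0 < c ^+ 2 by rewrite exprn_gt0.
have B0 : 0 < 32 * M / (c ^+ 2 * e) by rewrite divr_gt0 ?mulr_gt0.
exists (1 + 32 * M / (c ^+ 2 * e)) => [|y hy]; first by lra.
have y1 : 1 <= y by lra.
have cy0 : 0 <= c * y by rewrite mulr_ge0 ?ltW //; lra.
have hB : 32 * M <= y * (c ^+ 2 * e) by rewrite -ler_pdivrMr ?mulr_gt0 //; lra.
have h1 := @expR_ge1Dxn R (c * y) 1 cy0.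
have h2 : (c * y) ^+ 2 / 2 <= expR (c * y).
  by move: h1; rewrite (_ : 2`!%:R = 2) //; lra.
rewrite expRN ler_pdivrMr ?expR_gt0 //.
apply: (@le_trans _ _ (e * ((c * y) ^+ 2 / 2))); last by rewrite ler_pM2l.
apply: (@le_trans _ _ (16 * M * y)).
  have : 0 <= M * (y - 1) by rewrite mulr_ge0 ?ltW //; lra.
  by lra.
have := ler_wpM2r (_ : 0 <= y / 2) hB.
rewrite divr_ge0 //; last by lra.
by move=> /(_ isT); rewrite exprMn; lra.
Qed.

Lemma card_le_sum (T : finType) (I : finType) (P : pred T) (Q : I -> pred T) :
  (forall x, P x -> exists i, Q i x) -> (#|P| <= \sum_i #|Q i|)%N.
Proof.
move=> h; rewrite -sum1_card big_mkcond.
under [leqRHS]eq_bigr do rewrite -sum1_card big_mkcond.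
rewrite exchange_big /=; apply: leq_sum => x _.
case: ifP => // /h[i Qx]; rewrite (bigD1 i) //=.
by rewrite (_ : (x \in Q i) = true).
Qed.

Lemma far_chain_heavy (R : realType) (eps : R) (N n : nat) (c : seq (grid n)) :
  (0 < N)%N -> (0 < n)%N -> 14 / N%:R <= eps -> convex_chain c ->
  (eps%:E < hausdorff_dist (chain_curve c) (@parabola_arc R))%E ->
  exists i : 'I_N, (N%:R^-1 + N%:R ^- 3) * (2 * n%:R) < (cone_steps N i c)%:R :> R.
Proof.
move=> N0 n0 hN hc; apply: contraTP => h; rewrite -leNgt.
apply: le_trans (_ : ((14 * N%:R^-1)%:E <= _)%E); last by rewrite lee_fin.
apply: flat_chain_close => // i iN; rewrite leNgt; apply/negP => hi.
by apply: h; exists (Ordinal iN).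
Qed.

Theorem mainTheorem1 (R : realType) (eps : R) (heps : 0 < eps) :
  (fun nk : nat * nat =>
     chain_prob nk.2
       (fun c : seq (grid nk.1) =>
          (eps%:E < hausdorff_dist (chain_curve c) (@parabola_arc R))%E) : R)
    @ filter_prod \oo \oo --> (0 : R).
Proof.
apply/cvgrPdist_le => e e0.
(* N makes the distance 14 / N of [flat_chain_close] at most eps; N >= 3 gives [eta_half], on which
   the removal of an edge relies. *)
have [N1 hN1] := natr_large (14 / eps + 3).
have := hN1 N1 (leqnn _); move: N1 {hN1} => N hN.
have ep : 0 < 14 / eps by rewrite divr_gt0.
have N3 : (3 <= N)%N by rewrite -(ler_nat R); lra.
have N0 : (0 < N)%N by exact: leq_trans N3.
have N0' : (0 : R) < N%:R by rewrite ltr0n.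
have N3' : (3 : R) <= N%:R by rewrite ler_nat.
have hNe : 14 / N%:R <= eps.
  have : 14 / eps <= N%:R by lra.
  by rewrite !ler_pdivrMr // mulrC.
have eta0 : 0 < N%:R ^- 3 :> R by rewrite invr_gt0 exprn_gt0.
have eta_half : (N%:R^-1 + N%:R ^- 3) * 2 <= 1 :> R.
  have i3 : (N%:R : R)^-1 <= 3^-1 by rewrite lef_pV2 ?posrE.
  have i0 : 0 < (N%:R : R)^-1 by rewrite invr_gt0.
  rewrite -exprVn; move: (_^-1) i3 i0 => x x3 x0.
  have : x ^+ 3 <= x / 9 by rewrite exprS ler_pM2l // expr2; nra.
  by lra.
have [q1 [c1 [b1 [B1 [q13 /andP[c10 c11] b10 B10 tilt1]]]]] := cone_energy_tilt N0 eta0.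
(* The loss 6 / s of the lower bound is then at most half of the Chernoff gain c1. *)
have [s1 hs1] := natr_large (12 / c1 + 2).
have := hs1 s1 (leqnn _); move: s1 {hs1} => s hs.
have c12 : 0 < 12 / c1 by rewrite divr_gt0.
have s2 : (1 < s)%N by rewrite -(ler_nat R); lra.
have s0 : (0 < s)%N by exact: ltnW.
have s0' : (0 : R) < s%:R by rewrite ltr0n.
have hsc : 6 / s%:R <= c1 / 2.
  have : 12 / c1 <= s%:R by lra.
  by rewrite !ler_pdivrMr //; lra.
have M0 : (0 < 4 * s ^ 2)%N by rewrite muln_gt0 expn_gt0 s0.
have M0' : (0 : R) < (4 * s ^ 2)%:R by rewrite ltr0n.
have eta20 : 0 < (4 * s ^ 2)%:R ^- 2 :> R by rewrite invr_gt0 exprn_gt0.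
have [q2 [c2 [b2 [B2 [q23 /andP[c20 c21] b20 B20 tilt2]]]]] := cone_energy_tilt M0 eta20.
have c1h : 0 < c1 / 2 by lra.
(* B3 brings the final quotient below e; B4 makes unbalanced configurations negligible in
   [balanced_count]. *)
have [B3 B31 small3] := linear_expR_small (c := c1 / 2) (M := 2 * N%:R) (e := e)
  c1h (mulr_gt0 (ltr0Sn _ 1) N0') e0.
have [B4 B41 small4] := linear_expR_small (c := c2) (M := 2 * (4 * s ^ 2)%:R) (e := 1 / 4)
  c20 (mulr_gt0 (ltr0Sn _ 1) M0') (divr_gt0 ltr01 (ltr0Sn _ 3)).
pose b0 := Num.min 1 (Num.min b1 b2).
pose B0 := Num.max B1 (Num.max B2 (Num.max B3 B4)).
have b01 : 0 < b0 <= 1 by rewrite !lt_min ltr01 b10 b20 /= ge_min lexx.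
have B01 : 1 <= B0 by rewrite !le_max B31 !orbT.
have [n0 [k0 hnk]] := choose_beta (off_middle s) b01 B01.
exists ([set n | (maxn 1 n0 <= n)%N], [set k | (k0.+2 <= k)%N]).
  by split; [exists (maxn 1 n0)|exists k0.+2].
case=> n k [/=]; rewrite geq_max => /andP[n1 hn].
(* k is K + 2: configurations use at most K + 1 edges, and one edge is reserved for the
   completion. *)
case: k => [|[|K]] // hK; have {}hK : (k0 <= K)%N by [].
have [beta [/andP[beta0 betab] hB PhiE]] := hnk n K hn hK.
move: betab; rewrite !le_min => /and3P[_ bb1 bb2].
move: hB; rewrite !ge_max => /and4P[hB1 hB2 hB3 hB4].
move: PhiE; set lam := mode_activity _ K => PhiE.
have lam01 : 0 < lam <= 1 by apply/mode_activity_itv/size_weight_log_concave.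
have lam0 : 0 < lam by have /andP[] := lam01.
have t1 : tilted_energies N n q1 (N%:R ^- 3) c1 beta lam.
  by apply: tilt1 => //; rewrite beta0.
have t2 : tilted_energies (4 * s ^ 2) n q2 ((4 * s ^ 2)%:R ^- 2) c2 beta lam.
  by apply: tilt2 => //; rewrite beta0.
set Phi := beta * n%:R in hB1 hB2 hB3 hB4 PhiE.
have Phi1 : 1 <= Phi by exact: le_trans hB3.
have small : (2 * Phi + 6) * (2 * (4 * s ^ 2)%:R) * expR (- (c2 * Phi)) <= 1 / 4.
  apply: le_trans (small4 _ hB4); rewrite ler_pM2r ?expR_gt0 // mulrC ler_pM2l.
    by lra.
  by rewrite mulr_gt0.
have lower := balanced_count s0 (leq_trans (ltn0Sn 2) q23) beta0 erefl t2 PhiE small.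
rewrite -/lam -/Phi in lower.
set bal := #|_|%N in lower.
have balT := balanced_le_chains R K s2 n1.
rewrite -/bal in balT.
rewrite sub0r normrN /chain_prob.
set T := #|[pred c : K.+2.-bseq (grid n) | convex_chain c]| in balT *.
rewrite ger0_norm ?divr_ge0 ?ler0n //.
have lamK : 0 < lam ^+ K.+1 by rewrite exprn_gt0.
have lamK1 : lam ^+ K.+1 <= 1 by have /andP[_ l1] := lam01; rewrite exprn_ile1 // ltW.
have ex0 := expR_gt0 (3 * Phi - 6 / s%:R * Phi).
(* The lower bound also shows that chains exist, so that the quotient is not a division by zero. *)
have T0 : (0 : R) < T%:R.
  rewrite ltr0n; apply: leq_trans balT; rewrite lt0n; apply/eqP => b0'.
  by move: lower; rewrite b0' !mulr0 leNgt ex0.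
rewrite ler_pdivrMr //.
pose heavy (i : 'I_N) := [pred c : K.+2.-bseq (grid n) | convex_chain c &
  ((N%:R^-1 + N%:R ^- 3) * (2 * n%:R) < (cone_steps N i c)%:R :> R)].
apply: (@le_trans _ _ (\sum_(i < N) #|heavy i|)%N%:R).
  rewrite ler_nat; apply: card_le_sum => c /andP[hc far].
  have [i hi] := far_chain_heavy N0 n1 hNe hc far.
  by exists i; rewrite /heavy /= hc.
have heavy_le (i : 'I_N) : #|heavy i|%:R * lam ^+ K.+1 <=
    2 * expR (3 * Phi - c1 * Phi).
  have h1 := heavy_chain_count i K n1 (ltW eta0) eta_half.
  have h2 := heavy_cone_count K (leq_trans (ltn0Sn 2) q13) beta0 lam01 t1 (ltn_ord i) PhiE.
  (* As c1 <= 1, this exponential is at least 1 and absorbs the one-edge chain that was counted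
     apart. *)
  have e1 : 1 <= expR (3 * Phi - c1 * Phi).
    rewrite -[leLHS]expR0 ler_expR.
    by clear -c11 Phi1; nra.
  have combine (x y z : R) : x <= 1 + y -> y * lam ^+ K.+1 <= z -> 1 <= z ->
      x * lam ^+ K.+1 <= 2 * z.
    by move=> /(ler_wpM2r (ltW lamK)); clear -lamK1; lra.
  apply: combine h2 e1; rewrite -(natrD _ 1%N) ler_nat; exact: h1.
rewrite natr_sum -(ler_pM2r lamK) mulr_suml.
apply: (@le_trans _ _ (\sum_(i < N) 2 * expR (3 * Phi - c1 * Phi))).
  by apply: ler_sum => i _; exact: heavy_le.
rewrite sumr_const card_ord -[leLHS]mulr_natl.
have balT' : bal%:R <= T%:R :> R by rewrite ler_nat.
have P12 : 0 < 4 * Phi + 12 by clear -Phi1; lra.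
have up : expR (3 * Phi - 6 / s%:R * Phi) <= (4 * Phi + 12) * (lam ^+ K.+1 * T%:R).
  by apply: (le_trans lower); rewrite (ler_pM2l P12) (ler_pM2l lamK).
rewrite -(ler_pM2l P12).
have -> : (4 * Phi + 12) * (e * T%:R * lam ^+ K.+1) =
  e * ((4 * Phi + 12) * (lam ^+ K.+1 * T%:R)) by ring.
apply: (@le_trans _ _ (e * expR (3 * Phi - 6 / s%:R * Phi))); last first.
  by rewrite ler_pM2l.
apply: (@le_trans _ _ (2 * N%:R * (4 * Phi + 12) * expR (- (c1 / 2 * Phi)) *
    expR (3 * Phi - 6 / s%:R * Phi))); last first.
  by rewrite ler_pM2r //; exact: small3.
have -> : (4 * Phi + 12) * (N%:R * (2 * expR (3 * Phi - c1 * Phi))) =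
  2 * N%:R * (4 * Phi + 12) * expR (3 * Phi - c1 * Phi) by ring.
rewrite -[leRHS]mulrA ler_pM2l ?mulr_gt0 // -expRD ler_expR.
have := ler_wpM2r (_ : 0 <= Phi) hsc; rewrite (le_trans ler01) // => /(_ isT).
by clear; lra.
Qed.
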